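(* (i) Let $K\subset\mathbb{R}^2$ be a bounded convex set, symmetric about the origin and with non-empty interior. For $\theta\in[0,2\pi)$ let $\omega=(\cos\theta,\sin\theta)$, $S_\theta=\sup_{x\in K}x\cdot\omega$, and for $\epsilon>0$ let $l(\theta,\epsilon)$ denote the length of the chord $\{x\in K: x\cdot\omega=S_\theta-\epsilon\}$. Suppose that there exists a constant $c>0$ such that $l(\theta,\epsilon)\le c\sqrt{\epsilon}$ for all $\theta$ and all $\epsilon>0$. Let $E\subset[0,1]^2$ be a compact set of Hausdorff dimension $\alpha>\frac12$. Then the Hausdorff dimension of $\Delta_K(E)$ is at least $\min(1,\alpha-\frac12)$. If furthermore $\alpha>\frac32$, then $\Delta_K(E)$ has positive Lebesgue measure. (ii) Let $d\ge2$ and let $K\subset\mathbb{R}^d$ be a bounded convex set, symmetric about the origin and with non-empty interior, such that $\partial K$ is smooth and has everywhere non-vanishing Gaussian curvature. Let $E\subset[0,1]^d$ be a compact set of Hausdorff dimension $\alpha>\frac{d+1}{2}$. Then $\Delta_K(E)$ has positive Lebesgue measure.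
   Context: For a bounded convex set $K\subset\mathbb{R}^d$, symmetric about the origin and with non-empty interior, $\|\cdot\|_K$ is the norm induced by $K$ (the norm whose unit ball is $K$, up to boundary points). The $K$-distance set of $E\subset\mathbb{R}^d$ is $\Delta_K(E)=\{\|x-y\|_K: x,y\in E\}\subset[0,\infty)$; ''Lebesgue measure'' of $\Delta_K(E)$ means one-dimensional Lebesgue measure. *)

(* Defs.v *)
From HB Require Import structures.
From mathcomp Require Import all_boot all_order all_algebra.
From mathcomp Require Import all_classical all_reals all_analysis.

Set Implicit Arguments.
Unset Strict Implicit.
Unset Printing Implicit Defensive.

Import Order.TTheory GRing.Theory Num.Theory.
Import numFieldNormedType.Exports.

Local Open Scope classical_set_scope.
Local Open Scope ring_scope.

(* The norm of the library on ['rV[R]_d] is the sup norm.  It is used only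
   through its topology; metric notions use the Euclidean distance [eucl_dist]. *)

Section Euclidean.
Context {R : realType} {d : nat}.
Implicit Types (x y : 'rV[R]_d).

Definition dot x y : R := \sum_(j < d) x 0 j * y 0 j.

Definition eucl_norm x : R := Num.sqrt (dot x x).

Definition eucl_dist x y : R := eucl_norm (x - y).

Definition unit_cube : set 'rV[R]_d := [set x | forall j, 0 <= x 0 j <= 1].

End Euclidean.

Section Hausdorff.
Context {R : realType} {T : Type} (dist : T -> T -> R).
Implicit Types (A : set T) (s delta : R).
Local Open Scope ereal_scope.

(* [0] is inserted so that the empty set has diameter [0]. *)
Definition ediam A : \bar R :=
  ereal_sup (0 |` [set (dist x y)%:E | x in A & y in A]).

(* The empty set costs [0] also for [s = 0], where [poweR 0 0 = 1]. *)
Definition hausdorff_cost s A : \bar R :=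
  if A == set0 then 0 else poweR (ediam A) s.

Definition hausdorff_premeasure s delta A : \bar R :=
  ereal_inf [set \sum_(0 <= k <oo) hausdorff_cost s (F k) | F in
    [set F : nat -> set T | A `<=` \bigcup_k F k /\
                            forall k, ediam (F k) <= delta%:E]].

Definition hausdorff_measure s A : \bar R :=
  ereal_sup [set hausdorff_premeasure s delta A | delta in
    [set delta : R | (0 < delta)%R]].

Definition hausdorff_dim A : \bar R :=
  ereal_inf [set s%:E | s in
    [set s : R | (0 <= s)%R /\ hausdorff_measure s A = 0]].

End Hausdorff.

Section Bodies.
Context {R : realType} {d : nat}.
Implicit Types (K E : set 'rV[R]_d) (x : 'rV[R]_d).

Definition symmetric_convex_body K : Prop :=
  [/\ bounded_set K,
      convex_set (K : set (convex_lmodType 'rV[R]_d)),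
      (forall x, K x -> K (- x)) &
      K° !=set0].

Definition body_norm K x : R := inf [set t : R | 0 < t /\ K (t^-1 *: x)].

Definition distance_set K E : set R :=
  [set body_norm K (x - y) | x in E & y in E].

Definition support_fun K x : R := sup [set dot y x | y in K].

Definition boundary K : set 'rV[R]_d := closure K `\` K°.

End Bodies.

Section Chords.
Context {R : realType}.
Implicit Types (K : set 'rV[R]_2) (theta eps : R).

Definition direction theta : 'rV[R]_2 :=
  \row_j (if j == 0 then cos theta else sin theta).

Definition chord K theta eps : set 'rV[R]_2 :=
  [set x | K x /\
    dot x (direction theta) = support_fun K (direction theta) - eps].

(* A chord of a convex set is a segment, possibly without its end points, so
   that its length is its diameter ([0] if the chord is empty). *)
Definition chord_length K theta eps : \bar R := ediam eucl_dist (chord K theta eps).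

End Chords.

Fixpoint Ck {R : realType} {V W : normedModType R} (k : nat) (f : V -> W) :
    Prop :=
  if k is k'.+1 then
    (forall x, differentiable f x) /\ (forall v, Ck k' (fun x => 'D_v f x))
  else continuous f.

Definition smooth {R : realType} {V W : normedModType R} (f : V -> W) : Prop :=
  forall k, Ck k f.

(* Gauss-Kronecker curvature [det II / det I] of a parametrized hypersurface
   [X], for the orientation given by [unit_normal].  Row [i] of ['J X u] is the
   [i]-th partial derivative of [X] at [u]. *)
Section GaussCurvature.
Context {R : realType} {d : nat} (X : 'rV[R]_d.-1 -> 'rV[R]_d).
Implicit Types (u : 'rV[R]_d.-1).

(* Cross product of the [d.-1] partial derivatives of [X]. *)
Definition cross_normal u : 'rV[R]_d :=
  \row_j ((-1) ^+ j * \det (col' j ('J X u))).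

Definition unit_normal u : 'rV[R]_d :=
  (eucl_norm (cross_normal u))^-1 *: cross_normal u.

Definition first_form u : 'M[R]_d.-1 :=
  \matrix_(i, j) dot ('D_(delta_mx 0 i) X u) ('D_(delta_mx 0 j) X u).

Definition second_form u : 'M[R]_d.-1 :=
  \matrix_(i, j)
    dot ('D_(delta_mx 0 i) (fun w => 'D_(delta_mx 0 j) X w) u) (unit_normal u).

Definition gauss_curvature u : R := \det (second_form u) / \det (first_form u).

End GaussCurvature.

Section Hypersurfaces.
Context {R : realType} {d : nat}.
Implicit Types (S : set 'rV[R]_d) (p : 'rV[R]_d) (i : 'I_d).

(* The point of the graph of [g] over [u], the [i]-th coordinate being the
   dependent one: its other coordinates are those of [u], in order. *)
Definition graph_chart i (g : 'rV[R]_d.-1 -> R) (u : 'rV[R]_d.-1) : 'rV[R]_d :=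
  \row_j (if unlift i j is Some k then u 0 k else g u).

(* [col' i x] is [x] without its [i]-th coordinate. *)
Definition smooth_graph_near S p i (g : 'rV[R]_d.-1 -> R) : Prop :=
  smooth g /\ \forall x \near p, S x <-> x = graph_chart i g (col' i x).

Definition smooth_hypersurface S : Prop :=
  forall p, S p -> exists i g, smooth_graph_near S p i g.

(* Meaningful for smooth hypersurfaces; the graph representation chosen near
   [p] changes the curvature at most by a sign. *)
Definition nonvanishing_curvature S : Prop :=
  forall p, S p -> forall i g, smooth_graph_near S p i g ->
    gauss_curvature (graph_chart i g) (col' i p) != 0.

End Hypersurfaces.

(* Main.v *)
(* Let [N] be the norm induced by [K], and let [sigma] be a surface measure on
   the boundary of [K] whose Fourier transform is [O(|zeta| ^ -gamma)].  If [E]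
   has dimension [> s], a Frostman measure [mu] on [E] satisfies
   [mu (B(x, r)) <= C r ^ s].  Testing [mu * mu] against Fejer kernels centred on
   the dilates [t * sigma] bounds the mass of the pairs with
   [|N(x - y) - t| < eps] by
   [eps * \sum_k |mu^(k)| ^ 2 * |sigma^(t k)| <= C eps ^ beta] as soon as
   [beta + d - 1 - gamma < s]: hence any cover of the distance set by intervals
   of lengths [e_j] has [\sum_j e_j ^ beta >= c > 0].

   The decay is obtained locally and summed over a finite cover of the boundary.
   For (i), [gamma = 1/2]: the chord condition says that the boundary is the
   graph of a uniformly strongly concave function, and van der Corput's lemma
   applies.  For (ii), [gamma = (d - 1) / 2]: the boundary is the graph of a
   smooth function with invertible Hessian; one integrates by parts away from
   the stationary directions and squares the integral near them.

   All integrals are ultralimits of Riemann sums, which avoids measurability. *)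

From HB Require Import structures.
From mathcomp Require Import all_boot all_order all_algebra.
From mathcomp Require Import all_classical all_reals all_analysis.
From mathcomp Require Import zify ring lra finmap complex.
Require Import Defs.

Set Implicit Arguments.
Unset Strict Implicit.
Unset Printing Implicit Defensive.

Import Order.TTheory GRing.Theory Num.Theory.
Import numFieldNormedType.Exports.

Local Open Scope classical_set_scope.
Local Open Scope ring_scope.

(** The measure [mu] is never passed to a limit. For each level [J] it is a finite sum of atoms on
    [E], with the growth condition imposed on dyadic cells of level at most [J]; its mass is bounded
    below by a Hausdorff content, and all constants are independent of [J]. The distance set is
    compact, so a countable cover can be thickened and made finite, and [J] is chosen afterwards,
    fine enough for its shortest interval. Fejer kernels are nonnegative trigonometric polynomials:
    every Fourier expansion is a finite sum, and positivity allows passing between frequency sums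
    and pair sums. Near [t = 0] the dilates [t * sigma] lose their decay; the pairs at small
    distance are discarded, and the growth of [mu] limits them to half of the pair mass. At
    frequency [2 ^ i] the decay gives [2 ^ (- gamma * i)] and the growth gives [2 ^ ((d - s) * i)];
    the sum up to level [j] must stay below [2 ^ ((1 - beta) * j)], whence the condition on [s]. For
    [beta = 1] it reads [s > d - gamma]. *)

Lemma nat_above (R : realType) (x : R) : exists n : nat, x < n%:R.
Proof. by exists (Num.truncn x).+1; exact: truncnS_gt. Qed.

(** * Riemann sums along an ultrafilter *)

Section RiemannFunctional.
Context {R : realType}.
Implicit Types (f g : R -> R) (B M : nat).

(** For [k < 2 * m * m!] these points run over [[-m, m)] with mesh [1 / m!]. The factorial makes
    every fixed rational a multiple of the mesh for large [m], so that rational translations become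
    exact reindexings. *)
Definition grid_point (m k : nat) : R :=
  (k%:R - (m * m`!)%N%:R) / m`!%:R.

Definition grid_mean (m : nat) f : R :=
  m`!%:R^-1 * \sum_(0 <= k < 2 * m * m`!) f (grid_point m k).

Definition grid_ultrafilter : set_system nat :=
  projT1 (cid (ultraFilterLemma (F := \oo) _)).

Lemma grid_ultrafilterP :
  UltraFilter grid_ultrafilter /\ \oo `<=` grid_ultrafilter.
Proof. by rewrite /grid_ultrafilter; case: cid. Qed.

#[local] Instance grid_ultrafilter_ultra : UltraFilter grid_ultrafilter.
Proof. by have [] := grid_ultrafilterP. Qed.

(* An ultralimit of Riemann sums over [m`!^-1 * Z]: a positive linear functional
   that is invariant under rational translations, for arbitrary bounded
   functions of bounded support. *)
Definition riemann f : R := lim (grid_mean ^~ f @ grid_ultrafilter).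

Definition bdd_supp f : Prop :=
  exists M B, (forall x, `|f x| <= M%:R) /\
              (forall x, B%:R < `|x| -> f x = 0).

Lemma fact_gt0R m : 0 < m`!%:R :> R.
Proof. by rewrite ltr0n fact_gt0. Qed.

Lemma big_nat_window (g : nat -> R) (l n a b : nat) :
  (l <= a)%N -> (a <= b)%N -> (b <= n)%N ->
  (forall k, (k < a)%N || (b <= k)%N -> g k = 0) ->
  \sum_(l <= k < n) g k = \sum_(a <= k < b) g k.
Proof.
move=> la ab bn g0.
rewrite (big_cat_nat (n := b))//=; last exact: leq_trans ab.
rewrite (big_cat_nat (n := a))//=.
rewrite big_nat_cond big1 ?add0r; last first.
  by move=> k /andP[/andP[_ ka] _]; rewrite g0// ka.
rewrite [X in _ + X]big_nat_cond [X in _ + X]big1 ?addr0//.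
by move=> k /andP[/andP[bk _] _]; rewrite g0// bk orbT.
Qed.

Lemma grid_point_out m k B : (B <= m)%N ->
  (k < (m - B) * m`!)%N || ((m + B) * m`! + 1 <= k)%N ->
  B%:R < `|grid_point m k|.
Proof.
move=> Bm; have F0 := fact_gt0R m.
have BF : 0 <= B%:R * m`!%:R :> R by rewrite mulr_ge0.
rewrite /grid_point normrM [X in _ * X]gtr0_norm ?invr_gt0// ltr_pdivlMr//.
have -> : (m * m`!)%N%:R = m%:R * m`!%:R :> R by rewrite natrM.
case/orP => h.
  have : (k%:R < (m%:R - B%:R) * m`!%:R :> R) by rewrite -natrB// -natrM ltr_nat.
  by move=> h'; rewrite ltr0_norm; nra.
have : ((m%:R + B%:R) * m`!%:R + 1 <= k%:R :> R).
  by rewrite -natrD -natrM -[1]/(1%:R) -natrD ler_nat.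
by move=> h'; rewrite gtr0_norm; nra.
Qed.

(** The upper index ends with [+ 1] because the support lies in the closed interval [[-B, B]], whose
    right end point is itself a grid point. *)
Lemma grid_mean_window m f B : (B < m)%N ->
  (forall x, B%:R < `|x| -> f x = 0) ->
  grid_mean m f = m`!%:R^-1 *
    \sum_((m - B) * m`! <= k < (m + B) * m`! + 1) f (grid_point m k).
Proof.
move=> Bm f0; congr (_ * _); have := fact_gt0 m => F0; apply: big_nat_window.
- by [].
- by nia.
- by nia.
- by move=> k h; apply: f0; apply: grid_point_out => //; exact: ltnW.
Qed.

Lemma grid_mean_bound m f M B : (B < m)%N ->
  (forall x, `|f x| <= M%:R) -> (forall x, B%:R < `|x| -> f x = 0) ->
  `|grid_mean m f| <= M%:R * (2 * B%:R + 1).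
Proof.
move=> Bm fM f0; rewrite (grid_mean_window Bm f0).
have F0 := fact_gt0R m.
rewrite normrM gtr0_norm ?invr_gt0// ler_pdivrMl//.
apply: le_trans (ler_norm_sum _ _ _) _.
apply: (@le_trans _ _ (\sum_((m - B) * m`! <= k < (m + B) * m`! + 1) M%:R)).
  by apply: ler_sum => i _.
rewrite sumr_const_nat -[M%:R *+ _]mulr_natr [leRHS]mulrCA ler_wpM2l//.
have -> : ((m + B) * m`! + 1 - (m - B) * m`! = 2 * B * m`! + 1)%N.
  by have := ltnW Bm; nia.
have : 1 <= m`!%:R :> R by rewrite ler1n fact_gt0.
rewrite natrD !natrM; nra.
Qed.

Lemma near_grid_mean (P : nat -> Prop) (m0 : nat) :
  (forall m, (m0 <= m)%N -> P m) -> \forall m \near grid_ultrafilter, P m.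
Proof.
move=> h; have [_ sU] := grid_ultrafilterP; apply: sU.
by exists m0 => // m /=; exact: h.
Qed.

(** The image of an ultrafilter is an ultrafilter, and this one contains a compact interval, so it
    converges. This is what makes the [lim] in [riemann] a genuine limit. *)
Lemma riemann_cvg f : bdd_supp f ->
  grid_mean ^~ f @ grid_ultrafilter --> riemann f.
Proof.
move=> [M [B [fM f0]]].
pose C : R := M%:R * (2 * B%:R + 1).
have UG : UltraFilter (grid_mean ^~ f @ grid_ultrafilter).
  split; first exact: fmap_proper_filter.
  move=> G GF sG; apply/seteqP; split => // A GA.
  have [//|h] := in_ultra_setVsetC ((grid_mean ^~ f) @^-1` A) grid_ultrafilter_ultra.
  have GAc : G (~` A) by apply: sG.
  by have := filterI GA GAc; rewrite setICr => /(_ _)/filter_ex[].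
have := @segment_compact R (- C) C; rewrite compact_ultra => /(_ _ UG) [].
  apply: (near_grid_mean (m0 := B.+1)) => m Bm /=.
  by rewrite in_itv/= -ler_norml; exact: grid_mean_bound.
move=> p [_ pl]; have -> : riemann f = p by exact/cvg_lim.
exact: pl.
Qed.

Lemma riemann_lin a f g : bdd_supp f -> bdd_supp g ->
  riemann (fun x => a * f x + g x) = a * riemann f + riemann g.
Proof.
move=> bf bg; apply/cvg_lim => //.
have -> : grid_mean ^~ (fun x => a * f x + g x) =
          (fun m => a * grid_mean m f + grid_mean m g).
  apply/funext => m; rewrite /grid_mean big_split/= -mulr_sumr mulrDr.
  by rewrite mulrCA.
apply: cvgD; last exact: riemann_cvg.
by apply: cvgMl_tmp; exact: riemann_cvg.
Qed.

Lemma bdd_supp0 : bdd_supp (fun=> 0).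
Proof. by exists 0%N, 0%N; split => // x; rewrite normr0. Qed.

Lemma riemann0 : riemann (fun=> 0) = 0.
Proof.
by have := riemann_lin (- 1) bdd_supp0 bdd_supp0; under eq_fun do rewrite mulr0 addr0; lra.
Qed.

Lemma riemann_ge0 f : bdd_supp f -> (forall x, 0 <= f x) -> 0 <= riemann f.
Proof.
move=> bf f0; apply: cvgr_to_ge (riemann_cvg bf) _.
apply: (near_grid_mean (m0 := 0%N)) => m _.
by rewrite mulr_ge0 ?invr_ge0 ?ler0n// sumr_ge0.
Qed.

Lemma riemann_bound f M B :
  (forall x, `|f x| <= M%:R) -> (forall x, B%:R < `|x| -> f x = 0) ->
  `|riemann f| <= M%:R * (2 * B%:R + 1).
Proof.
move=> fM f0; have bf : bdd_supp f by exists M, B.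
apply: cvgr_to_le (cvg_norm (riemann_cvg bf)) _.
by apply: (near_grid_mean (m0 := B.+1)) => m Bm; exact: grid_mean_bound.
Qed.

(** For [m >= q] the translation by [a / q] moves the index by the integer [a * (m! / q)], and for
    large [m] the moved support still lies inside the summation range. The Riemann sums are then
    equal from some [m] on, not merely close. *)
Lemma riemann_shift_nat f (a q : nat) : (0 < q)%N -> bdd_supp f ->
  riemann (fun x => f (x + a%:R / q%:R)) = riemann f.
Proof.
move=> q0 [M [B [fM f0]]]; rewrite /riemann.
have bf : bdd_supp f by exists M, B.
apply/cvg_lim => //.
apply: cvg_trans (riemann_cvg bf); apply: near_eq_cvg.
apply: (near_grid_mean (m0 := (q + B + a + 1)%N)) => m hm.
have qm : (q %| m`!)%N by rewrite dvdn_fact// q0/=; lia.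
have F0 := fact_gt0 m.
pose c := (a * (m`! %/ q))%N.
have cm : (c <= a * m`!)%N by rewrite leq_mul2l leq_div orbT.
have hprod : (a * m`! + B * m`! + m`! <= m * m`!)%N.
  rewrite -[X in (_ + X <= _)%N]mul1n -!mulnDl leq_mul2r.
  by apply/orP; right; lia.
rewrite (grid_mean_window (B := B))//; last lia.
congr (_ * _).
have -> : \sum_(0 <= k < 2 * m * m`!) f (grid_point m k + a%:R / q%:R) =
   \sum_(0 <= k < 2 * m * m`!) f (grid_point m (k + c)).
  apply: eq_bigr => k _; congr f; rewrite /grid_point natrD [in RHS]addrAC [in RHS]mulrDl.
  congr (_ + _); rewrite /c natrM.
  have -> : m`!%:R = (m`! %/ q)%:R * q%:R :> R by rewrite -natrM divnK.
  field.
  by rewrite !pnatr_eq0 -!lt0n q0 divn_gt0// dvdn_leq.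
have -> : \sum_(0 <= k < 2 * m * m`!) f (grid_point m (k + c)) =
    \sum_(c <= k < 2 * m * m`! + c) f (grid_point m k).
  by rewrite -{2}(add0n c) big_addn addnK.
clearbody c.
rewrite [RHS](big_nat_window (a := (m - B) * m`!) (b := (m + B) * m`! + 1))//.
- by clear -hprod cm; rewrite mulnBl; lia.
- by clear -hprod; rewrite mulnBl mulnDl; lia.
- by clear -hprod F0; rewrite mulnDl -mulnA; lia.
- by move=> k h; apply: f0; apply: grid_point_out => //; lia.
Qed.

Lemma bdd_supp_shift f x0 : bdd_supp f -> bdd_supp (fun x => f (x + x0)).
Proof.
move=> [M [B [fM f0]]]; exists M, (B + (Num.truncn `|x0|).+1)%N; split => // x h.
apply: f0; have := truncnS_gt `|x0|; move: h; rewrite natrD => h1 h2.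
by have := ler_normB (x + x0) x0; rewrite addrK; lra.
Qed.

Lemma riemann_shift f (a : int) (q : nat) : (0 < q)%N -> bdd_supp f ->
  riemann (fun x => f (x + a%:~R / q%:R)) = riemann f.
Proof.
move=> q0 bf; case: a => a.
  by rewrite -(riemann_shift_nat a q0 bf).
rewrite -(riemann_shift_nat a.+1 q0 (bdd_supp_shift _ bf)); congr riemann.
by apply/funext => x; congr f; rewrite NegzE mulrNz mulNr addrK.
Qed.

(** The interval contains at least [(b - a) * m! - 1] grid points; the factor [1 / 2] absorbs the
    rounding. *)
Lemma riemann_lower f a b : a < b -> bdd_supp f ->
  (forall x, 0 <= f x) -> (forall x, a <= x <= b -> 1 <= f x) ->
  (b - a) / 2 <= riemann f.
Proof.
move=> ab bf f0 f1; apply: cvgr_to_ge (riemann_cvg bf) _.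
have [m1 hm1] := nat_above (2 / (b - a)).
have [m2 hm2] := nat_above (`|a| + 1).
have [m3 hm3] := nat_above (`|b| + 1).
apply: (near_grid_mean (m0 := (m1 + m2 + m3)%N)) => m hm.
have F0 := fact_gt0R m.
have Fm : m%:R <= m`!%:R :> R.
  by rewrite ler_nat; case: (m) => // n; exact: fact_geq.
have h1 : 2 / (b - a) < m%:R by apply: lt_le_trans hm1 _; rewrite ler_nat; lia.
have h2 : `|a| + 1 < m%:R by apply: lt_le_trans hm2 _; rewrite ler_nat; lia.
have h3 : `|b| + 1 < m%:R by apply: lt_le_trans hm3 _; rewrite ler_nat; lia.
have := ler_norm b; have := ler_norm (- a); rewrite normrN => ha hb.
set F := m`!%:R in F0 Fm *.
have m0R : 0 <= m%:R :> R by [].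
have p0 : 0 <= (a + m%:R) * F by rewrite mulr_ge0//; lra.
have L0 : 0 <= (b - a) * F by rewrite mulr_ge0//; lra.
set p := (Num.truncn ((a + m%:R) * F)).+1.
set L := Num.truncn ((b - a) * F).
have /andP[p1 p2] := truncn_itv p0; have /andP[L1 L2] := truncn_itv L0.
rewrite -/L in L1 L2; rewrite -/p in p1 p2.
have mF : (m * m`!)%N%:R = m%:R * F :> R by rewrite natrM.
have pL : (p + L <= 2 * m * m`!)%N.
  rewrite -(ler_nat R) natrD -mulnA natrM mF -/F.
  have : p%:R <= (a + m%:R) * F + 1 by rewrite /p -natr1 lerD2r.
  have : 1 <= F by rewrite ler1n fact_gt0.
  have : 0 <= (m%:R - b - 1) * F by rewrite mulr_ge0//; lra.
  move: L1 => {}L1; lra.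
rewrite /grid_mean -/F [leRHS]mulrC ler_pdivlMr//.
apply: (@le_trans _ _ L%:R).
have : 2 <= (b - a) * F.
    by rewrite mulrC -ler_pdivrMr ?subr_gt0//; lra.
  by move: L2; rewrite -natr1; lra.
apply: (@le_trans _ _ (\sum_(p <= k < p + L) 1)).
  by rewrite sumr_const_nat addKn -mulr_natl mulr1.
apply: (@le_trans _ _ (\sum_(p <= k < p + L) f (grid_point m k))).
  apply: ler_sum_nat => k /andP[k1 k2]; apply: f1.
  rewrite /grid_point ler_pdivlMr// ler_pdivrMr// mF -/F.
  have : p%:R <= k%:R :> R by rewrite ler_nat.
  have : k.+1%:R <= p%:R + L%:R :> R by rewrite -natrD ler_nat.
  have : p%:R <= (a + m%:R) * F + 1 by rewrite /p -natr1 lerD2r.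
  by rewrite -natr1 => *; apply/andP; split; lra.
rewrite [leRHS](big_cat_nat (n := p))//; last exact: leq_trans (leq_addr _ _) pL.
rewrite [X in _ <= _ + X](big_cat_nat (n := p + L))//; last exact: leq_addr.
by rewrite ler_wpDl ?sumr_ge0// ler_wpDr ?sumr_ge0.
Qed.

End RiemannFunctional.

(** * Iterated Riemann functionals in several variables *)

Section MultiRiemann.
Context {R : realType} {n : nat}.
Implicit Types (F G : 'rV[R]_n -> R) (u v : 'rV[R]_n) (P : pred 'I_n).

Definition set_coord (i : 'I_n) (x : R) u : 'rV[R]_n :=
  \row_j (if j == i then x else u 0 j).

Definition riemann_coord (i : 'I_n) F u : R :=
  riemann (fun x => F (set_coord i x u)).

Definition riemann_seq (s : seq 'I_n) F : 'rV[R]_n -> R :=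
  foldr riemann_coord F s.

(** The variables are integrated in the fixed order of [enum], since iterated ultralimits need not
    commute. Every coordinate of the base point [0] is overwritten on the way. *)
Definition rint F : R := riemann_seq (enum 'I_n) F 0.

(** Integrating out a coordinate keeps the support bounded only in the remaining ones; [P] records
    which coordinates those are. *)
Definition bdd_supp_on P F : Prop :=
  exists M B : nat, (forall u, `|F u| <= M%:R) /\
    (forall u i, P i -> B%:R < `|u 0 i| -> F u = 0).

Definition bdd_suppn F := bdd_supp_on predT F.

Lemma bdd_supp_on_coord P F i u : P i -> bdd_supp_on P F ->
  bdd_supp (fun x => F (set_coord i x u)).
Proof.
move=> Pi [M [B [FM F0]]]; exists M, B; split => // x hx.
by apply: (F0 _ i) => //; rewrite mxE eqxx.
Qed.

Lemma bdd_supp_on_riemann P F i : P i -> bdd_supp_on P F ->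
  bdd_supp_on (fun j => P j && (j != i)) (riemann_coord i F).
Proof.
move=> Pi [M [B [FM F0]]]; exists (M * (2 * B + 1))%N, B; split => [u|u j].
  rewrite natrM natrD natrM; apply: riemann_bound => // x hx.
  by apply: (F0 _ i) => //; rewrite mxE eqxx.
move=> /andP[Pj ji] hu; rewrite /riemann_coord.
rewrite -[RHS]riemann0; congr riemann; apply/funext => x.
by rewrite (F0 _ j)// mxE (negbTE ji).
Qed.

Lemma bdd_supp_on_seq P F s : all P s -> uniq s -> bdd_supp_on P F ->
  bdd_supp_on (fun j => P j && (j \notin s)) (riemann_seq s F).
Proof.
move=> + + bF; elim: s => [_ _|i s IH /= /andP[Pi Ps] /andP[nis us]].
  by have [M [B [FM F0]]] := bF; exists M, B; split => // u i /andP[+ _]; exact: F0.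
have [|M [B [FM F0]]] := bdd_supp_on_riemann (i := i) _ (IH Ps us).
  by rewrite Pi nis.
exists M, B; split => // u j /andP[Pj]; rewrite in_cons negb_or => /andP[ji js].
by apply: F0; rewrite Pj js ji.
Qed.

Lemma riemann_seq_lin P a F G s : all P s -> uniq s ->
  bdd_supp_on P F -> bdd_supp_on P G ->
  riemann_seq s (fun u => a * F u + G u) =
  (fun u => a * riemann_seq s F u + riemann_seq s G u).
Proof.
move=> + + bF bG; elim: s => [//|i s IH /= /andP[Pi Ps] /andP[nis us]].
rewrite IH//; apply/funext => u; rewrite /riemann_coord.
have Pi' : P i && (i \notin s) by rewrite Pi.
rewrite (riemann_lin a (f := fun x => riemann_seq s F (set_coord i x u)))//.
  exact: (bdd_supp_on_coord u Pi' (bdd_supp_on_seq Ps us bF)).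
exact: (bdd_supp_on_coord u Pi' (bdd_supp_on_seq Ps us bG)).
Qed.

Lemma riemann_seq_ge0 P F s : all P s -> uniq s ->
  bdd_supp_on P F -> (forall u, 0 <= F u) -> forall u, 0 <= riemann_seq s F u.
Proof.
move=> + + bF F0; elim: s => [//|i s IH /= /andP[Pi Ps] /andP[nis us]] u.
have Pi' : P i && (i \notin s) by rewrite Pi.
apply: riemann_ge0 => [|x]; last exact: IH.
exact: (bdd_supp_on_coord u Pi' (bdd_supp_on_seq Ps us bF)).
Qed.

Lemma rint_lin a F G : bdd_suppn F -> bdd_suppn G ->
  rint (fun u => a * F u + G u) = a * rint F + rint G.
Proof.
by move=> bF bG; rewrite /rint (@riemann_seq_lin predT)// ?enum_uniq// all_predT.
Qed.

Lemma rint_ge0 F : bdd_suppn F -> (forall u, 0 <= F u) -> 0 <= rint F.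
Proof.
by move=> bF F0; apply: (@riemann_seq_ge0 predT); rewrite ?enum_uniq ?all_predT.
Qed.

Lemma bdd_suppn_lin a F G : bdd_suppn F -> bdd_suppn G ->
  bdd_suppn (fun u => a * F u + G u).
Proof.
move=> [M [B [FM F0]]] [M' [B' [GM G0]]].
have [m hm] := nat_above (`|a| * M%:R + M'%:R).
exists m, (maxn B B'); split => [u|u i _ h].
  apply: le_trans (ler_normD _ _) _; rewrite normrM; apply: le_trans (ltW hm).
  by rewrite lerD// ler_wpM2l.
rewrite (F0 _ i) ?(G0 _ i) ?mulr0 ?addr0//.
  by apply: le_lt_trans h; rewrite ler_nat leq_maxr.
by apply: le_lt_trans h; rewrite ler_nat leq_maxl.
Qed.

Lemma bdd_suppn0 : bdd_suppn (fun=> 0).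
Proof. by exists 0%N, 0%N; split => // u; rewrite normr0. Qed.

Lemma rint0 : rint (fun=> 0) = 0.
Proof.
by have := rint_lin (- 1) bdd_suppn0 bdd_suppn0; under eq_fun do rewrite mulr0 addr0; lra.
Qed.

Lemma rintZ a F : bdd_suppn F -> rint (fun u => a * F u) = a * rint F.
Proof.
move=> bF; have := rint_lin a bF bdd_suppn0; rewrite rint0 addr0 => <-.
by congr rint; apply/funext => u; rewrite addr0.
Qed.

Lemma rintD F G : bdd_suppn F -> bdd_suppn G ->
  rint (fun u => F u + G u) = rint F + rint G.
Proof.
move=> bF bG; have := rint_lin 1 bF bG; rewrite mul1r => <-.
by congr rint; apply/funext => u; rewrite mul1r.
Qed.

Lemma bdd_suppnZ a F : bdd_suppn F -> bdd_suppn (fun u => a * F u).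
Proof.
move=> bF; have := bdd_suppn_lin a bF bdd_suppn0.
by congr bdd_suppn; apply/funext => u; rewrite addr0.
Qed.

Lemma bdd_suppnD F G : bdd_suppn F -> bdd_suppn G -> bdd_suppn (fun u => F u + G u).
Proof.
move=> bF bG; have := bdd_suppn_lin 1 bF bG.
by congr bdd_suppn; apply/funext => u; rewrite mul1r.
Qed.

Lemma bdd_suppnB F G : bdd_suppn F -> bdd_suppn G -> bdd_suppn (fun u => F u - G u).
Proof.
move=> bF bG; have := bdd_suppn_lin (- 1) bG bF.
by congr bdd_suppn; apply/funext => u; rewrite mulN1r addrC.
Qed.

Lemma rintB F G : bdd_suppn F -> bdd_suppn G ->
  rint (fun u => F u - G u) = rint F - rint G.
Proof.
move=> bF bG; have := rint_lin (- 1) bG bF; rewrite mulN1r addrC => <-.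
by congr rint; apply/funext => u; rewrite mulN1r addrC.
Qed.

Lemma bdd_suppn_sum (I : Type) (s : seq I) (F : I -> 'rV[R]_n -> R) :
  (forall i, bdd_suppn (F i)) -> bdd_suppn (fun u => \sum_(i <- s) F i u).
Proof.
move=> bF; elim: s => [|i s IH].
  have := bdd_suppn0; congr bdd_suppn; apply/funext => u; by rewrite big_nil.
have := bdd_suppnD (bF i) IH; congr bdd_suppn; apply/funext => u.
by rewrite big_cons.
Qed.

Lemma rint_sum (I : Type) (s : seq I) (F : I -> 'rV[R]_n -> R) :
  (forall i, bdd_suppn (F i)) ->
  rint (fun u => \sum_(i <- s) F i u) = \sum_(i <- s) rint (F i).
Proof.
move=> bF; elim: s => [|i s IH].
  rewrite big_nil -[RHS]rint0; congr rint; apply/funext => u; by rewrite big_nil.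
rewrite big_cons -IH -rintD//; last exact: bdd_suppn_sum.
by congr rint; apply/funext => u; rewrite big_cons.
Qed.

Lemma ler_rint F G : bdd_suppn F -> bdd_suppn G -> (forall u, F u <= G u) ->
  rint F <= rint G.
Proof.
move=> bF bG FG; rewrite -subr_ge0 -rintB//; apply: rint_ge0; first exact: bdd_suppnB.
by move=> u; rewrite subr_ge0.
Qed.

Lemma rint_prod (f : 'I_n -> R -> R) : (forall i, bdd_supp (f i)) ->
  rint (fun u => \prod_i f i (u 0 i)) = \prod_i riemann (f i).
Proof.
move=> bf.
suff H s : uniq s -> riemann_seq s (fun u => \prod_i f i (u 0 i)) =
    (fun u => \prod_i (if i \in s then riemann (f i) else f i (u 0 i))).
  by rewrite /rint H ?enum_uniq//; apply: eq_bigr => i _; rewrite mem_enum.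
elim: s => [//|i s IH /= /andP[nis us]].
rewrite IH//; apply/funext => u; rewrite /riemann_coord.
rewrite (bigD1 i)//= in_cons eqxx/=.
set C := (X in _ = _ * X).
have -> : (fun x => \prod_i0 (if i0 \in s then riemann (f i0)
     else f i0 (set_coord i x u 0 i0))) = (fun x => C * f i x + 0).
  apply/funext => x; rewrite (bigD1 i)//= (negbTE nis) mxE eqxx addr0 mulrC.
  congr (_ * _); apply: eq_bigr => j ji; rewrite in_cons (negbTE ji)/=.
  by rewrite mxE (negbTE ji).
rewrite riemann_lin//; last exact: bdd_supp0.
by rewrite riemann0 addr0 mulrC.
Qed.

Lemma set_coord_shift i k c x u : i != k ->
  set_coord i x u + c *: delta_mx 0 k = set_coord i x (u + c *: delta_mx 0 k).
Proof.
move=> ik; apply/rowP => j; rewrite !mxE/=.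
by have [->|//] := eqVneq j i; rewrite (negbTE ik) mulr0 addr0.
Qed.

Lemma set_coord_shift_eq k c x u :
  set_coord k x u + c *: delta_mx 0 k = set_coord k (x + c) u.
Proof.
apply/rowP => j; rewrite !mxE/=.
by have [_|_] := eqVneq j k; rewrite ?mulr1 ?mulr0 ?addr0.
Qed.

Lemma riemann_seq_shift_notin F s k c : k \notin s ->
  riemann_seq s (fun u => F (u + c *: delta_mx 0 k)) =
  (fun u => riemann_seq s F (u + c *: delta_mx 0 k)).
Proof.
elim: s => [//|i s IH]; rewrite in_cons negb_or => /andP[ki ks] /=.
rewrite IH//; apply/funext => u; congr riemann; apply/funext => x.
by rewrite set_coord_shift// eq_sym.
Qed.

Lemma riemann_seq_shift P F s k (a : int) (q : nat) : (0 < q)%N ->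
  all P s -> uniq s -> bdd_supp_on P F -> k \in s ->
  riemann_seq s (fun u => F (u + (a%:~R / q%:R) *: delta_mx 0 k)) = riemann_seq s F.
Proof.
move=> q0 + + bF; elim: s => [//|i s IH /= /andP[Pi Ps] /andP[nis us]].
rewrite in_cons; case: eqP => [->|/eqP ki] /= ks.
  have Pi' : P i && (i \notin s) by rewrite Pi.
  rewrite riemann_seq_shift_notin//; apply/funext => u.
  rewrite /riemann_coord -[RHS](riemann_shift a q0)//.
    by congr riemann; apply/funext => x; rewrite set_coord_shift_eq.
  exact: (bdd_supp_on_coord u Pi' (bdd_supp_on_seq Ps us bF)).
by rewrite IH.
Qed.

Lemma rint_shift1 F k (a : int) (q : nat) : (0 < q)%N -> bdd_suppn F ->
  rint (fun u => F (u + (a%:~R / q%:R) *: delta_mx 0 k)) = rint F.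
Proof.
move=> q0 bF; rewrite /rint (riemann_seq_shift (P := predT))// ?all_predT//.
  exact: enum_uniq.
by rewrite mem_enum.
Qed.

Lemma bdd_suppn_shift F v : bdd_suppn F -> bdd_suppn (fun u => F (u + v)).
Proof.
move=> [M [B [FM F0]]].
have [m hm] := nat_above (\sum_i `|v 0 i|).
exists M, (B + m)%N; split => // u i _ h; apply: (F0 _ i) => //.
have : `|v 0 i| <= \sum_i `|v 0 i|.
  by rewrite (bigD1 i)//= ler_wpDr// sumr_ge0.
rewrite mxE; move: h; rewrite natrD => h1 h2.
by have := ler_normB (u 0 i + v 0 i) (v 0 i); rewrite addrK; lra.
Qed.

Lemma rint_shift F (a : 'I_n -> int) (q : nat) : (0 < q)%N -> bdd_suppn F ->
  rint (fun u => F (u + \row_i ((a i)%:~R / q%:R))) = rint F.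
Proof.
move=> q0 bF; rewrite [\row_i _]row_sum_delta.
suff H (s : seq 'I_n) : rint (fun u => F (u + \sum_(i <- s)
   ((\row_i ((a i)%:~R / q%:R) : 'rV[R]_n) 0 i *: delta_mx 0 i))) = rint F by exact: H.
elim: s => [|i s IH].
  by congr rint; apply/funext => u; rewrite big_nil addr0.
rewrite -[RHS]IH -[RHS](rint_shift1 i (a i) q0); last exact: bdd_suppn_shift.
congr rint; apply/funext => u; rewrite big_cons mxE; congr F.
by rewrite addrA.
Qed.

(** [Q] stands for the indicator of a set outside which [F] vanishes. The bound is the discriminant
    condition for the integral of [(F - l * Q) ^ 2], a nonnegative quadratic polynomial in [l]. *)
Lemma rint_cauchy_schwarz F Q : bdd_suppn F -> bdd_suppn Q ->
  bdd_suppn (fun u => F u ^+ 2) -> (forall u, F u * Q u = F u) ->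
  (forall u, Q u ^+ 2 = Q u) ->
  rint F ^+ 2 <= rint Q * rint (fun u => F u ^+ 2).
Proof.
move=> bF bQ bF2 FQ Q2.
have key l : 0 <= rint (fun u => F u ^+ 2) - 2 * l * rint F + l ^+ 2 * rint Q.
  have -> : rint (fun u => F u ^+ 2) - 2 * l * rint F + l ^+ 2 * rint Q =
            rint (fun u => (F u - l * Q u) ^+ 2).
    have -> : (fun u => (F u - l * Q u) ^+ 2) =
        (fun u => - (2 * l) * F u + (l ^+ 2 * Q u + F u ^+ 2)).
      apply/funext => u; rewrite sqrrB exprMn Q2.
      by rewrite mulrCA FQ; ring.
    rewrite rint_lin//; last exact: bdd_suppn_lin.
    by rewrite rint_lin//; ring.
  apply: rint_ge0 => [|u]; last exact: sqr_ge0.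
  have -> : (fun u => (F u - l * Q u) ^+ 2) =
        (fun u => - (2 * l) * F u + (l ^+ 2 * Q u + F u ^+ 2)).
    apply/funext => u; rewrite sqrrB exprMn Q2.
    by rewrite mulrCA FQ; ring.
  by apply: bdd_suppn_lin => //; exact: bdd_suppn_lin.
have Q0 : 0 <= rint Q by apply: rint_ge0 => // u; rewrite -Q2 sqr_ge0.
have F20 : 0 <= rint (fun u => F u ^+ 2).
  by apply: rint_ge0 => // u; exact: sqr_ge0.
set A := rint (fun u => F u ^+ 2) in key F20 *; set b := rint F in key *.
set q := rint Q in key Q0 *.
move: Q0; rewrite le_eqVlt => /orP[/eqP q0|q0].
  rewrite -q0 mul0r; have [->|b0] := eqVneq b 0; first by rewrite expr0n.
  (* With [rint Q = 0] the quadratic degenerates to [A - 2 * l * b]; this [l] would give it the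
     value [-1]. *)
  have := key ((A + 1) / (2 * b)); rewrite -q0 mulr0 addr0.
  have -> : 2 * ((A + 1) / (2 * b)) * b = A + 1 by field.
  by lra.
have := key (b / q).
have -> : A - 2 * (b / q) * b + (b / q) ^+ 2 * q = A - b ^+ 2 / q by field; rewrite gt_eqF.
by rewrite subr_ge0 ler_pdivrMr// mulrC.
Qed.

End MultiRiemann.

(** * Fejer kernels *)

Section TrigBounds.
Context {R : realType}.
Implicit Types x y : R.

Lemma sin_mvt x : 0 < x -> exists2 c, 0 < c < x & sin x = cos c * x.
Proof.
move=> x0; have cs : {within `[0, x], continuous (@sin R)}.
  by apply: continuous_subspaceT => z; exact: continuous_sin.
have [c /itvP cx] := MVT x0 (fun z _ => is_derive_sin z) cs.
rewrite sin0 !subr0 => e; exists c => //; by rewrite !cx.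
Qed.

Lemma norm_sin_le x : `|sin x| <= `|x|.
Proof.
wlog x0 : x / 0 < x.
  move=> h; have [x0|x0|->] := ltgtP x 0; last by rewrite sin0 normr0.
    by have := h (- x); rewrite sinN !normrN; apply; lra.
  exact: h.
have [c _ ->] := sin_mvt x0; rewrite normrM ler_piMl//; exact: cos_max.
Qed.

Lemma cos_ge_sqr x : 1 - x ^+ 2 / 2 <= cos x.
Proof.
have -> : cos x = 1 - 2 * sin (x / 2) ^+ 2.
  have {1}-> : x = (x / 2) *+ 2 by rewrite mulr2n; lra.
  by rewrite cos_mulr2n cos2sin2 mulr2n; ring.
have := norm_sin_le (x / 2); rewrite -(ler_pXn2r (n := 2)) ?nnegrE//.
by rewrite !real_normK ?num_real// expr_div_n; lra.
Qed.

Lemma cos_ge_half x : `|x| <= 1 -> 2^-1 <= cos x.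
Proof.
move=> x1; apply: le_trans (cos_ge_sqr x).
have : `|x| ^+ 2 <= 1 by rewrite expr_le1.
by rewrite real_normK ?num_real//; lra.
Qed.

Lemma sin_ge_half x : 0 <= x <= 1 -> x / 2 <= sin x.
Proof.
move=> /andP[]; rewrite le_eqVlt => /orP[/eqP<-|x0] x1; first by rewrite sin0 mul0r.
have [c /andP[c0 cx] ->] := sin_mvt x0; rewrite mulrC ler_pM2r//.
by apply: cos_ge_half; rewrite gtr0_norm//; lra.
Qed.

Lemma norm_sin_ge x : `|x| <= 1 -> `|x| / 2 <= `|sin x|.
Proof.
wlog x0 : x / 0 <= x.
  move=> h; have [/h//|x0] := leP 0 x.
  by have := h (- x); rewrite sinN !normrN; apply; lra.
move=> x1; have := sin_ge_half (x := x); rewrite x0/= (le_trans (ler_norm _) x1).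
by move=> /(_ isT) h; rewrite ger0_norm// (le_trans h)// ler_norm.
Qed.

End TrigBounds.

Section Fejer.
Context {R : realType}.
Implicit Types x y : R.
Local Open Scope complex_scope.

Definition cis x : R[i] := cos x +i* sin x.

Definition normsq (z : R[i]) : R := complex.Re z ^+ 2 + complex.Im z ^+ 2.

Lemma cisD x y : cis (x + y) = cis x * cis y.
Proof. by rewrite /cis sinD cosD; apply/eqP; rewrite eq_complex/= eqxx addrC/= addrC. Qed.

Lemma cis0 : cis 0 = 1.
Proof. by rewrite /cis cos0 sin0. Qed.

Lemma cis_sum (I : Type) (s : seq I) (f : I -> R) :
  cis (\sum_(i <- s) f i) = \prod_(i <- s) cis (f i).
Proof. by apply: big_morph; [exact: cisD|exact: cis0]. Qed.

Lemma normsqM z w : normsq (z * w) = normsq z * normsq w.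
Proof. by case: z w => [a b] [c e]; rewrite /normsq/=; ring. Qed.

Lemma normsq1 : normsq 1 = 1.
Proof. by rewrite /normsq/= expr1n expr0n addr0. Qed.

Lemma normsq_prod (I : Type) (s : seq I) (f : I -> R[i]) :
  normsq (\prod_(i <- s) f i) = \prod_(i <- s) normsq (f i).
Proof. by apply: big_morph; [exact: normsqM|exact: normsq1]. Qed.

Lemma Re_sum (I : Type) (s : seq I) (f : I -> R[i]) :
  complex.Re (\sum_(i <- s) f i) = \sum_(i <- s) complex.Re (f i).
Proof. by apply: big_morph => // -[a b] [c e]. Qed.

Lemma Im_sum (I : Type) (s : seq I) (f : I -> R[i]) :
  complex.Im (\sum_(i <- s) f i) = \sum_(i <- s) complex.Im (f i).
Proof. by apply: big_morph => // -[a b] [c e]. Qed.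

Definition fejer (M : nat) x : R :=
  M%:R^-1 * normsq (\sum_(k < M) cis (k%:R * x)).

Lemma fejer_le M x : fejer M x <= M%:R.
Proof.
have [->|M0] := posnP M; first by rewrite /fejer invr0 mul0r.
have MR : 0 < M%:R :> R by rewrite ltr0n.
rewrite /fejer ler_pdivrMl// -expr2 /normsq Re_sum Im_sum/=.
have H (u : 'I_M -> R) (v : 'I_M -> R) : (forall k, u k ^+ 2 + v k ^+ 2 = 1) ->
    (\sum_k u k) ^+ 2 + (\sum_k v k) ^+ 2 <= M%:R ^+ 2.
  move=> uv; rewrite !expr2 !big_distrlr/= -big_split/=.
  have -> : M%:R * M%:R = \sum_(i < M) \sum_(j < M) (1 : R).
    by rewrite !big_const_ord !iter_addr_0 mulr_natl.
  apply: ler_sum => i _; rewrite -big_split; apply: ler_sum => j _ /=.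
  have := sqr_ge0 (u i - u j); have := sqr_ge0 (v i - v j).
  by have := uv i; have := uv j; rewrite !sqrrB; lra.
by apply: H => k; exact: cos2Dsin2.
Qed.

(** The geometric sum has modulus [|sin (M * x / 2) / sin (x / 2)|]. Multiplying by
    [2 * sin (x / 2)] makes its real and imaginary parts telescope and avoids dividing by a sine
    that may vanish. *)
Lemma cis_geom M x : normsq (\sum_(k < M) cis (k%:R * x)) * sin (x / 2) ^+ 2 <= 1.
Proof.
have tel_c : (\sum_(k < M) cos (k%:R * x)) * (2 * sin (x / 2)) =
    sin ((M%:R - 2^-1) * x) + sin (x / 2).
  elim: M => [|M IH].
    by rewrite big_ord0 mul0r mulr0n sub0r mulNr mulrC sinN addrC subrr.
  rewrite big_ord_recr/= mulrDl IH.
  have -> : (M.+1%:R - 2^-1) * x = M%:R * x + x / 2 by rewrite -natr1; field.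
  have -> : (M%:R - 2^-1) * x = M%:R * x - x / 2 by field.
  by rewrite sinB sinD; ring.
have tel_s : (\sum_(k < M) sin (k%:R * x)) * (2 * sin (x / 2)) =
    cos (x / 2) - cos ((M%:R - 2^-1) * x).
  elim: M {tel_c} => [|M IH].
    by rewrite big_ord0 mul0r mulr0n sub0r mulNr mulrC cosN subrr.
  rewrite big_ord_recr/= mulrDl IH.
  have -> : (M.+1%:R - 2^-1) * x = M%:R * x + x / 2 by rewrite -natr1; field.
  have -> : (M%:R - 2^-1) * x = M%:R * x - x / 2 by field.
  by rewrite cosB cosD; ring.
rewrite /normsq Re_sum Im_sum/=.
set C := \sum_(k < M) _ in tel_c *; set S := \sum_(k < M) _ in tel_s *.
have -> : (C ^+ 2 + S ^+ 2) * sin (x / 2) ^+ 2 =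
   ((C * (2 * sin (x / 2))) ^+ 2 + (S * (2 * sin (x / 2))) ^+ 2) / 4 by field.
rewrite tel_c tel_s; set A := (M%:R - 2^-1) * x.
have h1 := cos2Dsin2 A; have h2 := cos2Dsin2 (x / 2).
have := sqr_ge0 (sin A - sin (x / 2)); have := sqr_ge0 (cos A + cos (x / 2)).
by rewrite !sqrrB !sqrrD; lra.
Qed.

(** The kernel has further peaks at the nonzero multiples of [2 * pi]; the condition [|x| <= 1],
    true of coordinate differences in the unit cube, stays away from them. The constant [16] comes
    from squaring [|sin (x / 2)| >= |x| / 4]. *)
Lemma fejer_decay M x : (0 < M)%N -> 0 < `|x| <= 1 -> fejer M x <= 16 / (M%:R * x ^+ 2).
Proof.
move=> M0 /andP[x0 x1]; have MR : 0 < M%:R :> R by rewrite ltr0n.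
rewrite /fejer invfM mulrCA ler_pM2l ?invr_gt0//.
have xx : 0 < x ^+ 2 by rewrite -[x ^+ 2]real_normK ?num_real// exprn_gt0.
rewrite ler_pdivlMr//.
have h : (x / 4) ^+ 2 <= sin (x / 2) ^+ 2.
  rewrite -[leLHS]real_normK ?num_real// -[leRHS]real_normK ?num_real//.
  rewrite ler_pXn2r ?nnegrE//; apply: le_trans (norm_sin_ge _).
    by rewrite !normrM !(ger0_norm (x := _^-1))//; lra.
  by rewrite normrM (ger0_norm (x := _^-1))//; lra.
have := cis_geom M x; set N := normsq _.
have N0 : 0 <= N by rewrite /N /normsq addr_ge0// sqr_ge0.
have : N * (x / 4) ^+ 2 <= N * sin (x / 2) ^+ 2 by rewrite ler_wpM2l.
have -> : (x / 4) ^+ 2 = x ^+ 2 / 16 by field.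
lra.
Qed.

Lemma fejer_ge0 M x : 0 <= fejer M x.
Proof. by rewrite mulr_ge0 ?invr_ge0 ?addr_ge0 ?sqr_ge0. Qed.

End Fejer.

Section FejerKernel.
Context {R : realType} {d : nat}.
Implicit Types (v : 'rV[R]_d) (M : nat).

Definition freq M (m : {ffun 'I_d -> 'I_M}) : 'rV[R]_d := \row_i (m i)%:R.

(** A product of one-variable Fejer kernels, with peak value [M ^ d], expanded as a trigonometric
    polynomial whose frequencies are differences of integer points of a cube. In this form its
    pairing with [mu] and with [sigma] is a finite sum of Fourier coefficients. *)
Definition fejer_kernel M v : R :=
  (M%:R ^+ d)^-1 * \sum_(m : {ffun 'I_d -> 'I_M}) \sum_(n : {ffun 'I_d -> 'I_M})
     cos (dot (freq m - freq n) v).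

Lemma dotDl (x y z : 'rV[R]_d) : dot (x + y) z = dot x z + dot y z.
Proof. by rewrite /dot -big_split; apply: eq_bigr => j _; rewrite mxE mulrDl. Qed.

Lemma dotNl (x z : 'rV[R]_d) : dot (- x) z = - dot x z.
Proof. by rewrite /dot -sumrN; apply: eq_bigr => j _; rewrite mxE mulNr. Qed.

Lemma dotBl (x y z : 'rV[R]_d) : dot (x - y) z = dot x z - dot y z.
Proof. by rewrite dotDl dotNl. Qed.

Lemma dotC (x y : 'rV[R]_d) : dot x y = dot y x.
Proof. by apply: eq_bigr => j _; rewrite mulrC. Qed.

Lemma dotZl a (x y : 'rV[R]_d) : dot (a *: x) y = a * dot x y.
Proof. by rewrite /dot mulr_sumr; apply: eq_bigr => j _; rewrite mxE mulrA. Qed.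

Lemma dotDr (x y z : 'rV[R]_d) : dot z (x + y) = dot z x + dot z y.
Proof. by rewrite dotC dotDl !(dotC z). Qed.

Lemma dotNr (x z : 'rV[R]_d) : dot z (- x) = - dot z x.
Proof. by rewrite dotC dotNl dotC. Qed.

Lemma dotBr (x y z : 'rV[R]_d) : dot z (x - y) = dot z x - dot z y.
Proof. by rewrite dotDr dotNr. Qed.

Lemma dotZr a (x y : 'rV[R]_d) : dot x (a *: y) = a * dot x y.
Proof. by rewrite dotC dotZl dotC. Qed.

Lemma coord_le_norm (v : 'rV[R]_d) i : `|v 0 i| <= `|v|.
Proof.
by rewrite [leRHS]/Num.norm/= mx_normrE; apply/bigmax_geP; right; exists (0, i).
Qed.

Lemma row_norm_le (v : 'rV[R]_d) c : 0 <= c -> (forall i, `|v 0 i| <= c) -> `|v| <= c.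
Proof.
move=> c0 h; rewrite [leLHS]/Num.norm/= mx_normrE; apply/bigmax_leP; split => //.
by move=> [i j] _ /=; rewrite (ord1 i).
Qed.

Lemma row_norm_lt (v : 'rV[R]_d) c : 0 < c -> (forall i, `|v 0 i| < c) -> `|v| < c.
Proof.
move=> c0 h; rewrite [ltLHS]/Num.norm/= mx_normrE; apply/bigmax_ltP; split => //.
by move=> [i j] _ /=; rewrite (ord1 i).
Qed.

Lemma row_norm_attained (v : 'rV[R]_d) : v != 0 -> exists i, `|v| = `|v 0 i|.
Proof.
move=> v0; have [|[i j] e] := @mx_norm_neq0 _ _ _ v.
  by apply: contra v0 => /eqP/mx_norm_eq0->.
by exists j; rewrite {1}/Num.norm/= e (ord1 i).
Qed.

Lemma norm_dot_le (x y : 'rV[R]_d) : `|dot x y| <= d%:R * `|x| * `|y|.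
Proof.
apply: le_trans (ler_norm_sum _ _ _) _.
apply: (@le_trans _ _ (\sum_(j < d) `|x| * `|y|)).
  by apply: ler_sum => j _; rewrite normrM ler_pM// coord_le_norm.
by rewrite sumr_const card_ord -[leLHS]mulr_natl mulrA.
Qed.

(* The two double sums are the real part of |sum_m e^(i m.v)|^2. *)
Lemma fejer_kernel_sqr M v : fejer_kernel M v = (M%:R ^+ d)^-1 *
  ((\sum_(m : {ffun 'I_d -> 'I_M}) cos (dot (freq m) v)) ^+ 2 +
   (\sum_(m : {ffun 'I_d -> 'I_M}) sin (dot (freq m) v)) ^+ 2).
Proof.
congr (_ * _); rewrite !expr2 !big_distrlr -big_split/=; apply: eq_bigr => m _.
by rewrite -big_split; apply: eq_bigr => n _; rewrite dotBl cosB.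
Qed.

Lemma fejer_kernel_ge0 M v : 0 <= fejer_kernel M v.
Proof. by rewrite fejer_kernel_sqr mulr_ge0 ?invr_ge0 ?exprn_ge0// addr_ge0// sqr_ge0. Qed.

Lemma fejer_kernel_prod M v : fejer_kernel M v = \prod_i fejer M (v 0 i).
Proof.
rewrite fejer_kernel_sqr /fejer big_split/= prodr_const card_ord exprVn.
congr (_ * _); rewrite -normsq_prod bigA_distr_bigA/= /normsq Re_sum Im_sum.
by congr (_ ^+ 2 + _ ^+ 2); apply: eq_bigr => m _; rewrite -cis_sum /=;
  rewrite /dot; congr (_ _); apply: eq_bigr => i _; rewrite mxE.
Qed.

(** All phases have absolute value at most [1], so each of the [M ^ d] cosines is at least [1 / 2];
    the squared sine sum is dropped. A lower bound is required near the origin only and the kernel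
    is nonnegative elsewhere, so the periodic repetition of the peaks does no harm. *)
Lemma fejer_kernel_lower M v : (0 < d)%N -> (0 < M)%N ->
  d%:R * M%:R * `|v| <= 1 -> M%:R ^+ d / 4 <= fejer_kernel M v.
Proof.
move=> d0 M0 hv; rewrite fejer_kernel_sqr.
have MR : 0 < M%:R ^+ d :> R by rewrite exprn_gt0// ltr0n.
rewrite [leRHS]mulrC ler_pdivlMr//.
apply: ler_wpDr; first exact: sqr_ge0.
have h : M%:R ^+ d / 2 <= \sum_(m : {ffun 'I_d -> 'I_M}) cos (dot (freq m) v).
  apply: (@le_trans _ _ (\sum_(m : {ffun 'I_d -> 'I_M}) 2^-1)).
    by rewrite sumr_const card_ffun !card_ord -[leRHS]mulr_natl natrX.
  apply: ler_sum => m _; apply: cos_ge_half.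
  apply: le_trans (norm_dot_le _ _) _; apply: le_trans hv.
  rewrite ler_wpM2r// ler_wpM2l//.
  by apply: row_norm_le => // i; rewrite mxE normr_nat ler_nat ltnW.
apply: (@le_trans _ _ ((M%:R ^+ d / 2) ^+ 2)).
  by rewrite expr_div_n expr2; lra.
by rewrite ler_pXn2r// nnegrE; [exact: mulr_ge0 (ltW MR) _ | exact: le_trans h; exact: mulr_ge0 (ltW MR) _].
Qed.

End FejerKernel.

(** * Functionals with Fourier decay *)

Section DecayFunctional.
Context {R : realType} {d : nat}.
Implicit Types (f g : 'rV[R]_d -> R) (S : set 'rV[R]_d).

Definition bounded_fn f := exists M : R, forall x, `|f x| <= M.

(* [sigma] behaves like a positive measure carried by a hypersurface containing
   [S], with mass at least [c * r ^ (d - 1)] in balls centred on [S], and whose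
   Fourier transform decays at rate [gamma]. *)
Record decay_functional (gamma : R) S (sigma : ('rV[R]_d -> R) -> R) : Prop := {
  sigma_lin : forall a f g, bounded_fn f -> bounded_fn g ->
    sigma (fun x => a * f x + g x) = a * sigma f + sigma g ;
  sigma_ge0 : forall f, bounded_fn f -> (forall x, 0 <= f x) -> 0 <= sigma f ;
  sigma_decay : exists C : R, forall zeta,
    `|zeta| `^ gamma * `|sigma (fun p => cos (dot zeta p))| <= C ;
  sigma_lower : exists2 c : R, 0 < c & forall q r f, S q -> 0 < r <= 1 ->
    bounded_fn f -> (forall x, 0 <= f x) ->
    (forall x, `|x - q| <= r -> 1 <= f x) -> c * r ^+ d.-1 <= sigma f }.

Lemma bounded_fn_lin a f g : bounded_fn f -> bounded_fn g ->
  bounded_fn (fun x => a * f x + g x).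
Proof.
move=> [M fM] [M' gM]; exists (`|a| * M + M') => x.
by apply: le_trans (ler_normD _ _) _; rewrite normrM lerD// ler_wpM2l.
Qed.

Lemma bounded_fn0 : bounded_fn (fun=> 0).
Proof. by exists 0 => x; rewrite normr0. Qed.

Lemma bounded_fnZ a f : bounded_fn f -> bounded_fn (fun x => a * f x).
Proof.
by move=> [M fM]; exists (`|a| * M) => x; rewrite normrM ler_wpM2l.
Qed.

Lemma bounded_fnD f g : bounded_fn f -> bounded_fn g -> bounded_fn (fun x => f x + g x).
Proof.
move=> [M fM] [M' gM]; exists (M + M') => x.
by apply: le_trans (ler_normD _ _) _; rewrite lerD.
Qed.

Lemma bounded_fn_sum (I : Type) (s : seq I) (F : I -> 'rV[R]_d -> R) :
  (forall i, bounded_fn (F i)) -> bounded_fn (fun x => \sum_(i <- s) F i x).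
Proof.
move=> bF; elim: s => [|i s IH].
  by exists 0 => x; rewrite big_nil normr0.
have := bounded_fnD (bF i) IH; congr bounded_fn.
by apply/funext => x; rewrite big_cons.
Qed.

Lemma bounded_cos (h : 'rV[R]_d -> R) : bounded_fn (fun x => cos (h x)).
Proof. by exists 1 => x; exact: cos_max. Qed.

Lemma bounded_sin (h : 'rV[R]_d -> R) : bounded_fn (fun x => sin (h x)).
Proof. by exists 1 => x; exact: sin_max. Qed.

Lemma bounded_fejer_kernel M (h : 'rV[R]_d -> 'rV[R]_d) :
  bounded_fn (fun x => fejer_kernel M (h x)).
Proof.
apply: bounded_fnZ; apply: bounded_fn_sum => m; apply: bounded_fn_sum => n.
exact: bounded_cos.
Qed.

Section Linear.
Context {gamma : R} {S : set 'rV[R]_d} {sigma : ('rV[R]_d -> R) -> R}.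
Hypothesis sigmaP : decay_functional gamma S sigma.

Lemma sigma0 : sigma (fun=> 0) = 0.
Proof.
have := sigma_lin sigmaP (- 1) bounded_fn0 bounded_fn0.
by under eq_fun do rewrite mulr0 addr0; lra.
Qed.

Lemma sigmaZ a f : bounded_fn f -> sigma (fun x => a * f x) = a * sigma f.
Proof.
move=> bf; have := sigma_lin sigmaP a bf bounded_fn0; rewrite sigma0 addr0 => <-.
by congr sigma; apply/funext => x; rewrite addr0.
Qed.

Lemma sigmaD f g : bounded_fn f -> bounded_fn g ->
  sigma (fun x => f x + g x) = sigma f + sigma g.
Proof.
move=> bf bg; have := sigma_lin sigmaP 1 bf bg; rewrite mul1r => <-.
by congr sigma; apply/funext => x; rewrite mul1r.
Qed.

Lemma sigma_sum (I : Type) (s : seq I) (F : I -> 'rV[R]_d -> R) :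
  (forall i, bounded_fn (F i)) ->
  sigma (fun x => \sum_(i <- s) F i x) = \sum_(i <- s) sigma (F i).
Proof.
move=> bF; elim: s => [|i s IH].
  by rewrite big_nil -[RHS]sigma0; congr sigma; apply/funext => x; rewrite big_nil.
rewrite big_cons -IH -sigmaD//; last exact: bounded_fn_sum.
by congr sigma; apply/funext => x; rewrite big_cons.
Qed.

Lemma sigma_le f g : bounded_fn f -> bounded_fn g -> (forall x, f x <= g x) ->
  sigma f <= sigma g.
Proof.
move=> bf bg fg; have : 0 <= sigma (fun x => -1 * f x + g x).
  apply: sigma_ge0 sigmaP _ _ _ => [|x]; first exact: bounded_fn_lin.
  by rewrite mulN1r addrC subr_ge0.
by rewrite (sigma_lin sigmaP)// mulN1r addrC subr_ge0.
Qed.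

Lemma norm_sigma_cos_le (h : 'rV[R]_d -> R) :
  `|sigma (fun x => cos (h x))| <= sigma (fun=> 1).
Proof.
have b1 : bounded_fn (fun _ : 'rV[R]_d => 1 : R) by exists 1 => x; rewrite normr1.
have bc := bounded_cos h.
rewrite ler_norml; apply/andP; split.
  rewrite -mulN1r -sigmaZ//; apply: sigma_le => //; first exact: bounded_fnZ.
  by move=> x; rewrite mulr1 cos_geN1.
by apply: sigma_le => // x; exact: cos_le1.
Qed.

End Linear.
End DecayFunctional.

(** * Fourier expansion of sums over pairs of atoms *)

Section PairSums.
Context {R : realType} {d : nat}.
Implicit Types (mu : seq (R * 'rV[R]_d)) (k x : 'rV[R]_d).

Definition mass mu : R := \sum_(a <- mu) a.1.

(** This is [|mu^(k)| ^ 2] for the atomic measure with mass [a.1] at the point [a.2]. *)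
Definition fourier_sqr mu k : R :=
  (\sum_(a <- mu) a.1 * cos (dot k a.2)) ^+ 2 +
  (\sum_(a <- mu) a.1 * sin (dot k a.2)) ^+ 2.

Lemma fourier_sqr_ge0 mu k : 0 <= fourier_sqr mu k.
Proof. by rewrite addr_ge0// sqr_ge0. Qed.

Lemma sum_pair_cos mu k :
  \sum_(a <- mu) \sum_(b <- mu) a.1 * b.1 * cos (dot k (a.2 - b.2)) =
  fourier_sqr mu k.
Proof.
rewrite /fourier_sqr !expr2 !big_distrlr -big_split/=; apply: eq_bigr => a _.
rewrite -big_split; apply: eq_bigr => b _ /=; rewrite dotBr cosB; ring.
Qed.

(** Exchanging the two atoms changes the sign of the sine. The sine part of the transform of [sigma]
    therefore cancels in pair sums, which is why [sigma_decay] constrains cosines only. *)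
Lemma sum_pair_sin mu k :
  \sum_(a <- mu) \sum_(b <- mu) a.1 * b.1 * sin (dot k (a.2 - b.2)) = 0.
Proof.
set X := LHS; have : X = - X; last by lra.
rewrite {1}/X exchange_big/= /X -sumrN; apply: eq_bigr => a _.
rewrite -sumrN; apply: eq_bigr => b _.
by rewrite -opprB dotNr sinN mulrN (mulrC b.1).
Qed.

Lemma exchange_big4 (I J : finType) (K : Type) (r : seq K) (F : I -> J -> K -> K -> R) :
  \sum_i \sum_j \sum_(a <- r) \sum_(b <- r) F i j a b =
  \sum_(a <- r) \sum_(b <- r) \sum_i \sum_j F i j a b.
Proof.
transitivity (\sum_i \sum_(a <- r) \sum_j \sum_(b <- r) F i j a b).
  by apply: eq_bigr => i _; rewrite exchange_big.
rewrite exchange_big; apply: eq_bigr => a _ /=.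
transitivity (\sum_i \sum_(b <- r) \sum_j F i j a b).
  by apply: eq_bigr => i _; rewrite exchange_big.
by rewrite exchange_big.
Qed.

Lemma sum_pair_fejer mu M :
  \sum_(a <- mu) \sum_(b <- mu) a.1 * b.1 * fejer_kernel M (a.2 - b.2) =
  (M%:R ^+ d)^-1 * \sum_(m : {ffun 'I_d -> 'I_M}) \sum_(n : {ffun 'I_d -> 'I_M})
     fourier_sqr mu (freq m - freq n).
Proof.
under [in RHS]eq_bigr do under eq_bigr do rewrite -sum_pair_cos.
rewrite exchange_big4 mulr_sumr; apply: eq_bigr => a _.
rewrite mulr_sumr; apply: eq_bigr => b _.
rewrite /fejer_kernel mulrCA; congr (_ * _).
by rewrite mulr_sumr; apply: eq_bigr => m _; rewrite mulr_sumr.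
Qed.

Lemma sum_pair_sigma gamma S sigma mu M t : decay_functional gamma S sigma ->
  \sum_(a <- mu) \sum_(b <- mu) a.1 * b.1 *
     sigma (fun p => fejer_kernel M (a.2 - b.2 - t *: p)) =
  (M%:R ^+ d)^-1 * \sum_(m : {ffun 'I_d -> 'I_M}) \sum_(n : {ffun 'I_d -> 'I_M})
     fourier_sqr mu (freq m - freq n) *
     sigma (fun p => cos (dot (t *: (freq m - freq n)) p)).
Proof.
move=> sP.
have E x : sigma (fun p => fejer_kernel M (x - t *: p)) =
   (M%:R ^+ d)^-1 * \sum_(m : {ffun 'I_d -> 'I_M}) \sum_(n : {ffun 'I_d -> 'I_M})
     (cos (dot (freq m - freq n) x) * sigma (fun p => cos (dot (t *: (freq m - freq n)) p)) +
      sin (dot (freq m - freq n) x) * sigma (fun p => sin (dot (t *: (freq m - freq n)) p))).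
  rewrite (sigmaZ sP); last first.
    by apply: bounded_fn_sum => m; apply: bounded_fn_sum => n; exact: bounded_cos.
  congr (_ * _); rewrite (sigma_sum sP); last first.
    by move=> m; apply: bounded_fn_sum => n; exact: bounded_cos.
  apply: eq_bigr => m _; rewrite (sigma_sum sP); last by move=> n; exact: bounded_cos.
  apply: eq_bigr => n _; rewrite -(sigmaZ sP); last exact: bounded_cos.
  rewrite -(sigmaZ sP); last exact: bounded_sin.
  rewrite -(sigmaD sP); [|apply: bounded_fnZ; exact: bounded_cos
                         |apply: bounded_fnZ; exact: bounded_sin].
  congr sigma; apply/funext => p.
  by rewrite dotBr dotZr dotZl cosB.
under eq_bigr do under eq_bigr do rewrite E.
transitivity ((M%:R ^+ d)^-1 *
  \sum_(m : {ffun 'I_d -> 'I_M}) \sum_(n : {ffun 'I_d -> 'I_M})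
   \sum_(a <- mu) \sum_(b <- mu) a.1 * b.1 *
   (cos (dot (freq m - freq n) (a.2 - b.2)) *
      sigma (fun p => cos (dot (t *: (freq m - freq n)) p)) +
    sin (dot (freq m - freq n) (a.2 - b.2)) *
      sigma (fun p => sin (dot (t *: (freq m - freq n)) p)))).
  rewrite exchange_big4 mulr_sumr.
  apply: eq_bigr => a _; rewrite mulr_sumr.
  apply: eq_bigr => b _; rewrite mulrCA; congr (_ * _).
  rewrite mulr_sumr; apply: eq_bigr => m _.
  by rewrite mulr_sumr; apply: eq_bigr => n _.
congr (_ * _); apply: eq_bigr => m _; apply: eq_bigr => n _.
rewrite -sum_pair_cos mulr_suml.
set sc := sigma (fun p => cos _); set ss := sigma (fun p => sin _).
set k := freq m - freq n.
have -> : \sum_(a <- mu) \sum_(b <- mu) a.1 * b.1 *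
   (cos (dot k (a.2 - b.2)) * sc + sin (dot k (a.2 - b.2)) * ss) =
  (\sum_(a <- mu) \sum_(b <- mu) a.1 * b.1 * cos (dot k (a.2 - b.2))) * sc +
  (\sum_(a <- mu) \sum_(b <- mu) a.1 * b.1 * sin (dot k (a.2 - b.2))) * ss.
  rewrite !mulr_suml -big_split; apply: eq_bigr => a _ /=.
  rewrite !mulr_suml -big_split; apply: eq_bigr => b _ /=; ring.
by rewrite sum_pair_sin mul0r addr0 mulr_suml.
Qed.

End PairSums.

Section FrequencyLevels.
Context {R : realType} {d : nat}.

Lemma ler_sum_inj (A B : finType) (P : pred A) (h : A -> B) (G : B -> R) :
  {in P &, injective h} -> (forall b, 0 <= G b) ->
  \sum_(a | P a) G (h a) <= \sum_b G b.
Proof.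
move=> hinj G0.
have -> : \sum_(a | P a) G (h a) = \sum_(b in [set h a | a in P]%SET) G b.
  by rewrite big_imset.
rewrite [leRHS](bigID (mem [set h a | a in P]%SET))/=.
by rewrite lerDl sumr_ge0.
Qed.

(** A difference [k] with [|k| < L] arises on the left at most once for each of the [M ^ d] choices
    of [n]. On the right it arises at least [L ^ d] times: for [n'] with coordinates in [[0, L)],
    both [L + n'] and [L + n' + k] have coordinates in [[0, 3 * L)]. A truncation of the frequencies
    is thus dominated by a full Fejer sum, which is again a pair sum with a nonnegative kernel. *)
Lemma sum_freq_level (H : 'rV[R]_d -> R) (M L : nat) : (0 < M)%N -> (0 < L)%N ->
  (forall k, 0 <= H k) ->
  (M%:R ^+ d)^-1 * (\sum_(m : {ffun 'I_d -> 'I_M}) \sum_(n : {ffun 'I_d -> 'I_M})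
     (if `|freq m - freq n : 'rV[R]_d| < L%:R then H (freq m - freq n) else 0)) <=
  (L%:R ^+ d)^-1 * (\sum_(m : {ffun 'I_d -> 'I_(3 * L)})
     \sum_(n : {ffun 'I_d -> 'I_(3 * L)}) H (freq m - freq n)).
Proof.
move=> M0 L0 H0.
have MR : 0 < M%:R ^+ d :> R by rewrite exprn_gt0// ltr0n.
have LR : 0 < L%:R ^+ d :> R by rewrite exprn_gt0// ltr0n.
have L3 : (0 < 3 * L)%N by rewrite muln_gt0.
pose o3 (k : nat) : 'I_(3 * L) := insubd (Ordinal L3) k.
have o3E k : (k < 3 * L)%N -> o3 k = k :> nat by move=> h; rewrite val_insubd h.
rewrite ler_pdivrMl// mulrCA ler_pdivlMl//.
rewrite exchange_big/= mulr_sumr.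
set T := \sum_(m : {ffun 'I_d -> 'I_(3 * L)}) _.
apply: (@le_trans _ _ (\sum_(n : {ffun 'I_d -> 'I_M}) T)); last first.
  by rewrite sumr_const card_ffun !card_ord -[leLHS]mulr_natl natrX.
apply: ler_sum => n _; rewrite {}/T exchange_big/=.
rewrite -big_mkcond/=.
pose sh (n' : {ffun 'I_d -> 'I_L}) : {ffun 'I_d -> 'I_(3 * L)} :=
  [ffun i => o3 (L + n' i)%N].
have shE (n' : {ffun 'I_d -> 'I_L}) i : sh n' i = (L + n' i)%N :> nat.
  by rewrite ffunE o3E//; have := ltn_ord (n' i); lia.
have sh_inj : injective sh.
  move=> a b ab; apply/ffunP => i; apply/val_inj => /=.
  by have := shE a i; rewrite ab shE; lia.
pose K (n3 : {ffun 'I_d -> 'I_(3 * L)}) : R :=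
  \sum_(m : {ffun 'I_d -> 'I_(3 * L)}) H (freq m - freq n3).
apply: (@le_trans _ _ (\sum_(n' : {ffun 'I_d -> 'I_L}) K (sh n'))); last first.
  apply: (@ler_sum_inj _ _ predT sh K); first by move=> a b _ _; exact: sh_inj.
  by move=> b; exact: sumr_ge0.
set X : R := \sum_(m | _) _.
have -> : L%:R ^+ d * X = \sum_(n' : {ffun 'I_d -> 'I_L}) X.
  by rewrite sumr_const card_ffun !card_ord -[RHS]mulr_natl natrX.
apply: ler_sum => n' _; rewrite /X /K.
pose h (m : {ffun 'I_d -> 'I_M}) : {ffun 'I_d -> 'I_(3 * L)} :=
  [ffun i => o3 (L + n' i + m i - n i)%N].
have close (m : {ffun 'I_d -> 'I_M}) i : `|freq m - freq n : 'rV[R]_d| < L%:R ->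
    (m i < n i + L)%N /\ (n i < m i + L)%N.
  move=> /(le_lt_trans (coord_le_norm _ i)); rewrite !mxE ltr_norml.
  move=> /andP[h1 h2]; split; rewrite -(ltr_nat R) natrD; lra.
have hE (m : {ffun 'I_d -> 'I_M}) i : `|freq m - freq n : 'rV[R]_d| < L%:R ->
    h m i = (L + n' i + m i - n i)%N :> nat.
  move=> /(close _ i)[h1 h2]; rewrite ffunE o3E//.
  by have := ltn_ord (n' i); lia.
have eqH (m : {ffun 'I_d -> 'I_M}) : `|freq m - freq n : 'rV[R]_d| < L%:R ->
    freq m - freq n = freq (h m) - freq (sh n') :> 'rV[R]_d.
  move=> hm; apply/rowP => i; rewrite !mxE (hE _ _ hm) shE.
  have [h1 h2] := close _ i hm.
  rewrite natrB; last by lia.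
  by rewrite !natrD; ring.
have -> : \sum_(m : {ffun 'I_d -> 'I_M} | `|freq m - freq n : 'rV[R]_d| < L%:R) H (freq m - freq n) =
    \sum_(m : {ffun 'I_d -> 'I_M} | `|freq m - freq n : 'rV[R]_d| < L%:R) H (freq (h m) - freq (sh n')).
  by apply: eq_bigr => m hm; rewrite eqH.
apply: (@ler_sum_inj _ _ _ h (fun m3 => H (freq m3 - freq (sh n')))) => //.
move=> a b /= ha hb ab; apply/ffunP => i; apply/val_inj => /=.
have := hE a i ha; rewrite ab (hE b i hb).
by have [h1 h2] := close _ i ha; have [h3 h4] := close _ i hb; lia.
Qed.

End FrequencyLevels.

(** * Energy estimates for Frostman measures *)

Section CellSums.
Context {R : realType}.

(** Both sides of [a] are compared with telescoping sums of [3 / ((e + 1) * (e + 2))]; each side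
    contributes at most [3]. *)
Lemma sum_inv_sqr_le (N a : nat) : \sum_(k < N) (1 + (k%:R - a%:R) ^+ 2)^-1 <= 6 :> R.
Proof.
pose S n : R := \sum_(k < n) (1 + (k%:R - a%:R) ^+ 2)^-1.
have SS n : S n.+1 = S n + (1 + (n%:R - a%:R) ^+ 2)^-1 by rewrite /S big_ord_recr.
have below n : (n <= a)%N -> S n <= 3 / ((a - n)%:R + 1).
  elim: n => [|n IH] na.
    by rewrite /S big_ord0 divr_ge0// addr_ge0.
  rewrite SS; have /IH h := ltnW na; apply: le_trans (lerD h (lexx _)) _.
  have -> : n%:R - a%:R = - (a - n)%:R :> R by rewrite natrB ?(ltnW na)// opprB.
  rewrite sqrrN; have -> : (a - n = (a - n.+1).+1)%N by lia.
  set D := (a - n.+1)%N; rewrite -[D.+1%:R]natr1.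
  have D0 : 0 <= D%:R :> R by [].
  set e := D%:R in D0 *.
  rewrite -subr_ge0.
  have -> : 3 / (e + 1) - (3 / (e + 1 + 1) + (1 + (e + 1) ^+ 2)^-1) =
     (2 * e ^+ 2 + 3 * e + 4) / ((e + 1) * (e + 1 + 1) * (1 + (e + 1) ^+ 2)).
    by field; rewrite !gt_eqF//; nra.
  by rewrite divr_ge0//; [nra|rewrite ?mulr_ge0 ?addr_ge0 ?sqr_ge0].
have above n : S (a + n)%N <= 6 - 3 / (n%:R + 1).
  elim: n => [|n IH].
    rewrite addn0; have := below a (leqnn a); rewrite subnn add0r divr1; lra.
  rewrite addnS SS; apply: le_trans (lerD IH (lexx _)) _.
  have -> : (a + n)%:R - a%:R = n%:R :> R by rewrite natrD; ring.
  rewrite -[n.+1%:R]natr1; have n0 : 0 <= n%:R :> R by [].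
  (* The product [(2 * e - 1) * (e - 1)] is negative between [1 / 2] and [1]: that [n] is an integer
     matters here. *)
  have n2 : 0 <= 2 * n%:R ^+ 2 - 3 * n%:R + 1 :> R.
    case: (n) => [|m]; first by rewrite expr0n/=; lra.
    by rewrite -[m.+1%:R]natr1; have : 0 <= m%:R :> R by []; nra.
  set e := n%:R in n0 n2 *.
  rewrite -subr_ge0.
  have -> : 6 - 3 / (e + 1 + 1) - (6 - 3 / (e + 1) + (1 + e ^+ 2)^-1) =
     (2 * e ^+ 2 - 3 * e + 1) / ((e + 1) * (e + 1 + 1) * (1 + e ^+ 2)).
    by field; rewrite !gt_eqF//; nra.
  by rewrite divr_ge0//; rewrite ?mulr_ge0 ?addr_ge0 ?sqr_ge0.
have [/below h|h] := leqP N a.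
  apply: le_trans h _; rewrite ler_pdivrMr; last by rewrite ltr_wpDl.
  have : 0 <= (a - N)%:R :> R by []. lra.
have -> : N = (a + (N - a))%N by lia.
by apply: le_trans (above _) _; rewrite gerBl divr_ge0// addr_ge0.
Qed.

Lemma truncn_dist (x y : R) : 0 <= x -> 0 <= y ->
  `|(Num.truncn x)%:R - (Num.truncn y)%:R| - 1 <= `|x - y|.
Proof.
move=> /truncn_itv/andP[x1 x2] /truncn_itv/andP[y1 y2].
move: x2 y2; rewrite -!natr1.
set a := (Num.truncn x)%:R in x1 *; set b := (Num.truncn y)%:R in y1 *.
move=> x2 y2; have h1 := ler_norm (x - y); have := ler_norm (y - x).
by rewrite distrC => h2; rewrite lerBlDr ler_norml; apply/andP; split; lra.
Qed.

(** Points in equal or adjacent cells get the trivial bound [3 * 2 ^ i]. If the cell indices differ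
    by [E >= 2], then [|x - y| >= 2 * (E - 1) / 2 ^ i] and the decay of the kernel applies; [7] is
    large enough because [16 * (1 + E ^ 2) <= 80 * (E - 1) ^ 2], and [7 * 3 * 4 = 84]. *)
Lemma fejer_cell i (x y : R) : 0 <= x <= 1 -> 0 <= y <= 1 ->
  fejer (3 * 2 ^ i) (x - y) <= 7 * 2 ^+ i /
    (1 + ((Num.truncn (2 ^+ i * x / 2))%:R - (Num.truncn (2 ^+ i * y / 2))%:R) ^+ 2).
Proof.
move=> /andP[x0 x1] /andP[y0 y1].
have P0 : 0 < 2 ^+ i :> R by rewrite exprn_gt0.
set P : R := 2 ^+ i in P0 *.
have hx : 0 <= P * x / 2 by rewrite divr_ge0// mulr_ge0// ltW.
have hy : 0 <= P * y / 2 by rewrite divr_ge0// mulr_ge0// ltW.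
have := truncn_dist hx hy.
set D := _%:R - _%:R.
have -> : P * x / 2 - P * y / 2 = P / 2 * (x - y) by field.
rewrite normrM (ger0_norm (x := P / 2)); last by rewrite divr_ge0// ltW.
move=> hD.
have eM : (3 * 2 ^ i)%:R = 3 * P :> R by rewrite natrM natrX.
rewrite -[D ^+ 2]real_normK ?num_real//.
have D0 : 0 <= `|D| by [].
set E := `|D| in hD D0 *.
rewrite ler_pdivlMr; last by rewrite ltr_pwDl// sqr_ge0.
have [E2|E2] := ltP E 2.
  have E1 : E <= 1.
    move: E2; rewrite /E /D.
    set a := Num.truncn _; set b := Num.truncn _.
    have [ab|/ltnW ab] := leqP a b; first rewrite distrC.
      by rewrite -natrB// ger0_norm// (ltr_nat R _ 2) (ler_nat R _ 1).
    by rewrite -natrB// ger0_norm// (ltr_nat R _ 2) (ler_nat R _ 1).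
  apply: (@le_trans _ _ (3 * P * (1 + E ^+ 2))).
    by rewrite ler_wpM2r ?addr_ge0 ?sqr_ge0// -eM fejer_le.
  by have : E ^+ 2 <= 1 by [rewrite expr_le1]; nra.
have d0 : 0 < `|x - y| by nra.
apply: (@le_trans _ _ (16 / (3 * P * (x - y) ^+ 2) * (1 + E ^+ 2))).
  rewrite ler_wpM2r ?addr_ge0 ?sqr_ge0// -eM fejer_decay//.
    by rewrite muln_gt0 expn_gt0.
  rewrite d0/= ler_norml; lra.
rewrite -[(x - y) ^+ 2]real_normK ?num_real//.
set z := `|x - y| in hD d0 *.
rewrite mulrAC ler_pdivrMr; last by rewrite !mulr_gt0// exprn_gt0.
have h : (E - 1) ^+ 2 * 4 <= (P * z) ^+ 2.
  have : (E - 1) ^+ 2 <= (P / 2 * z) ^+ 2.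
    by rewrite ler_pXn2r// nnegrE; [lra|rewrite !mulr_ge0//; lra].
  have -> : (P / 2 * z) ^+ 2 = (P * z) ^+ 2 / 4 by field.
  lra.
have -> : 7 * P * (3 * P * z ^+ 2) = 21 * (P * z) ^+ 2 by ring.
have : (1 + E ^+ 2) <= 5 * (E - 1) ^+ 2 by nra.
lra.
Qed.

End CellSums.

(** * Atomic measures with controlled growth on dyadic cells *)

Section RegularMeasures.
Context {R : realType} {d : nat}.
Implicit Types (mu : seq (R * 'rV[R]_d)) (x y : 'rV[R]_d).

Definition cell (i : nat) x : {ffun 'I_d -> nat} :=
  [ffun l => Num.truncn (2 ^+ i * x 0 l / 2)].

Definition cell_mass mu i k : R := \sum_(a <- mu | cell i a.2 == k) a.1.

(* Dyadic cells of level [i] have side [2 / 2 ^ i], so that the unit cube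
   (faces included) is a single cell of level [0]. *)
Definition regular (q : R) (J : nat) mu : Prop :=
  [/\ forall a, a \in mu -> 0 <= a.1,
      forall a, a \in mu -> unit_cube a.2 &
      forall i k, (i <= J)%N -> cell_mass mu i k <= q ^+ i].

Lemma cell_lt i x l : unit_cube x -> (cell i x l < 2 ^ i)%N.
Proof.
move=> /(_ l) /andP[x0 x1]; rewrite ffunE.
have P0 : 0 < 2 ^+ i :> R by rewrite exprn_gt0.
rewrite -(ltr_nat R) natrX; apply: (@le_lt_trans _ _ (2 ^+ i * x 0 l / 2)).
  have : 0 <= 2 ^+ i * x 0 l / 2 by rewrite divr_ge0// mulr_ge0// ltW.
  by move/truncn_itv/andP => [].
by nra.
Qed.

(** The kernel is replaced by a bound depending on cells only, and the atoms of one cell have mass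
    at most [q ^ i]. The sum over cells of the product bound factors over the coordinates, each
    factor being at most [7 * 2 ^ i * 6]. *)
Lemma fejer_row_sum q J mu i x : regular q J mu -> (i <= J)%N -> 0 <= q ->
  unit_cube x ->
  \sum_(b <- mu) b.1 * fejer_kernel (3 * 2 ^ i) (x - b.2) <=
  q ^+ i * (42 * 2 ^+ i) ^+ d.
Proof.
move=> [mu0 mu1 muq] iJ q0 ux.
have P0 : 0 < 2 ^+ i :> R by rewrite exprn_gt0.
have L0 : (0 < 2 ^ i)%N by rewrite expn_gt0.
pose o (k : nat) : 'I_(2 ^ i) := insubd (Ordinal L0) k.
pose kap y : {ffun 'I_d -> 'I_(2 ^ i)} := [ffun l => o (cell i y l)].
have kapE y l : unit_cube y -> kap y l = cell i y l :> nat.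
  by move=> uy; rewrite ffunE val_insubd cell_lt.
pose w (k : nat) (l : 'I_d) : R := 7 * 2 ^+ i / (1 + ((cell i x l)%:R - k%:R) ^+ 2).
have w0 k l : 0 <= w k l.
  by rewrite divr_ge0 ?mulr_ge0 ?addr_ge0 ?sqr_ge0// ltW.
apply: (@le_trans _ _ (\sum_(b <- mu) b.1 * \prod_l w (kap b.2 l) l)).
  rewrite big_seq [leRHS]big_seq; apply: ler_sum => b bmu.
  rewrite ler_wpM2l ?mu0// fejer_kernel_prod; apply: ler_prod => l _.
  rewrite fejer_ge0/= /w kapE; last exact: mu1.
  rewrite !mxE !ffunE; apply: fejer_cell; first exact: ux.
  exact: mu1.
rewrite (partition_big (fun b => kap b.2) predT)//=.
apply: (@le_trans _ _ (\sum_(k : {ffun 'I_d -> 'I_(2 ^ i)}) q ^+ i * \prod_l w (k l) l)).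
  apply: ler_sum => k _.
  have -> : \sum_(b <- mu | kap b.2 == k) b.1 * \prod_l w (kap b.2 l) l =
      (\sum_(b <- mu | kap b.2 == k) b.1) * \prod_l w (k l) l.
    by rewrite mulr_suml; apply: eq_bigr => b /eqP->.
  rewrite ler_wpM2r ?prodr_ge0//.
  have := muq i [ffun l => nat_of_ord (k l)] iJ; apply: le_trans.
  rewrite /cell_mass big_seq_cond [leRHS]big_seq_cond le_eqVlt; apply/orP; left.
  apply/eqP/eq_bigl => b; case: (boolP (b \in mu)) => //= bmu.
  apply/eqP/eqP => [<-|e]; apply/ffunP => l.
    by rewrite [RHS]ffunE kapE//; exact: mu1.
  by apply/val_inj => /=; rewrite kapE ?e ?ffunE//; exact: mu1.
rewrite -mulr_sumr ler_wpM2l ?exprn_ge0//.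
have := bigA_distr_bigA (fun (l : 'I_d) (k : 'I_(2 ^ i)) => w k l).
move=> /= <-; rewrite -[d in leRHS]card_ord -prodr_const; apply: ler_prod => l _.
rewrite sumr_ge0//= /w -mulr_sumr.
have -> : 42 * 2 ^+ i = 7 * 2 ^+ i * 6 :> R by ring.
rewrite ler_wpM2l ?mulr_ge0 ?(ltW P0)//.
apply: le_trans (sum_inv_sqr_le (2 ^ i) (cell i x l)).
by apply: ler_sum => k _; rewrite -sqrrN opprB.
Qed.

End RegularMeasures.

(** * Counting pairs at a prescribed distance *)

Section PairCount.
Context {R : realType} {d : nat}.
Implicit Types (mu : seq (R * 'rV[R]_d)) (x y k : 'rV[R]_d).

(** A bounded weight that decays like [|k|] to the power [- gamma] is dominated by indicators of the
    balls [|k| < 2 ^ i] with weights [2 ^ (- gamma * i)], and such indicators are what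
    [sum_freq_level] handles. The level [0] serves [k = 0], where decay says nothing. *)
Lemma dyadic_weight (gamma A C t1 t W : R) k (j : nat) :
  0 <= gamma -> 0 <= C -> 0 < t1 -> t1 <= t -> 0 <= A ->
  W <= A -> `|t *: k| `^ gamma * W <= C -> (k = 0 \/ 1 <= `|k|) -> `|k| < 2 ^+ j ->
  W <= (A + C / t1 `^ gamma * 2 `^ gamma) *
    \sum_(i < j.+1) (if `|k| < 2 ^+ i then (2 `^ gamma)^-1 ^+ i else 0).
Proof.
move=> g0 C0 t10 tt A0 WA WC k01 kj.
have G0 : 0 < 2 `^ gamma :> R by rewrite powR_gt0.
have T0 : 0 < t1 `^ gamma by rewrite powR_gt0.
set D := A + _; have D0 : 0 <= D.
  by rewrite addr_ge0// mulr_ge0// ?divr_ge0// ltW.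
have term0 (i : 'I_j.+1) : 0 <= (if `|k| < 2 ^+ i then (2 `^ gamma)^-1 ^+ i else 0).
  by case: ifP => // _; rewrite exprn_ge0// invr_ge0 ltW.
case: k01 => [k0|k1].
  rewrite (bigD1 ord0)//= {1}k0 normr0 expr0 ltr01 expr0 mulrDr mulr1.
  rewrite ler_wpDr ?mulr_ge0 ?sumr_ge0//.
  by rewrite (le_trans WA)// /D lerDl mulr_ge0// ?divr_ge0// ltW.
have ex : exists i, `|k| < 2 ^+ i by exists j.
(* The first ball containing [k] suffices: [2 ^ (i - 1) <= |k|], and the factor [2 ^ gamma] in the
   constant pays for the shift from [i - 1] to [i]. *)
case: (ex_minnP ex) => i ki imin.
have ij : (i < j.+1)%N by rewrite ltnS imin.
have i0 : (0 < i)%N.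
  by case: i ki {imin ij} => //; rewrite expr0 ltNge k1.
have ki' : 2 ^+ i.-1 <= `|k|.
  by rewrite leNgt; apply/negP => /imin; case: (i) i0 => //= n _; rewrite ltnn.
rewrite (bigD1 (Ordinal ij))//= ki mulrDr ler_wpDr ?mulr_ge0 ?sumr_ge0//.
apply: (@le_trans _ _ (C / t1 `^ gamma * 2 `^ gamma * (2 `^ gamma)^-1 ^+ i)); last first.
  by rewrite ler_wpM2r ?exprn_ge0 ?invr_ge0 ?(ltW G0)// /D lerDr.
have [W0|W0] := leP 0 W; last first.
  by rewrite (le_trans (ltW W0))// !mulr_ge0 ?exprn_ge0 ?invr_ge0// ltW.
have h : t1 `^ gamma * (2 `^ gamma) ^+ i.-1 * W <= C.
  apply: le_trans WC; rewrite ler_wpM2r// -powR_mulrn ?powR_ge0// -powRrM mulrC.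
  rewrite [gamma * _]mulrC powRrM powR_mulrn// -powRM ?exprn_ge0// ?(ltW t10)//.
  rewrite ge0_ler_powR ?nnegrE ?mulr_ge0 ?exprn_ge0 ?(ltW t10)//.
  rewrite normrZ gtr0_norm ?(lt_le_trans t10)// mulrC ler_pM ?exprn_ge0 ?(ltW t10)//.
have -> : C / t1 `^ gamma * 2 `^ gamma * (2 `^ gamma)^-1 ^+ i =
     C / (t1 `^ gamma * (2 `^ gamma) ^+ i.-1).
  case: (i) i0 => //= n _; rewrite exprVn exprS; field.
  by rewrite !gt_eqF// exprn_gt0.
by rewrite ler_pdivlMr 1?mulrC// mulr_gt0// exprn_gt0.
Qed.

Lemma freq_diff_norm M (m n : {ffun 'I_d -> 'I_M}) :
  (freq m - freq n = 0 :> 'rV[R]_d \/ 1 <= `|freq m - freq n : 'rV[R]_d|).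
Proof.
have [->|mn] := eqVneq m n; first by left; rewrite subrr.
right; have [l] : exists l, m l != n l.
  by apply/existsP; rewrite -negb_forall; apply: contra mn => /forallP h; apply/eqP/ffunP => l; apply/eqP.
move=> mni; apply: le_trans (coord_le_norm _ l); rewrite !mxE.
have {}mni : (m l != n l :> nat) by [].
wlog lt : m n mni {mn} / (m l < n l)%N.
  move=> h; have [lt|lt|e] := ltngtP (m l) (n l); first exact: h.
    by rewrite distrC; apply: h => //; rewrite eq_sym.
  by rewrite e eqxx in mni.
rewrite distrC -natrB ?(ltnW lt)// ger0_norm//.
by rewrite (ler_nat R 1) subn_gt0.
Qed.

Lemma freq_diff_lt M (m n : {ffun 'I_d -> 'I_M}) : (0 < M)%N ->
  `|freq m - freq n : 'rV[R]_d| < M%:R.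
Proof.
move=> M0; apply: row_norm_lt => [|i]; first by rewrite ltr0n.
rewrite !mxE ltr_norml.
have h1 : (m i)%:R < M%:R :> R by rewrite ltr_nat.
have h2 : (n i)%:R < M%:R :> R by rewrite ltr_nat.
have h3 : 0 <= (m i)%:R :> R by [].
have h4 : 0 <= (n i)%:R :> R by [].
by apply/andP; split; lra.
Qed.

Lemma mass_ge0 q J mu : regular q J mu -> 0 <= mass mu.
Proof.
by move=> [h _ _]; rewrite /mass big_seq; apply: sumr_ge0 => a /h.
Qed.

Lemma sum_pair_fejer_level q J mu i : regular q J mu -> (i <= J)%N -> 0 <= q ->
  \sum_(a <- mu) \sum_(b <- mu) a.1 * b.1 * fejer_kernel (3 * 2 ^ i) (a.2 - b.2)
  <= q ^+ i * (42 * 2 ^+ i) ^+ d * mass mu.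
Proof.
move=> rmu iJ q0; have [mu0 mu1 _] := rmu.
rewrite /mass mulr_sumr big_seq [leRHS]big_seq; apply: ler_sum => a amu.
rewrite mulrC -(mulr_sumr _ _ _ a.1) || idtac.
under eq_bigr do rewrite -mulrA.
rewrite -mulr_sumr mulrC; rewrite ler_wpM2r ?mu0//.
by apply: (fejer_row_sum rmu) => //; exact: mu1.
Qed.

(** Each dyadic level of frequencies is read back in space as a Fejer pair sum of scale [3 * 2 ^ i],
    bounded through the growth of [mu]; with the decay this yields the ratio of the geometric sum.
    The constant [126 = 3 * 42] combines the enlargement of the scale with the row bound. Only
    levels [i <= j <= J] occur, and the constant is independent of [J], [mu] and [t]. *)
Lemma pair_sigma_upper gamma S sigma (q t1 t2 : R) : decay_functional gamma S sigma ->
  0 <= gamma -> 0 < q -> 0 < t1 ->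
  exists2 C, 0 < C & forall J j mu t, regular q J mu -> (j <= J)%N -> t1 <= t <= t2 ->
  \sum_(a <- mu) \sum_(b <- mu) a.1 * b.1 *
     sigma (fun p => fejer_kernel (2 ^ j) (a.2 - b.2 - t *: p)) <=
  C * \sum_(i < j.+1) ((2 `^ gamma)^-1 * q * 2 ^+ d) ^+ i * mass mu.
Proof.
move=> sP g0 q0 t10; have [C HC] := sigma_decay sP.
have G0 : 0 < 2 `^ gamma :> R by rewrite powR_gt0.
pose A := sigma (fun=> 1); pose C1 := `|C|.
have A0 : 0 <= A by apply: sigma_ge0 sP _ _ _ => //; exists 1 => x; rewrite normr1.
pose D := A + C1 / t1 `^ gamma * 2 `^ gamma + 1.
have D1 : A + C1 / t1 `^ gamma * 2 `^ gamma <= D by rewrite lerDl.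
have D0 : 0 < D.
  by rewrite ltr_wpDl// addr_ge0// !mulr_ge0 ?invr_ge0 ?powR_ge0 ?normr_ge0.
exists (D * 126 ^+ d) => [|J j mu t rmu jJ /andP[tt1 tt2]].
  by rewrite mulr_gt0// exprn_gt0.
have Tot0 := mass_ge0 rmu.
rewrite (sum_pair_sigma _ _ _ sP).
have M0 : (0 < 2 ^ j)%N by rewrite expn_gt0.
have Md : 0 < ((2 ^ j)%:R ^+ d)^-1 :> R by rewrite invr_gt0 exprn_gt0// ltr0n.
set g := (2 `^ gamma)^-1; have gg0 : 0 < g by rewrite invr_gt0.
pose F := fourier_sqr mu.
apply: (@le_trans _ _ (((2 ^ j)%:R ^+ d)^-1 *
  (\sum_(m : {ffun 'I_d -> 'I_(2 ^ j)}) \sum_(n : {ffun 'I_d -> 'I_(2 ^ j)})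
   \sum_(i < j.+1) D * g ^+ i *
     (if `|freq m - freq n : 'rV[R]_d| < (2 ^ i)%:R then F (freq m - freq n) else 0)))).
  rewrite ler_pM2l//; apply: ler_sum => m _; apply: ler_sum => n _.
  set k := freq m - freq n.
  have Fk : 0 <= F k := fourier_sqr_ge0 _ _.
  have kn : k = 0 \/ 1 <= `|k| := freq_diff_norm m n.
  have kj : `|k| < 2 ^+ j by rewrite -natrX; exact: freq_diff_lt.
  set W := sigma _.
  have hW : `|W| <= (A + C1 / t1 `^ gamma * 2 `^ gamma) *
    \sum_(i < j.+1) (if `|k| < 2 ^+ i then g ^+ i else 0).
    apply: (dyadic_weight (t := t)) => //; first exact: normr_ge0.
      exact: (norm_sigma_cos_le sP).
    by apply: le_trans (HC (t *: k)) _; exact: ler_norm.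
  apply: (@le_trans _ _ (F k * (D * \sum_(i < j.+1) (if `|k| < 2 ^+ i then g ^+ i else 0)))).
    rewrite ler_wpM2l//; apply: le_trans (ler_norm _) _; apply: le_trans hW _.
    by rewrite ler_wpM2r// sumr_ge0// => i _; case: ifP => // _; rewrite exprn_ge0// ltW.
  rewrite !mulr_sumr le_eqVlt; apply/orP; left; apply/eqP; apply: eq_bigr => i _.
  by rewrite natrX; case: ifP => _; rewrite ?mulr0//; ring.
under eq_bigr do rewrite exchange_big/=.
rewrite exchange_big/= mulr_sumr [leRHS]mulr_sumr.
apply: ler_sum => i _.
have iJ : (i <= J)%N by apply: leq_trans jJ; rewrite -ltnS.
have L0 : (0 < 2 ^ i)%N by rewrite expn_gt0.
have := sum_freq_level M0 L0 (fourier_sqr_ge0 mu).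
set X := \sum_(m : {ffun 'I_d -> 'I_(2 ^ j)}) _ => hX.
apply: (@le_trans _ _ (D * g ^+ i * (((2 ^ j)%:R ^+ d)^-1 * X))).
  rewrite mulrCA ler_wpM2l// ?(ltW Md)//.
  rewrite mulr_sumr le_eqVlt; apply/orP; left; apply/eqP; apply: eq_bigr => m _.
  by rewrite mulr_sumr.
apply: (@le_trans _ _ (D * g ^+ i * (3 ^+ d * (q ^+ i * (42 * 2 ^+ i) ^+ d * mass mu)))).
  rewrite ler_wpM2l ?mulr_ge0 ?exprn_ge0 ?(ltW D0) ?(ltW gg0)//.
  apply: le_trans hX _.
  have := sum_pair_fejer_level rmu iJ (ltW q0); rewrite sum_pair_fejer.
  set Y := \sum_(m : {ffun 'I_d -> 'I_(3 * 2 ^ i)}) _.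
  have -> : ((2 ^ i)%:R ^+ d)^-1 * Y = 3 ^+ d * (((3 * 2 ^ i)%:R ^+ d)^-1 * Y).
    rewrite natrM exprMn; field.
    by rewrite !expf_neq0// pnatr_eq0 -lt0n.
  by move=> hY; rewrite ler_wpM2l// exprn_ge0.
have -> : 126 ^+ d = 3 ^+ d * 42 ^+ d :> R by rewrite -exprMn -natrM.
rewrite !exprMn -!exprM (mulnC d i) le_eqVlt; apply/orP; left; apply/eqP.
ring.
Qed.

(** For a counted pair the kernel of scale [2 ^ j] is at least [(2 ^ j) ^ d / 4] on a piece of the
    surface of radius about [2 ^ - j], so [sigma_lower] makes the pair contribute about [2 ^ j]
    times its weight. In the upper bound the geometric sum of ratio [r] is compared with
    [h = 2 ^ (1 - beta) >= 1], which treats [r < 1] and [r >= 1] alike; dividing,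
    [h / 2 = 2 ^ - beta]. *)
Lemma pair_count gamma S sigma (q beta t1 t2 : R) : decay_functional gamma S sigma ->
  (0 < d)%N -> 0 <= gamma -> 0 < q -> 0 < t1 -> 1 <= t2 -> beta <= 1 ->
  (2 `^ gamma)^-1 * q * 2 ^+ d < 2 `^ (1 - beta) ->
  exists2 C, 0 < C & forall J j mu t, regular q J mu -> (j <= J)%N -> t1 <= t <= t2 ->
  \sum_(a <- mu) \sum_(b <- mu | `[< exists2 p, S p &
        `|a.2 - b.2 - t *: p| <= (2 * d%:R * 2 ^+ j)^-1 >]) a.1 * b.1 <=
  C * (2 `^ (- beta)) ^+ j * mass mu.
Proof.
move=> sP d0 g0 q0 t10 t21 b1 hr.
have [C0 C00 HC] := pair_sigma_upper t2 sP g0 q0 t10.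
have [c c0 Hc] := sigma_lower sP.
have G0 : 0 < 2 `^ gamma :> R by rewrite powR_gt0.
set r := _ * q * _ in hr HC.
have r0 : 0 < r by rewrite !mulr_gt0 ?invr_gt0// exprn_gt0.
set h := 2 `^ (1 - beta) in hr.
have h0 : 0 < h by rewrite powR_gt0.
have h1 : 1 <= h.
  by have := ler_powR (ler1n R 2) (y := 1 - beta) (x := 0); rewrite powRr0; apply; lra.
pose rho := r / h.
have rho1 : rho < 1 by rewrite ltr_pdivrMr// mul1r.
have rho0 : 0 <= rho by rewrite divr_ge0// ltW.
have dR : 0 < d%:R :> R by rewrite ltr0n.
have t20 : 0 < t2 by rewrite (lt_le_trans _ t21).
pose c' := c / 4 / (2 * d%:R * t2) ^+ d.-1.
have dt0 : 0 < 2 * d%:R * t2 by rewrite !mulr_gt0.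
have c'0 : 0 < c' by rewrite !divr_gt0// exprn_gt0.
have K0 : 0 < 1 - rho by rewrite subr_gt0.
exists (C0 / (1 - rho) / c') => [|J j mu t rmu jJ tt]; first exact: divr_gt0 (divr_gt0 C00 K0) c'0.
have Tot0 := mass_ge0 rmu; have [mu0 mu1 _] := rmu.
have M0 : 0 < 2 ^+ j :> R by rewrite exprn_gt0.
have := HC J j mu t rmu jJ tt.
set U := (X in X <= _) => HU.
have low : c' * 2 ^+ j * \sum_(a <- mu) \sum_(b <- mu | `[< exists2 p, S p &
        `|a.2 - b.2 - t *: p| <= (2 * d%:R * 2 ^+ j)^-1 >]) a.1 * b.1 <= U.
  rewrite mulr_sumr /U big_seq [leRHS]big_seq; apply: ler_sum => a amu.
  rewrite mulr_sumr big_seq_cond [leRHS]big_seq [leLHS]big_mkcond [leRHS]big_mkcond/=.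
  apply: ler_sum => b _; case: (boolP (b \in mu)) => //= bmu.
  have ab0 : 0 <= a.1 * b.1 by rewrite mulr_ge0 ?mu0.
  have bK : bounded_fn (fun p => fejer_kernel (2 ^ j) (a.2 - b.2 - t *: p)).
    exact: bounded_fejer_kernel.
  case: asboolP => [[p Sp hp]|_]; last first.
    by rewrite mulr_ge0// (sigma_ge0 sP)// => x; exact: fejer_kernel_ge0.
  rewrite mulrC ler_wpM2l//.
  have Md : 0 < 2 ^+ j ^+ d :> R by rewrite exprn_gt0.
  (* With this radius the argument of the kernel has norm at most [(2 * d * 2 ^ j)^-1 + t2 * s], and
     [d * 2 ^ j] times that is exactly [1], the threshold of [fejer_kernel_lower]. *)
  pose s := (2 * d%:R * t2 * 2 ^+ j)^-1.
  have s0 : 0 < s by rewrite invr_gt0 mulr_gt0.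
  have s1 : s <= 1.
    rewrite invf_le1 ?mulr_gt0//.
    have : 1 <= 2 ^+ j :> R by rewrite exprn_ege1// ler1n.
    have : 1 <= d%:R :> R by rewrite ler1n.
    nra.
  have /andP[tt1 tt2] := tt; have t0 : 0 < t by exact: lt_le_trans tt1.
  have := Hc p s (fun x => 4 / (2 ^+ j) ^+ d * fejer_kernel (2 ^ j) (a.2 - b.2 - t *: x)).
  rewrite s0 s1 => /(_ Sp isT (bounded_fnZ _ bK)) H.
  have {H} : c * s ^+ d.-1 <= sigma (fun x => 4 / (2 ^+ j) ^+ d *
     fejer_kernel (2 ^ j) (a.2 - b.2 - t *: x)).
    apply: H => x.
      by rewrite mulr_ge0 ?fejer_kernel_ge0// divr_ge0// ltW.
    move=> hx; rewrite -ler_pdivrMl ?divr_gt0// mulr1 invf_div.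
    rewrite -natrX; apply: fejer_kernel_lower => //; first by rewrite expn_gt0.
    have -> : a.2 - b.2 - t *: x = (a.2 - b.2 - t *: p) - t *: (x - p).
      by rewrite scalerBr opprB addrA addrNK.
    apply: (@le_trans _ _ (d%:R * (2 ^+ j) * ((2 * d%:R * 2 ^+ j)^-1 + t2 * s))).
      rewrite natrX ler_wpM2l ?mulr_ge0 ?(ltW M0)//.
      apply: le_trans (ler_normB _ _) _; rewrite lerD// normrZ.
      by rewrite gtr0_norm// ler_pM// ltW.
    rewrite le_eqVlt; apply/orP; left; apply/eqP; rewrite /s; field.
    by rewrite !gt_eqF.
  rewrite (sigmaZ sP)//; set sK := sigma _ => hs.
  have -> : c' * 2 ^+ j = (2 ^+ j) ^+ d / 4 * (c * s ^+ d.-1).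
    have -> : (2 ^+ j) ^+ d = 2 ^+ j * (2 ^+ j) ^+ d.-1 :> R by rewrite -exprS prednK.
    rewrite /c' /s; set B := 2 * d%:R * t2 in dt0 *.
    rewrite exprVn [(B * _) ^+ _]exprMn.
    have n1 : B ^+ d.-1 != 0 by rewrite expf_neq0// gt_eqF.
    have n2 : (2 ^+ j) ^+ d.-1 != 0 :> R by rewrite !expf_neq0.
    move: n1 n2; move: (B ^+ _) ((2 ^+ j) ^+ _) => u v n1 n2.
    by field; rewrite n1 n2.
  rewrite -ler_pdivlMl ?divr_gt0// invf_div; exact: hs.
have up : U <= C0 / (1 - rho) * h ^+ j * mass mu.
  apply: le_trans HU _; rewrite -mulr_suml mulrA ler_wpM2r//.
  rewrite -mulrA ler_pM2l//.
  rewrite [leRHS]mulrC ler_pdivlMr//.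
  apply: (@le_trans _ _ (h ^+ j * (\sum_(i < j.+1) rho ^+ i) * (1 - rho))).
    rewrite ler_pM2r// mulr_sumr; apply: ler_sum => i _.
    have -> : r = h * rho by rewrite /rho mulrC divfK// gt_eqF.
    by rewrite exprMn ler_wpM2r ?exprn_ge0// ler_weXn2l// -ltnS.
  rewrite -mulrA ler_piMr ?exprn_ge0 ?(ltW h0)//.
  have := subrX1 rho j.+1; have : 0 <= rho ^+ j.+1 by rewrite exprn_ge0.
  lra.
have := le_trans low up.
have -> : 2 `^ (- beta) = h / 2.
  have -> : h = 2 `^ 1 * 2 `^ (- beta) by rewrite -powRD// pnatr_eq0 implybT.
  by rewrite powRr1//; field.
rewrite -ler_pdivlMl; last exact: mulr_gt0 c'0 M0.
move/le_trans; apply.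
rewrite expr_div_n le_eqVlt; apply/orP; left; apply/eqP; field.
by rewrite !gt_eqF.
Qed.

End PairCount.

(** * Frostman's lemma on the dyadic tree *)

Section Frostman.
Context {R : realType} {d : nat}.
Implicit Types (mu : seq (R * 'rV[R]_d)) (x y : 'rV[R]_d) (E : set 'rV[R]_d).

Lemma truncn_half (x : R) : 0 <= x -> (Num.truncn (2 * x))./2 = Num.truncn x.
Proof.
move=> x0; have /truncn_itv/andP[] : 0 <= 2 * x by rewrite mulr_ge0.
have /truncn_itv/andP[] := x0.
set a := Num.truncn x; set b := Num.truncn (2 * x) => h1 h2 h3 h4.
have : (2 * a < b.+1)%N by rewrite -(ltr_nat R) natrM; lra.
have : (b < 2 * a.+1)%N by rewrite -(ltr_nat R) natrM; lra.
lia.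
Qed.

Lemma cell_half i x l : unit_cube x -> (cell i.+1 x l)./2 = cell i x l.
Proof.
move=> /(_ l)/andP[x0 x1]; rewrite !ffunE exprS -!mulrA truncn_half//.
by rewrite mulrA divr_ge0// mulr_ge0// exprn_ge0.
Qed.

Lemma cell_coarse i n x y : unit_cube x -> unit_cube y ->
  cell (i + n) x = cell (i + n) y -> cell i x = cell i y.
Proof.
move=> ux uy; elim: n => [|n IH]; first by rewrite addn0.
rewrite addnS => e; apply: IH; apply/ffunP => l.
by rewrite -(cell_half _ _ ux) -(cell_half _ _ uy) e.
Qed.

Lemma cell_mass_le_mass mu i k : (forall a, a \in mu -> 0 <= a.1) ->
  cell_mass mu i k <= mass mu.
Proof.
move=> mu0; rewrite /cell_mass /mass [leRHS](bigID (fun a => cell i a.2 == k))/=.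
by rewrite lerDl big_seq_cond sumr_ge0// => a /andP[/mu0].
Qed.

Definition child (k : {ffun 'I_d -> nat}) (c : {ffun 'I_d -> bool}) :
  {ffun 'I_d -> nat} := [ffun l => (k l).*2 + c l]%N.

Lemma child_inj k : injective (child k).
Proof.
move=> c c' e; apply/ffunP => l; have := congr1 (fun f : {ffun _ -> nat} => f l) e.
by rewrite !ffunE => /addnI; case: (c l); case: (c' l).
Qed.

(** A flow and a cut on the tree of cells below [k], as in the max-flow min-cut theorem: [mu]
    respects the capacity [q ^ i'] of each cell down to level [i + n], and [cov] is a cut whose
    total capacity does not exceed the mass of [mu]. *)
Record frostman_piece (q : R) E n i k mu (cov : seq (nat * {ffun 'I_d -> nat})) :
    Prop := {
  fp_atoms : forall a, a \in mu -> [/\ 0 <= a.1, E a.2 & cell i a.2 = k] ;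
  fp_mass : forall i' k', (i <= i' <= i + n)%N -> cell_mass mu i' k' <= q ^+ i' ;
  fp_cover : forall x, E x -> cell i x = k ->
     exists2 p, p \in cov & cell p.1 x = p.2 ;
  fp_cost : \sum_(p <- cov) q ^+ p.1 <= mass mu }.

(* Finite form of Frostman's lemma, from the leaves to the root: the masses of
   the children are added, and scaled down when they exceed the capacity of
   their parent, which then enters the cover instead of them. *)
Lemma frostman_pieceP q E n i k : 0 <= q -> E `<=` unit_cube ->
  exists mu cov, frostman_piece q E n i k mu cov.
Proof.
move=> q0 EU; elim: n i k => [|n IH] i k.
  have [[x [Ex xk]]|nE] := pselect (exists x, E x /\ cell i x = k).
    exists [:: (q ^+ i, x)], [:: (i, k)]; split => /=.
    - by move=> a; rewrite inE => /eqP-> /=; split => //; exact: exprn_ge0.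
    - move=> i' k'; rewrite addn0 => h; have -> : i' = i by lia.
      by rewrite /cell_mass big_cons big_nil /=; case: ifP => _; rewrite ?addr0 ?exprn_ge0.
    - by move=> y Ey yk; exists (i, k) => //; rewrite inE.
    - by rewrite /mass !big_cons !big_nil.
  exists [::], [::]; split => //.
  - by move=> i' k' _; rewrite /cell_mass big_nil exprn_ge0.
  - by move=> x Ex xk; case: nE; exists x.
  - by rewrite /mass !big_nil.
have /choice[mu_ /choice[cov_ H]] c : exists mu cov,
   frostman_piece q E n i.+1 (child k c) mu cov by exact: IH.
pose mu := flatten [seq mu_ c | c <- enum {ffun 'I_d -> bool}].
pose cov := flatten [seq cov_ c | c <- enum {ffun 'I_d -> bool}].
have in_mu a : a \in mu -> exists c, a \in mu_ c.
  by move=> /flattenP[s /mapP[c _ ->] h]; exists c.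
have mu0 a : a \in mu -> 0 <= a.1.
  by move=> /in_mu[c /(fp_atoms (H c))[]].
have muE a : a \in mu -> E a.2 by move=> /in_mu[c /(fp_atoms (H c))[]].
have muk a : a \in mu -> cell i a.2 = k.
  move=> /in_mu[c /(fp_atoms (H c))[_ Ea e]]; apply/ffunP => l.
  rewrite -cell_half ?e; last exact: EU.
  by rewrite ffunE; case: (c l); rewrite ?addn0 ?addn1 ?doubleK// -[LHS]/(uphalf (k l).*2) uphalf_double.
have massmu : mass mu = \sum_c mass (mu_ c).
  by rewrite /mass big_flatten big_map big_enum.
have cmass i' k' : cell_mass mu i' k' = \sum_c cell_mass (mu_ c) i' k'.
  by rewrite /cell_mass big_flatten big_map big_enum.
(* A cell of level greater than [i] lies in a single child, so at most one of the summed measures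
   charges it. *)
have fine i' k' : (i.+1 <= i' <= i.+1 + n)%N -> cell_mass mu i' k' <= q ^+ i'.
  move=> hi; rewrite cmass.
  have [[c0 [a [ac ak]]]|none] := pselect (exists c a, a \in mu_ c /\ cell i' a.2 = k').
    rewrite (bigD1 c0)//= big1 ?addr0; first exact: (fp_mass (H c0)).
    move=> c cc0; rewrite /cell_mass big_seq_cond big1// => b /andP[bc /eqP bk].
    have [_ Ea ea] := fp_atoms (H c0) ac; have [_ Eb eb] := fp_atoms (H c) bc.
    suff : c = c0 by move=> e; rewrite e eqxx in cc0.
    apply: (@child_inj k); rewrite -ea -eb.
    apply: (@cell_coarse i.+1 (i' - i.+1)); [exact: EU|exact: EU|].
    by rewrite subnKC ?bk ?ak//; case/andP: hi.
  rewrite big1 ?exprn_ge0// => c _.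
  rewrite /cell_mass big_seq_cond big1// => b /andP[bc /eqP bk].
  by case: none; exists c, b.
have cov_ok x : E x -> cell i x = k -> exists2 p, p \in cov & cell p.1 x = p.2.
  move=> Ex xk; pose c : {ffun 'I_d -> bool} := [ffun l => odd (cell i.+1 x l)].
  have xc : cell i.+1 x = child k c.
    apply/ffunP => l; have cl : c l = odd (cell i.+1 x l) by rewrite ffunE.
    rewrite [RHS]ffunE cl -xk -cell_half; last exact: EU.
    by rewrite addnC odd_double_half.
  have [p pc pe] := fp_cover (H c) Ex xc; exists p => //.
  by apply/flattenP; exists (cov_ c) => //; apply: map_f; rewrite mem_enum.
have cost : \sum_(p <- cov) q ^+ p.1 <= mass mu.
  rewrite massmu /cov big_flatten big_map big_enum/=.
  by apply: ler_sum => c _; exact: (fp_cost (H c)).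
have [small|big] := leP (mass mu) (q ^+ i).
  exists mu, cov; split => //.
    by move=> a ha; split; [exact: mu0|exact: muE|exact: muk].
  move=> i' k' /andP[]; rewrite leq_eqVlt => /orP[/eqP<- _|ii' i'n].
    by apply: le_trans small; exact: cell_mass_le_mass.
  by apply: fine; rewrite ii' addSnnS.
have m0 : 0 < mass mu by apply: le_lt_trans big; exact: exprn_ge0.
pose th := q ^+ i / mass mu.
have th0 : 0 <= th by rewrite divr_ge0 ?exprn_ge0// ltW.
have th1 : th <= 1 by rewrite ler_pdivrMr// mul1r ltW.
pose mu' := [seq (th * a.1, a.2) | a <- mu].
have massmu' : mass mu' = q ^+ i.
  rewrite /mass big_map /= -mulr_sumr /th -/(mass mu) divfK//.
  by rewrite gt_eqF.
have cmu' i' k' : cell_mass mu' i' k' = th * cell_mass mu i' k'.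
  by rewrite /cell_mass big_map /= -mulr_sumr.
have mu'0 a : a \in mu' -> 0 <= a.1.
  by move=> /mapP[b /mu0 b0 ->] /=; exact: mulr_ge0.
exists mu', [:: (i, k)]; split.
- move=> a ha; split; first exact: mu'0.
    by move: ha => /mapP[b /muE ? ->].
  by move: ha => /mapP[b /muk ? ->].
- move=> i' k' /andP[]; rewrite leq_eqVlt => /orP[/eqP<- _|ii' i'n].
    by rewrite -massmu'; exact: cell_mass_le_mass.
  rewrite cmu'; apply: (@le_trans _ _ (cell_mass mu i' k')); last first.
    by apply: fine; rewrite ii' addSnnS.
  by rewrite ler_piMl// /cell_mass big_seq_cond sumr_ge0// => a /andP[/mu0].
- by move=> x _ xk; exists (i, k) => //; rewrite inE.
- by rewrite massmu' big_cons big_nil addr0.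
Qed.

Lemma frostman q E (J : nat) : 0 <= q -> E `<=` unit_cube ->
  exists mu (cov : seq (nat * {ffun 'I_d -> nat})),
  [/\ regular q J mu, forall a, a \in mu -> E a.2,
      forall x, E x -> exists2 p, p \in cov & cell p.1 x = p.2 &
      \sum_(p <- cov) q ^+ p.1 <= mass mu].
Proof.
move=> q0 EU; have [mu [cov H]] := frostman_pieceP J 0%N [ffun=> 0%N] q0 EU.
exists mu, cov; split; last exact: (fp_cost H).
- split.
  + by move=> a /(fp_atoms H)[].
  + by move=> a /(fp_atoms H)[_ /EU].
  + by move=> i k iJ; apply: (fp_mass H).
- by move=> a /(fp_atoms H)[].
- move=> x Ex; apply: (fp_cover H Ex); apply/ffunP => l.
  by have := cell_lt 0 l (EU _ Ex); rewrite expn0 ltnS leqn0 => /eqP->; rewrite ffunE.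
Qed.

End Frostman.

(** * Hausdorff content *)

Section HausdorffContent.
Context {R : realType}.

Section Abstract.
Context {T : Type} (dist : T -> T -> R).
Implicit Types (A : set T).

Lemma ediam_ge0 A : (0 <= ediam dist A)%E.
Proof. by apply: ereal_sup_ubound; left. Qed.

Lemma ediam_le A (r : R) : 0 <= r -> (forall x y, A x -> A y -> dist x y <= r) ->
  (ediam dist A <= r%:E)%E.
Proof.
move=> r0 h; apply: ge_ereal_sup => z [->|[x Ax [y Ay <-]]]; first by rewrite lee_fin.
by rewrite lee_fin h.
Qed.

Lemma ediam0 : ediam dist set0 = 0%E.
Proof. by apply/eqP; rewrite eq_le ediam_ge0 andbT; apply: ediam_le. Qed.

Lemma hausdorff_cost_ge0 s A : (0 <= hausdorff_cost dist s A)%E.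
Proof. by rewrite /hausdorff_cost; case: ifP => // _; exact: poweR_ge0. Qed.

Lemma hausdorff_cost0 s : hausdorff_cost dist s set0 = 0%E.
Proof. by rewrite /hausdorff_cost eqxx. Qed.

Lemma hausdorff_cost_le s A (r : R) : 0 <= s -> 0 <= r -> (ediam dist A <= r%:E)%E ->
  (hausdorff_cost dist s A <= (r `^ s)%:E)%E.
Proof.
move=> s0 r0 h; rewrite /hausdorff_cost; case: ifP => _.
  by rewrite lee_fin powR_ge0.
rewrite -poweR_EFin; apply: gt0_ler_poweR => //.
  by rewrite in_itv/= ediam_ge0 leey.
by rewrite in_itv/= lee_fin r0 leey.
Qed.

Lemma hausdorff_premeasure_ge0 s delta A : (0 <= hausdorff_premeasure dist s delta A)%E.
Proof.
apply: le_ereal_inf_tmp => z [F _ <-].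
by apply: nneseries_ge0 => n _ _; exact: hausdorff_cost_ge0.
Qed.

Lemma hausdorff_premeasure_le s delta A (G : seq (set T)) (r : nat -> R) :
  0 <= s -> 0 <= delta -> (forall x, A x -> exists2 k, (k < size G)%N & nth set0 G k x) ->
  (forall k, (k < size G)%N -> 0 <= r k <= delta) ->
  (forall k, (k < size G)%N -> (ediam dist (nth set0 G k) <= (r k)%:E)%E) ->
  (hausdorff_premeasure dist s delta A <= (\sum_(0 <= k < size G) (r k) `^ s)%:E)%E.
Proof.
move=> s0 d0 cov rd dG.
apply: (@le_trans _ _ (\sum_(0 <= k <oo) hausdorff_cost dist s (nth set0 G k))%E).
  apply: ereal_inf_lbound; exists (fun k => nth set0 G k) => //; split.
    by move=> x /cov[k _ h]; exists k.
  move=> k; have [Gk|kG] := leqP (size G) k; first by rewrite nth_default// ediam0 lee_fin.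
  by apply: le_trans (dG _ kG) _; rewrite lee_fin; have /andP[] := rd _ kG.
rewrite (nneseries_split 0 (size G))//; last first.
  by move=> k _; exact: hausdorff_cost_ge0.
rewrite [X in (_ + X)%E]eseries0 ?adde0; last first.
  by move=> k Gk _; rewrite nth_default ?hausdorff_cost0.
rewrite add0n -sumEFin !big_mkord; apply: lee_sum => k _.
by apply: hausdorff_cost_le => //; [have /andP[] := rd _ (ltn_ord k)|exact: dG].
Qed.

Lemma hausdorff_measure_pos s A : hausdorff_measure dist s A != 0%E ->
  exists2 delta : R, 0 < delta & exists2 eta : R, 0 < eta &
    (eta%:E <= hausdorff_premeasure dist s delta A)%E.
Proof.
move=> m0; apply: contrapT => h; move/eqP: m0; apply.
apply/eqP; rewrite eq_le; apply/andP; split.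
  apply: ge_ereal_sup => z [delta /= d0 <-]; rewrite leNgt; apply/negP => pos.
  apply: h; exists delta => //; move: pos.
  case: (hausdorff_premeasure dist s delta A) => [r|_|//].
    by rewrite lte_fin => r0; exists r.
  by exists 1; rewrite ?leey.
apply: (@le_trans _ _ (hausdorff_premeasure dist s 1 A)).
  exact: hausdorff_premeasure_ge0.
by apply: ereal_sup_ubound; exists 1 => //=.
Qed.

End Abstract.

Context {d : nat}.
Implicit Types (x y : 'rV[R]_d) (E : set 'rV[R]_d).

Lemma eucl_norm_le x (c : R) : 0 <= c -> (forall l, `|x 0 l| <= c) ->
  eucl_norm x <= Num.sqrt d%:R * c.
Proof.
move=> c0 h; have -> : c = Num.sqrt (c ^+ 2) by rewrite sqrtr_sqr ger0_norm.
rewrite /eucl_norm -sqrtrM// ler_sqrt.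
  rewrite /dot; apply: (@le_trans _ _ (\sum_(j < d) c ^+ 2)).
    apply: ler_sum => l _; rewrite -expr2 -real_normK ?num_real//.
    by rewrite ler_pXn2r ?nnegrE.
  by rewrite sumr_const card_ord -[leLHS]mulr_natl.
by rewrite mulr_ge0// sqr_ge0.
Qed.

Lemma cell_close i x y l : unit_cube x -> unit_cube y -> cell i x = cell i y ->
  `|x 0 l - y 0 l| <= 2 * 2^-1 ^+ i.
Proof.
move=> /(_ l)/andP[x0 _] /(_ l)/andP[y0 _] /(congr1 (fun f : {ffun _ -> nat} => f l)).
rewrite !ffunE => e.
have P0 : 0 < 2 ^+ i :> R by rewrite exprn_gt0.
have /truncn_itv/andP[] : 0 <= 2 ^+ i * x 0 l / 2 by rewrite divr_ge0// mulr_ge0// ltW.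
have /truncn_itv/andP[] : 0 <= 2 ^+ i * y 0 l / 2 by rewrite divr_ge0// mulr_ge0// ltW.
rewrite e -[(Num.truncn _).+1%:R]natr1; set n := (Num.truncn _)%:R => h1 h2 h3 h4.
rewrite exprVn ler_pdivlMr// -[2 ^+ i in leLHS]gtr0_norm// -normrM ler_norml.
by apply/andP; split; lra.
Qed.

(** A positive Hausdorff measure controls only covers of small diameter. A cover that uses a cell of
    level below [j0] already costs [q ^ j0] through that cell; otherwise all its cells have diameter
    at most [delta] and the premeasure bound applies. *)
Lemma content_pos s E : 0 <= s -> E `<=` unit_cube ->
  hausdorff_measure eucl_dist s E != 0%E ->
  exists2 eta : R, 0 < eta & forall cov : seq (nat * {ffun 'I_d -> nat}),
    (forall x, E x -> exists2 p, p \in cov & cell p.1 x = p.2) ->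
    eta <= \sum_(p <- cov) (2 `^ (- s)) ^+ p.1.
Proof.
move=> s0 EU /hausdorff_measure_pos[delta d0 [eta e0 heta]].
set q : R := 2 `^ (- s).
have q0 : 0 < q by rewrite powR_gt0.
have q1 : q <= 1.
  by have := ler_powR (ler1n R 2) (x := - s) (y := 0); rewrite powRr0 oppr_le0; exact.
pose D : R := Num.sqrt d%:R * 2 + 1.
have D0 : 0 < D by rewrite ltr_wpDl// mulr_ge0// sqrtr_ge0.
have Ds0 : 0 < D `^ s by rewrite powR_gt0.
have [j0 hj0] : exists j0, forall j, (j0 <= j)%N -> D * 2^-1 ^+ j <= delta.
  have [n hn] := nat_above (D / delta).
  exists n => j nj; rewrite exprVn ler_pdivrMr ?exprn_gt0// mulrC -ler_pdivrMr//.
  apply: le_trans (ltW hn) _; rewrite -natrX ler_nat.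
  by apply: leq_trans nj _; apply: ltnW; exact: ltn_expl.
exists (Num.min (q ^+ j0) (eta / D `^ s)).
  by rewrite lt_min exprn_gt0// divr_gt0.
move=> cov hcov.
have [/hasP[p pc pj]|/hasPn big] := boolP (has (fun p => (p.1 < j0)%N) cov).
  rewrite ge_min; apply/orP; left; rewrite (big_rem p)//=.
  apply: (@le_trans _ _ (q ^+ p.1)); first by rewrite ler_wiXn2l ?(ltW q0)// ltnW.
  by rewrite lerDl sumr_ge0// => i _; rewrite exprn_ge0// ltW.
rewrite ge_min; apply/orP; right; rewrite ler_pdivrMr// -lee_fin.
apply: le_trans heta _.
pose G := [seq [set x : 'rV[R]_d | unit_cube x /\ cell p.1 x = p.2] | p <- cov].
pose p0 : nat * {ffun 'I_d -> nat} := (0%N, [ffun=> 0%N]).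
pose r k := D * 2^-1 ^+ (nth p0 cov k).1.
have sG : size G = size cov by rewrite size_map.
have jk k : (k < size cov)%N -> (j0 <= (nth p0 cov k).1)%N.
  by move=> hk; rewrite leqNgt; apply: big; exact: mem_nth.
apply: le_trans (hausdorff_premeasure_le (G := G) (r := r) s0 (ltW d0) _ _ _) _.
- move=> x Ex; have [p pc pe] := hcov x Ex; exists (index p cov).
    by rewrite sG index_mem.
  by rewrite (nth_map p0) ?index_mem// nth_index//; split => //; exact: EU.
- move=> k; rewrite sG => hk; rewrite mulr_ge0 ?exprn_ge0 ?(ltW D0)//=.
  exact: hj0 (jk _ hk).
- move=> k; rewrite sG => hk; rewrite (nth_map p0)//; apply: ediam_le.
    by rewrite mulr_ge0 ?exprn_ge0 ?(ltW D0).
  move=> x y [ux ex] [uy ey]; apply: le_trans (eucl_norm_le (c := 2 * 2^-1 ^+ (nth p0 cov k).1) _ _) _.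
  + by rewrite mulr_ge0// exprn_ge0.
  + by move=> l; rewrite !mxE; apply: cell_close => //; rewrite ex ey.
  + by rewrite mulrA /r ler_wpM2r ?exprn_ge0// /D lerDl.
rewrite lee_fin sG (big_nth p0) mulr_suml le_eqVlt; apply/orP; left; apply/eqP.
apply: eq_bigr => k _; rewrite /r powRM ?exprn_ge0 ?(ltW D0)// mulrC; congr (_ * _).
rewrite -[2^-1 ^+ _]powR_mulrn// powRAC powR_mulrn ?powR_ge0//; congr (_ ^+ _).
by rewrite -powR_inv1// -powRrM mulN1r.
Qed.

End HausdorffContent.

(** * The norm of a convex body *)

Section BodyNorm.
Context {R : realType} {d : nat}.
Variable K : set 'rV[R]_d.
Hypothesis bodyK : symmetric_convex_body K.
Implicit Types (x y p : 'rV[R]_d).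

Lemma ball_rowE x (e : R) : ball x e = [set y | `|x - y| < e].
Proof. by rewrite -ball_normE. Qed.

Lemma body_convex x y (t : R) : K x -> K y -> 0 <= t <= 1 ->
  K (t *: x + (1 - t) *: y).
Proof.
have [_ cK _ _] := bodyK => Kx Ky /andP[t0 t1].
have := cK x y (Itv01 t0 t1) (mem_set Kx) (mem_set Ky).
by move/set_mem.
Qed.

(** By symmetry [x] is the midpoint of the two points [z + x] and [- z + x] of [K], where [z] is an
    interior point. *)
Lemma body_inner : exists2 r : R, 0 < r & forall x, `|x| < r -> K x.
Proof.
have [_ _ sK [z]] := bodyK; rewrite /interior/= => /nbhs_ballP[e /= e0 he].
exists e => // x xe.
have h1 : K (z + x) by apply: he; rewrite ball_rowE/= opprD addNKr normrN.
have h2 : K (- z + x).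
  rewrite -[x]opprK -opprD; apply: sK; apply: he.
  by rewrite ball_rowE/= opprD addNKr opprK.
have := body_convex h1 h2 (t := 2^-1); rewrite invr_ge0 invf_le1// => /(_ _).
have -> : 1 - 2^-1 = 2^-1 :> R by field.
rewrite -scalerDr addrACA subrr add0r.
have -> : x + x = 2 *: x by rewrite scaler_nat mulr2n.
rewrite scalerA mulVf// scale1r.
by apply; rewrite ler0n ler1n.
Qed.

Lemma body_outer : exists2 B : R, 0 < B & forall x, K x -> `|x| <= B.
Proof.
have [[M [Mr hM]] _ _ _] := bodyK.
exists (`|M| + 1); first by rewrite ltr_wpDl.
by move=> x Kx; apply: hM => //; rewrite (le_lt_trans (ler_norm _))// ltrDl.
Qed.

Lemma body0 : K 0.
Proof. by have [r r0 h] := body_inner; apply: h; rewrite normr0. Qed.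

Lemma body_scale x (s : R) : K x -> 0 <= s <= 1 -> K (s *: x).
Proof.
by move=> Kx hs; have := body_convex Kx body0 hs; rewrite scaler0 addr0.
Qed.

Lemma closure_body_scale x (s : R) : closure K x -> 0 <= s < 1 -> K (s *: x).
Proof.
have [r r0 hr] := body_inner => clx /andP[s0 s1].
have [s00|sn0] := eqVneq s 0; first by rewrite s00 scale0r; exact: body0.
have sp : 0 < s by rewrite lt_neqAle eq_sym sn0.
have e0 : 0 < r * (1 - s) / s by rewrite divr_gt0 ?mulr_gt0// subr_gt0.
have [y [Ky]] := clx _ (nbhsx_ballx x _ e0).
rewrite ball_rowE/= => hy.
have K2 : K ((s / (1 - s)) *: (x - y)).
  apply: hr; rewrite normrZ ger0_norm ?divr_ge0 ?subr_ge0 ?(ltW s1)//.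
  by rewrite mulrC -ltr_pdivlMr ?invf_div ?divr_gt0 ?subr_gt0// mulrA.
have := body_convex Ky K2 (t := s); rewrite s0 (ltW s1) => /(_ isT).
rewrite scalerA mulrC divfK ?gt_eqF ?subr_gt0// scalerBr addrC addrNK//.
Qed.

Definition gauge_set x : set R := [set t : R | 0 < t /\ K (t^-1 *: x)].

Lemma gauge_set_has_inf x : has_inf (gauge_set x).
Proof.
have [r r0 hr] := body_inner.
split; last by exists 0 => t [/ltW].
exists ((`|x| + 1) / r); have t0 : 0 < (`|x| + 1) / r.
  by rewrite divr_gt0// ltr_wpDl.
split => //; apply: hr.
rewrite normrZ normfV (gtr0_norm t0) invf_div mulrAC.
by rewrite ltr_pdivrMr ?ltr_wpDl// ltr_pM2l// ltrDl.
Qed.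

Lemma body_norm_le x (t : R) : 0 < t -> K (t^-1 *: x) -> body_norm K x <= t.
Proof.
by move=> t0 Kt; apply: ge_inf => //; have [] := gauge_set_has_inf x.
Qed.

Lemma body_norm_lt x (t : R) : body_norm K x < t -> 0 < t /\ K (t^-1 *: x).
Proof.
move=> /(inf_lt (proj1 (gauge_set_has_inf x)))[s [s0 Ks] st].
have t0 := lt_trans s0 st; split => //.
have -> : t^-1 *: x = (s / t) *: (s^-1 *: x).
  by rewrite scalerA mulrAC divff ?mul1r ?gt_eqF.
apply: body_scale => //; rewrite divr_ge0 ?(ltW s0) ?(ltW t0)//=.
by rewrite ler_pdivrMr// mul1r ltW.
Qed.

Lemma body_norm_ge0 x : 0 <= body_norm K x.
Proof.
by apply: lb_le_inf; [have [] := gauge_set_has_inf x|move=> t [/ltW]].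
Qed.

Lemma body_norm_le_norm : exists2 r : R, 0 < r &
  forall x, body_norm K x <= `|x| / r.
Proof.
have [r r0 hr] := body_inner; exists r => // x.
apply/ler_addgt0Pr => e e0.
have t0 : 0 < `|x| / r + e by rewrite ltr_wpDl// divr_ge0// ltW.
apply: body_norm_le => //; apply: hr.
rewrite normrZ normfV (gtr0_norm t0) mulrC ltr_pdivrMr// mulrDr.
by rewrite mulrCA divff ?gt_eqF// mulr1 ltrDl mulr_gt0.
Qed.

Lemma norm_le_body_norm : exists2 B : R, 0 < B &
  forall x, `|x| <= B * body_norm K x.
Proof.
have [B B0 hB] := body_outer; exists B => // x.
rewrite -ler_pdivrMl//; apply/ler_addgt0Pr => e e0.
have [t0 /hB] := @body_norm_lt x (body_norm K x + e) ltac:(by rewrite ltrDl).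
rewrite normrZ normfV (gtr0_norm t0) ler_pdivrMl// => h.
by move: h; rewrite ler_pdivrMl// [leRHS]mulrC.
Qed.

Lemma body_norm_triangle x y : body_norm K (x + y) <= body_norm K x + body_norm K y.
Proof.
apply/ler_addgt0Pr => e e0.
have e2 : 0 < e / 2 by rewrite divr_gt0.
have [s0 Ks] := @body_norm_lt x (body_norm K x + e / 2) ltac:(by rewrite ltrDl).
have [t0 Kt] := @body_norm_lt y (body_norm K y + e / 2) ltac:(by rewrite ltrDl).
have -> : body_norm K x + body_norm K y + e =
  (body_norm K x + e / 2) + (body_norm K y + e / 2) by field.
set s := body_norm K x + _ in s0 Ks *; set t := body_norm K y + _ in t0 Kt *.
have st : 0 < s + t by exact: addr_gt0.
apply: body_norm_le => //.
have := body_convex Ks Kt (t := s / (s + t)).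
rewrite !scalerA.
have -> : s / (s + t) / s = (s + t)^-1 by field; rewrite !gt_eqF.
have -> : (1 - s / (s + t)) / t = (s + t)^-1 by field; rewrite !gt_eqF.
rewrite -scalerDr; apply; rewrite divr_ge0 ?(ltW s0) ?(ltW st)//=.
by rewrite ler_pdivrMr// mul1r lerDl ltW.
Qed.

Lemma body_normN x : body_norm K (- x) = body_norm K x.
Proof.
have [_ _ sK _] := bodyK.
rewrite /body_norm; congr inf; apply/seteqP; split => t [t0] /sK.
  by rewrite -scalerN opprK.
by rewrite -scalerN.
Qed.

Lemma body_norm_lipschitz : exists2 r : R, 0 < r &
  forall x y, `|body_norm K x - body_norm K y| <= `|x - y| / r.
Proof.
have [r r0 hr] := body_norm_le_norm; exists r => // x y.
have h1 := body_norm_triangle (x - y) y; rewrite subrK in h1.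
have h2 := body_norm_triangle (y - x) x; rewrite subrK in h2.
have h3 := hr (x - y); have := hr (y - x); rewrite distrC => h4.
by rewrite ler_norml; apply/andP; split; lra.
Qed.

Lemma body_normZ x (c : R) : 0 < c -> body_norm K (c *: x) = c * body_norm K x.
Proof.
move=> c0; apply/eqP; rewrite eq_le; apply/andP; split.
  rewrite -ler_pdivrMl//; apply/ler_addgt0Pr => e e0.
  have [t0 Kt] := @body_norm_lt x (body_norm K x + e) ltac:(by rewrite ltrDl).
  rewrite ler_pdivrMl//; apply: body_norm_le; first exact: mulr_gt0.
  by rewrite scalerA invfM mulrAC mulVf ?mul1r// gt_eqF.
apply/ler_addgt0Pr => e e0.
have [t0 Kt] := @body_norm_lt (c *: x) (body_norm K (c *: x) + e) ltac:(by rewrite ltrDl).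
rewrite -ler_pdivlMl//; apply: body_norm_le; first by rewrite mulr_gt0// invr_gt0.
by rewrite invfM invrK mulrC -scalerA.
Qed.

(** [K] may contain some of its boundary points and miss others, so the unit sphere of the norm is
    matched with [boundary K] and not with a part of [K]. The converse inclusion is [boundaryE]. *)
Lemma boundary_norm1 p : body_norm K p = 1 -> boundary K p.
Proof.
move=> p1; split.
  move=> U /nbhs_ballP[e /= e0 he].
  have P0 : 0 < `|p| + 1 by rewrite ltr_wpDl.
  pose t := Num.min 2^-1 (e / 2 / (`|p| + 1)).
  have t0 : 0 < t by rewrite lt_min invr_gt0 ltr0n/= !divr_gt0.
  have th : t <= 2^-1 by rewrite ge_min lexx.
  have te : t <= e / 2 / (`|p| + 1) by rewrite ge_min lexx orbT.
  exists ((1 - t) *: p); split.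
    have t1 : 0 < 1 - t by lra.
    have : body_norm K ((1 - t) *: p) < 1 by rewrite body_normZ// p1; lra.
    by move=> /body_norm_lt[_]; rewrite invr1 scale1r.
  apply: he; rewrite ball_rowE/= scalerBl scale1r subKr normrZ gtr0_norm//.
  move: te; rewrite ler_pdivlMr// => te.
  have := normr_ge0 p => p0.
  nra.
rewrite /interior/= => /nbhs_ballP[e /= e0 he].
have P0 : 0 < `|p| + 1 by rewrite ltr_wpDl.
pose t := e / 2 / (`|p| + 1).
have t0 : 0 < t by rewrite !divr_gt0.
have : K ((1 + t) *: p).
  apply: he; rewrite ball_rowE/= scalerDl scale1r opprD addNKr normrN normrZ gtr0_norm//.
  have te : t * (`|p| + 1) = e / 2 by rewrite /t divfK// gt_eqF.
  have := normr_ge0 p => p0.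
  nra.
rewrite -[1 + t]invrK => /(body_norm_le _); rewrite p1 invr_gt0.
have t1 : 0 < 1 + t by rewrite ltr_wpDr// ltW.
by move=> /(_ t1); rewrite leNgt invf_lt1//; lra.
Qed.

Lemma boundary_compact : compact (boundary K).
Proof.
apply: bounded_closed_compact.
  have [B B0 hB] := body_outer.
  exists (2 * B); split; first exact: num_real.
  move=> M hM p [clp _].
  have := hB _ (closure_body_scale clp (s := 2^-1) ltac:(lra)).
  by rewrite normrZ ger0_norm// => h /=; lra.
apply: closedI; first exact: closed_closure.
by apply: open_closedC; exact: open_interior.
Qed.

End BodyNorm.

(** * Covers of the distance set *)

Section CoverBound.
Context {R : realType} {d : nat}.
Implicit Types (x y p : 'rV[R]_d) (mu : seq (R * 'rV[R]_d)).

Lemma pow2_between (X : R) : 1 <= X -> exists j : nat, 2 ^+ j <= X < 2 ^+ j.+1.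
Proof.
move=> X1; have X0 : 0 <= X by apply: le_trans X1.
have /truncn_itv/andP[n1 n2] := X0.
have n0 : (0 < Num.truncn X)%N by rewrite truncn_gt0.
exists (trunc_log 2 (Num.truncn X)).
have /andP[h1 h2] := trunc_log_bounds (isT : (1 < 2)%N) n0.
rewrite -!natrX; apply/andP; split.
  by apply: le_trans n1; rewrite ler_nat.
by apply: lt_le_trans n2 _; rewrite ler_nat.
Qed.

(** The radius is at most the side [2 / 2 ^ i] of a cell, so the ball only meets the cell of [x] and
    its neighbours, [3 ^ d] cells in all. *)
Lemma near_mass q J mu i x (rho : R) : regular q J mu -> (i <= J)%N -> 0 <= q ->
  unit_cube x -> 2 ^+ i * rho <= 2 ->
  \sum_(b <- mu | `|x - b.2| < rho) b.1 <= 3 ^+ d * q ^+ i.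
Proof.
move=> [mu0 mu1 muq] iJ q0 ux hrho.
(* [c l] in [{0, 1, 2}] encodes the offset [c l - 1]. At index [0] the truncated subtraction repeats
   a cell, which only enlarges the sum. *)
pose k (c : {ffun 'I_d -> 'I_3}) : {ffun 'I_d -> nat} :=
  [ffun l => (cell i x l + c l - 1)%N].
apply: (@le_trans _ _ (\sum_(c : {ffun 'I_d -> 'I_3}) cell_mass mu i (k c))); last first.
  apply: (@le_trans _ _ (\sum_(c : {ffun 'I_d -> 'I_3}) q ^+ i)).
    by apply: ler_sum => c _; exact: muq.
  by rewrite sumr_const card_ffun !card_ord -[leLHS]mulr_natl natrX.
have -> : \sum_(c : {ffun 'I_d -> 'I_3}) cell_mass mu i (k c) =
   \sum_(b <- mu) \sum_(c : {ffun 'I_d -> 'I_3} | cell i b.2 == k c) b.1.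
  rewrite /cell_mass; under eq_bigr do rewrite big_mkcond/=.
  by rewrite exchange_big/=; apply: eq_bigr => b _; rewrite [RHS]big_mkcond.
rewrite big_mkcond/= big_seq [leRHS]big_seq; apply: ler_sum => b bmu.
case: ifP => [xb|_]; last by rewrite sumr_ge0// => c _; exact: mu0.
have ub := mu1 b bmu.
pose c : {ffun 'I_d -> 'I_3} := [ffun l => inord (cell i b.2 l + 1 - cell i x l)].
have P0 : 0 < 2 ^+ i :> R by rewrite exprn_gt0.
have hc l : (cell i b.2 l <= cell i x l + 1)%N /\ (cell i x l <= cell i b.2 l + 1)%N.
  rewrite !ffunE.
  have /andP[x0 _] := ux l; have /andP[b0 _] := ub l.
  have hx : 0 <= 2 ^+ i * x 0 l / 2 by rewrite divr_ge0// mulr_ge0// ltW.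
  have hb : 0 <= 2 ^+ i * b.2 0 l / 2 by rewrite divr_ge0// mulr_ge0// ltW.
  have := truncn_dist hx hb.
  set m := Num.truncn _; set n := Num.truncn _.
  have -> : 2 ^+ i * x 0 l / 2 - 2 ^+ i * b.2 0 l / 2 = 2 ^+ i / 2 * (x 0 l - b.2 0 l).
    by field.
  have := le_lt_trans (coord_le_norm _ l) xb; rewrite !mxE => h5.
  rewrite normrM ger0_norm ?divr_ge0 ?(ltW P0)// => h6.
  have {h5}h7 : 2 ^+ i * `|x 0 l - b.2 0 l| < 2 by apply: lt_le_trans hrho; rewrite ltr_pM2l.
  have : `|m%:R - n%:R| < 2 :> R by lra.
  rewrite ltr_norml => /andP[h8 h9].
  by split; rewrite -ltnS -(ltr_nat R) -addn1 !natrD; lra.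
have kc : k c = cell i b.2.
  apply/ffunP => l; have cl : c l = inord (cell i b.2 l + 1 - cell i x l) by rewrite ffunE.
  have [h1 h2] := hc l.
  rewrite [LHS]ffunE cl; move: h1 h2; move: (cell i b.2 l) (cell i x l) => u v h1 h2.
  by rewrite inordK; lia.
rewrite (bigD1 c) ?kc//= lerDl sumr_ge0// => c' _; exact: mu0.
Qed.

Lemma mass_le1 q J mu : regular q J mu -> mass mu <= 1.
Proof.
move=> rmu; have [_ mu1 muq] := rmu.
have := muq 0%N [ffun=> 0%N] (leq0n _); rewrite expr0; apply: le_trans.
rewrite /mass /cell_mass big_seq_cond [leRHS]big_seq_cond le_eqVlt.
apply/orP; left; apply/eqP/eq_bigl => a; case: (boolP (a \in mu)) => //= amu.
apply/esym/eqP/ffunP => l; rewrite [RHS]ffunE.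
by have := cell_lt 0 l (mu1 _ amu); rewrite expn0 ltnS leqn0 => /eqP.
Qed.

Lemma mass_pair_sum mu : \sum_(a <- mu) \sum_(b <- mu) a.1 * b.1 = mass mu ^+ 2.
Proof. by rewrite expr2 /mass big_distrlr. Qed.

(** Radial projection turns the condition on the norm into closeness to a dilate of the boundary:
    [x - t *: (x / N x)] equals [(N x - t) *: (x / N x)], of sup norm at most [e * B]. The level [j]
    is chosen with [2 ^ j] comparable to [1 / e], and [C2] guarantees [j <= J]. Large [e] are
    trivial, since [mass mu <= 1]. *)
Lemma annulus_count (K : set 'rV[R]_d) gamma sigma (q beta t0 : R) :
  symmetric_convex_body K -> decay_functional gamma (boundary K) sigma ->
  (0 < d)%N -> 0 <= gamma -> 0 < q -> 0 <= beta <= 1 -> 0 < t0 ->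
  (2 `^ gamma)^-1 * q * 2 ^+ d < 2 `^ (1 - beta) ->
  exists2 C, 0 < C & exists2 C2, 0 < C2 & forall J mu (t e : R), regular q J mu ->
    0 < e -> C2 <= e * 2 ^+ J ->
    \sum_(a <- mu) \sum_(b <- mu | (t0 <= body_norm K (a.2 - b.2)) &&
        (`|body_norm K (a.2 - b.2) - t| < e)) a.1 * b.1 <=
    C * e `^ beta * mass mu.
Proof.
move=> bodyK sP d0 g0 q0 /andP[beta0 beta1] t00 hr.
have [r r0 hr1] := body_norm_le_norm bodyK.
have [B B0 hB] := norm_le_body_norm bodyK.
pose t2 := r^-1 + 1.
have t21 : 1 <= t2 by rewrite lerDr invr_ge0 ltW.
have th0 : 0 < t0 / 2 by rewrite divr_gt0.
have [C C0 HC] := pair_count sP d0 g0 q0 th0 t21 beta1 hr.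
have dR : 0 < d%:R :> R by rewrite ltr0n.
have [D D0 DE] : exists2 D, 0 < D & D = 2 * d%:R * B.
  by exists (2 * d%:R * B) => //; rewrite !mulr_gt0.
pose e0 := Num.min (Num.min (t0 / 2) D^-1) 1.
have e00 : 0 < e0 by rewrite !lt_min th0 invr_gt0 D0/=.
have Db0 : 0 < (2 * D) `^ beta by rewrite powR_gt0// mulr_gt0.
have eb0 : 0 < e0 `^ beta by rewrite powR_gt0.
exists (C * (2 * D) `^ beta + (e0 `^ beta)^-1).
  by rewrite addr_gt0 ?mulr_gt0 ?invr_gt0.
exists D^-1; first by rewrite invr_gt0.
move=> J mu t e rmu ep eJ.
have Tot0 := mass_ge0 rmu; have Tot1 := mass_le1 rmu.
have [mu0 mu1 _] := rmu.
have ebp : 0 < e `^ beta by rewrite powR_gt0.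
have rhs0 : 0 <= (C * (2 * D) `^ beta + (e0 `^ beta)^-1) * e `^ beta * mass mu.
  by rewrite !mulr_ge0// ?addr_ge0 ?mulr_ge0 ?invr_ge0// ltW.
have [ebig|esmall] := leP e0 e.
  apply: (@le_trans _ _ (mass mu ^+ 2)).
    rewrite -mass_pair_sum big_seq [leRHS]big_seq; apply: ler_sum => a amu.
    rewrite big_seq_cond [leRHS]big_seq big_mkcond [leRHS]big_mkcond/=.
    apply: ler_sum => b _; case: (boolP (b \in mu)) => //= bmu.
    by case: ifP => // _; rewrite mulr_ge0 ?mu0.
  rewrite expr2 ler_wpM2r//; apply: le_trans Tot1 _.
  apply: (@le_trans _ _ ((e0 `^ beta)^-1 * e `^ beta)).
    rewrite mulrC ler_pdivlMr// mul1r ge0_ler_powR// nnegrE; exact: ltW.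
  by rewrite ler_wpM2r ?(ltW ebp)// lerDr mulr_ge0 ?(ltW C0)// ltW.
have [et eD e1] : [/\ e < t0 / 2, e < D^-1 & e < 1].
  by move: esmall; rewrite !lt_min => /andP[/andP[]].
have diffle a b : a \in mu -> b \in mu -> `|a.2 - b.2| <= 1.
  move=> /mu1 ua /mu1 ub; apply: row_norm_le => // l; rewrite !mxE ler_norml.
  by have /andP[? ?] := ua l; have /andP[? ?] := ub l; apply/andP; split; lra.
(* Values of [t] outside this range catch no pair: the norms in question lie between [t0] and
   [r^-1], and [e] is smaller than [t0 / 2] and than [1]. *)
have [tin|tout] := boolP (t0 / 2 <= t <= t2); last first.
  rewrite big_seq big1// => a amu; rewrite big_seq_cond big1// => b.
  move=> /andP[bmu /andP[h1 h2]]; exfalso; move/negP: tout; apply.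
  have h3 : body_norm K (a.2 - b.2) <= r^-1.
    apply: le_trans (hr1 _) _; rewrite -[leRHS]mul1r ler_wpM2r ?invr_ge0 ?(ltW r0)//.
    exact: diffle.
  by move: h2; rewrite ltr_norml /t2 => /andP[? ?]; apply/andP; split; lra.
have [j /andP[j1 j2]] : exists j : nat, 2 ^+ j <= (D * e)^-1 < 2 ^+ j.+1.
  apply: pow2_between; rewrite invf_ge1 ?mulr_gt0//.
  by rewrite mulrC -ler_pdivlMr// mul1r ltW.
have jJ : (j <= J)%N.
  rewrite -(leq_exp2l (m := 2))// -(ler_nat R) !natrX.
  apply: le_trans j1 _; rewrite invfM ler_pdivrMr// mulrC; exact: eJ.
have := HC J j mu t rmu jJ tin.
move=> H; apply: (@le_trans _ _ (C * (2 `^ (- beta)) ^+ j * mass mu)).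
  apply: le_trans H; rewrite big_seq [leRHS]big_seq; apply: ler_sum => a amu.
  rewrite big_seq_cond [leRHS]big_seq_cond big_mkcond [leRHS]big_mkcond/=.
  apply: ler_sum => b _; case: (boolP (b \in mu)) => //= bmu.
  have ab0 : 0 <= a.1 * b.1 by rewrite mulr_ge0 ?mu0.
  case: ifP => [/andP[h1 h2]|_]; last by case: ifP.
  case: asboolP => // -[]; set x := a.2 - b.2 in h1 h2 *.
  have N0 : 0 < body_norm K x by apply: lt_le_trans h1.
  exists ((body_norm K x)^-1 *: x).
    apply: boundary_norm1 => //; rewrite body_normZ ?invr_gt0// mulVf// gt_eqF//.
  have -> : x - t *: ((body_norm K x)^-1 *: x) =
    ((body_norm K x - t) / body_norm K x) *: x.
    rewrite scalerA mulrBl divff ?gt_eqF// scalerBl scale1r//.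
  rewrite normrZ normrM normfV (gtr0_norm N0).
  apply: (@le_trans _ _ (e * B)).
    rewrite -mulrA; apply: ler_pM => //; last by rewrite ler_pdivrMl// mulrC hB.
      by rewrite mulr_ge0// invr_ge0 ltW.
    exact: ltW.
  rewrite -[leRHS]mul1r ler_pdivlMr ?mulr_gt0 ?exprn_gt0//.
  have -> : e * B * (2 * d%:R * 2 ^+ j) = 2 ^+ j * (D * e) by rewrite DE; ring.
  by rewrite -ler_pdivlMr ?mulr_gt0// mul1r.
rewrite ler_wpM2r// -[leRHS]addr0 mulrDl -addrA.
rewrite ler_wpDr ?addr0 ?mulr_ge0 ?invr_ge0 ?(ltW eb0) ?(ltW ebp)//.
rewrite -mulrA ler_pM2l//.
rewrite powRN exprVn -powR_mulrn ?powR_ge0// powRAC powR_mulrn//.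
rewrite -powRM ?(ltW ep) ?mulr_ge0 ?(ltW D0)//.
have P0 : 0 < 2 ^+ j :> R by rewrite exprn_gt0.
rewrite -powRN -[2 ^+ j]invrK -powR_inv1 ?invr_ge0 ?(ltW P0)// -powRrM mulN1r opprK.
rewrite ge0_ler_powR// ?nnegrE ?invr_ge0 ?(ltW P0) ?mulr_ge0 ?(ltW ep) ?(ltW D0)//.
rewrite -[leRHS]invrK lef_pV2 ?posrE ?invr_gt0 ?mulr_gt0//.
move: j2; rewrite exprS -mulrA invfM => j2; lra.
Qed.

(** At least half of the pair mass lies at distance at least [t0], and each of these pairs falls
    into the annulus of some interval of the cover. Hence [mass mu ^ 2 / 2] is at most [C * mass mu]
    times the sum in the conclusion; one factor [mass mu] cancels and the other is at least
    [eta]. *)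
Lemma distance_cover_bound (K E : set 'rV[R]_d) gamma sigma (s beta : R) :
  symmetric_convex_body K -> decay_functional gamma (boundary K) sigma ->
  (0 < d)%N -> 0 <= gamma -> 0 <= beta <= 1 -> 0 < s -> beta + d%:R - 1 - gamma < s ->
  E `<=` unit_cube -> hausdorff_measure eucl_dist s E != 0%E ->
  exists2 c, 0 < c & forall cov : seq (R * R), (forall p : R * R, p \in cov -> 0 < p.2) ->
    (forall z, distance_set K E z -> exists2 p : R * R, p \in cov & `|z - p.1| < p.2) ->
    c <= \sum_(p <- cov) p.2 `^ beta.
Proof.
move=> bodyK sP d0 g0 b01 s0 hs EU mE.
have [eta eta0 heta] := content_pos (ltW s0) EU mE.
pose q : R := 2 `^ (- s).
have q0 : 0 < q by rewrite powR_gt0.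
have q1 : q < 1.
  rewrite /q /powR pnatr_eq0/= -[ltRHS]expR0 ltr_expR mulNr oppr_lt0 mulr_gt0//.
  by rewrite ln_gt0 ?ltr1n.
have [B B0 hB] := norm_le_body_norm bodyK.
have three0 : 0 < 3 ^+ d :> R by rewrite exprn_gt0.
(* This level makes the mass near any point at most [eta / 2], hence at most half of the total
   mass. *)
have [i1 hi1] : exists i, 3 ^+ d * q ^+ i <= eta / 2.
  have cv : q ^+ n @[n --> \oo] --> (0 : R) by apply: cvg_expr; rewrite gtr0_norm.
  have e0 : 0 < eta / 2 / 3 ^+ d by rewrite !divr_gt0.
  have /cvgr0_norm_le/(_ _ e0)[N _ hN] := cv.
  exists N; have := hN N (leqnn _); rewrite /= gtr0_norm ?exprn_gt0//.
  by rewrite ler_pdivlMr// mulrC.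
pose t0 := 2 / 2 ^+ i1 / B.
have t00 : 0 < t0 by rewrite !divr_gt0// exprn_gt0.
have hr : (2 `^ gamma)^-1 * q * 2 ^+ d < 2 `^ (1 - beta).
  rewrite /q -powRN -powR_mulrn// -!powRD ?pnatr_eq0 ?implybT//.
  rewrite /powR pnatr_eq0/= ltr_expR ltr_pM2r ?ln_gt0 ?ltr1n//; lra.
have [C C0 [C2 C20 HC]] := annulus_count bodyK sP d0 g0 q0 b01 t00 hr.
exists (eta / 2 / C); first by rewrite !divr_gt0.
move=> cov cov0 hcov.
have [J1 hJ1] : exists J1, forall p : R * R, p \in cov -> forall J, (J1 <= J)%N -> C2 <= p.2 * 2 ^+ J.
  have [m hm] := nat_above (\sum_(p <- cov) C2 / p.2).
  exists m => p pc J mJ; rewrite mulrC -ler_pdivrMr ?cov0//.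
  apply: (@le_trans _ _ (\sum_(p <- cov) C2 / p.2)).
    rewrite (big_rem p)//= lerDl big_seq sumr_ge0// => p' /mem_rem/cov0 p'0.
    by rewrite divr_ge0// ltW.
  apply: le_trans (ltW hm) _; rewrite -natrX ler_nat.
  by apply: leq_trans mJ _; apply: ltnW; exact: ltn_expl.
(* The level is fixed only now: fine enough to bound the near pairs and to resolve every interval of
   the finite cover. *)
pose J := maxn i1 J1.
have [mu [cells [rmu muE hcells cost]]] := frostman J (ltW q0) EU.
have Tot0 := mass_ge0 rmu; have [mu0 mu1 _] := rmu.
have etaTot : eta <= mass mu by apply: le_trans cost; exact: heta.
have TotP : 0 < mass mu by apply: lt_le_trans etaTot.
pose N (a b : R * 'rV[R]_d) := body_norm K (a.2 - b.2).
have near : \sum_(a <- mu) \sum_(b <- mu | N a b < t0) a.1 * b.1 <= mass mu ^+ 2 / 2.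
  apply: (@le_trans _ _ (mass mu * (eta / 2))); last first.
    by rewrite expr2 -mulrA ler_pM2l// ler_pM2r// ?invr_gt0.
  rewrite /mass mulr_suml big_seq [leRHS]big_seq; apply: ler_sum => a amu.
  rewrite -mulr_sumr ler_wpM2l ?mu0//; apply: le_trans hi1.
  have iJ : (i1 <= J)%N by exact: leq_maxl.
  have := near_mass (rho := B * t0) rmu iJ (ltW q0) (mu1 a amu).
  have -> : 2 ^+ i1 * (B * t0) = 2 by rewrite /t0; field; rewrite gt_eqF// expf_neq0.
  move=> /(_ (lexx _)); apply: le_trans.
  rewrite big_seq_cond [leRHS]big_seq_cond big_mkcond [leRHS]big_mkcond/=.
  apply: ler_sum => b _; case: (boolP (b \in mu)) => //= bmu.
  have b0 := mu0 b bmu.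
  case: ifP => [h|_]; last by case: ifP.
  by rewrite (le_lt_trans (hB _))// ltr_pM2l.
have far : mass mu ^+ 2 / 2 <= \sum_(a <- mu) \sum_(b <- mu | t0 <= N a b) a.1 * b.1.
  have : mass mu ^+ 2 = \sum_(a <- mu) \sum_(b <- mu | N a b < t0) a.1 * b.1 +
     \sum_(a <- mu) \sum_(b <- mu | t0 <= N a b) a.1 * b.1.
    rewrite -mass_pair_sum -big_split; apply: eq_bigr => a _ /=.
    rewrite (bigID (fun b => N a b < t0))/=; congr (_ + _).
    by apply: eq_bigl => b; rewrite leNgt.
  lra.
have : mass mu ^+ 2 / 2 <= \sum_(p <- cov) C * p.2 `^ beta * mass mu.
  apply: le_trans far _.
  apply: (@le_trans _ _ (\sum_(p <- cov) \sum_(a <- mu) \sum_(b <- mu |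
     (t0 <= N a b) && (`|N a b - p.1| < p.2)) a.1 * b.1)); last first.
    rewrite big_seq [leRHS]big_seq; apply: ler_sum => p pc.
    exact: (HC J mu p.1 p.2 rmu (cov0 p pc) (hJ1 p pc J (leq_maxr _ _))).
  rewrite [leRHS]exchange_big/= big_seq [leRHS]big_seq; apply: ler_sum => a amu.
  under [leRHS]eq_bigr do rewrite big_mkcond/=.
  rewrite [leRHS]exchange_big/= big_seq_cond [leRHS]big_seq big_mkcond [leRHS]big_mkcond/=.
  apply: ler_sum => b _; case: (boolP (b \in mu)) => //= bmu.
  have ab0 : 0 <= a.1 * b.1 by rewrite mulr_ge0 ?mu0.
  case: ifP => h /=; last by rewrite sumr_ge0// => p _; case: ifP.
  have [|p pc hp] := hcov (N a b); first by exists a.2; [exact: muE|exists b.2 => //; exact: muE].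
  rewrite (big_rem p)//= hp lerDl sumr_ge0// => p' _; by case: ifP.
rewrite -mulr_suml expr2 mulrAC ler_pM2r// -mulr_sumr => H.
by rewrite ler_pdivrMr// [leRHS]mulrC; apply: le_trans _ H; rewrite ler_pM2r// invr_gt0.
Qed.

End CoverBound.

(** * Uniformly smooth families *)

Section LineDerivative.
Context {R : realType} {n : nat}.
Implicit Types (F G : 'rV[R]_n -> R) (u e : 'rV[R]_n).

Definition line_derive F u e (l : R) : Prop :=
  is_derive (0 : R) (1 : R) (fun s : R => F (u + s *: e)) l.

Lemma line_derive_eq F u e l l' : line_derive F u e l -> l = l' -> line_derive F u e l'.
Proof. by move=> h <-. Qed.

Lemma line_derive_at F u e (s0 l : R) : line_derive F (u + s0 *: e) e l ->
  is_derive s0 1 (fun s : R => F (u + s *: e)) l.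
Proof.
move=> h.
have -> : (fun s : R => F (u + s *: e)) =
    (fun s => F (u + s0 *: e + s *: e)) \o (fun s => s - s0).
  by apply/funext => s /=; rewrite -addrA -scalerDl addrCA subrr addr0.
rewrite -[l]mulr1; apply: is_derive1_comp; first by rewrite subrr.
by apply: is_derive_eq; rewrite subr0.
Qed.

Lemma line_derive_cst c u e : line_derive (fun=> c) u e 0.
Proof. exact: is_derive_cst. Qed.

Lemma line_deriveD F G u e a b : line_derive F u e a -> line_derive G u e b ->
  line_derive (fun u => F u + G u) u e (a + b).
Proof. exact: is_deriveD. Qed.

Lemma line_deriveM F G u e a b : line_derive F u e a -> line_derive G u e b ->
  line_derive (fun u => F u * G u) u e (F u * b + G u * a).
Proof.
move=> hF hG; have := is_deriveM hF hG; rewrite /= scale0r addr0.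
exact.
Qed.

Lemma line_deriveV F u e a : F u != 0 -> line_derive F u e a ->
  line_derive (fun u => (F u)^-1) u e (- (F u)^-1 * (F u)^-1 * a).
Proof.
move=> Fu hF; have Fu' : (fun s : R => F (u + s *: e)) 0 != 0 by rewrite scale0r addr0.
apply: is_derive_eq (is_deriveV Fu' hF) _.
by rewrite scale0r addr0 /GRing.scale/= -exprVn expr2 !mulNr.
Qed.

Lemma line_derive_comp (f : R -> R) F u e a b : is_derive (F u) (1 : R) f a ->
  line_derive F u e b -> line_derive (fun u => f (F u)) u e (a * b).
Proof.
move=> hf hF; apply: (@is_derive1_comp _ f (fun s => F (u + s *: e))) => //.
by rewrite scale0r addr0.
Qed.

Lemma line_derive_near F G u e l : (\forall v \near u, F v = G v) ->
  line_derive F u e l -> line_derive G u e l.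
Proof.
move=> FG [d1 d2].
have FGs : \forall s \near (0 : R), F (u + s *: e) = G (u + s *: e).
  have : (fun s : R => u + s *: e) @ (0 : R) --> u + 0 *: e.
    by apply: cvgD; [exact: cvg_cst|apply: cvgZr_tmp; exact: cvg_id].
  by rewrite scale0r addr0 => /(_ _ FG).
split; first exact: near_eq_derivable d1.
by rewrite -d2; apply/esym; apply: near_eq_derive.
Qed.

Lemma line_derive_diff F u e : differentiable F u -> line_derive F u e ('D_e F u).
Proof.
move=> dF; rewrite /line_derive.
have -> : (fun s : R => F (u + s *: e)) = (fun s : R => F (s *: e + u)).
  by apply/funext => s; rewrite addrC.
split; first exact: (derivable1P F u e).1 (diff_derivable dF).
rewrite /derive; set g1 := fun h : R => h^-1 *: _; set g2 := fun h : R => h^-1 *: _.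
suff -> : g1 = g2 by [].
apply/funext => s; rewrite /g1 /g2 /= scale0r add0r addr0.
by congr (_ *: (F (_ *: _ + _) - _)); rewrite /GRing.scale/= mulr1.
Qed.

Lemma line_mvt F (F' : 'rV[R]_n -> R) u e (t : R) : 0 < t ->
  (forall s, 0 <= s <= t -> line_derive F (u + s *: e) e (F' (u + s *: e))) ->
  exists2 s, 0 <= s <= t & F (u + t *: e) - F u = t * F' (u + s *: e).
Proof.
move=> t0 h.
have hd s : 0 <= s <= t -> is_derive s (1 : R) (fun s => F (u + s *: e)) (F' (u + s *: e)).
  by move=> /h; exact: line_derive_at.
have [] := @MVT R (fun s => F (u + s *: e)) (fun s => F' (u + s *: e)) 0 t t0.
- by move=> x; rewrite in_itv/= => /andP[x0 xt]; apply: hd; rewrite !ltW.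
- apply: derivable_within_continuous => x; rewrite in_itv/= => /hd[].
  by [].
move=> c; rewrite in_itv/= => /andP[c0 ct].
rewrite scale0r addr0 subr0 => ->; exists c; first by rewrite !ltW.
by rewrite mulrC.
Qed.

End LineDerivative.

Section UniformlySmooth.
Context {R : realType} {n : nat} {P : Type} (U : set 'rV[R]_n) (k : P -> 'I_n).
Implicit Types (F G : P -> 'rV[R]_n -> R) (u : 'rV[R]_n).

Definition coord_vec (i : 'I_n) : 'rV[R]_n := delta_mx 0 i.

(* The derivatives up to order [m] of [F p] along the coordinate [k p] are
   bounded on [U], uniformly in the parameter [p]. *)
Fixpoint unif_smooth (m : nat) F : Prop :=
  (exists C : R, forall p u, U u -> `|F p u| <= C) /\
  if m is m'.+1 then exists F', unif_smooth m' F' /\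
    forall p u, U u -> line_derive (F p) u (coord_vec (k p)) (F' p u)
  else True.

Lemma unif_smooth_bounded m F : unif_smooth m F ->
  exists C : R, forall p u, U u -> `|F p u| <= C.
Proof. by case: m => [|m] []. Qed.

Lemma unif_smoothS m F : unif_smooth m.+1 F -> unif_smooth m F.
Proof.
elim: m F => [|m IH] F [bF [F' [sF' dF']]]; first by split.
by split => //; exists F'; split => //; exact: IH.
Qed.

Lemma unif_smooth_leq m m' F : (m <= m')%N -> unif_smooth m' F -> unif_smooth m F.
Proof.
move=> /subnK <-; elim: (m' - m)%N => [//|j IH]; rewrite addSn => /unif_smoothS; exact: IH.
Qed.

Lemma unif_smooth_cst m (c : P -> R) (C : R) : (forall p, `|c p| <= C) ->
  unif_smooth m (fun p _ => c p).
Proof.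
elim: m c C => [|m IH] c C hc; split => //; try by exists C.
exists (fun _ _ => 0); split; last by move=> p u _; exact: line_derive_cst.
by apply: (IH (fun=> 0) 0) => p; rewrite normr0.
Qed.

Lemma unif_smoothD m F G : unif_smooth m F -> unif_smooth m G ->
  unif_smooth m (fun p u => F p u + G p u).
Proof.
elim: m F G => [|m IH] F G [[C hC] hF] [[C' hC'] hG]; split => //;
  try by exists (C + C') => p u Uu; apply: le_trans (ler_normD _ _) _; rewrite lerD ?hC ?hC'.
have [F' [sF dF]] := hF; have [G' [sG dG]] := hG.
exists (fun p u => F' p u + G' p u); split; first exact: IH.
by move=> p u Uu; apply: line_deriveD; [exact: dF|exact: dG].
Qed.

Lemma unif_smoothM m F G : unif_smooth m F -> unif_smooth m G ->
  unif_smooth m (fun p u => F p u * G p u).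
Proof.
have bM F' G' C C' : (forall p u, U u -> `|F' p u| <= C) ->
    (forall p u, U u -> `|G' p u| <= C') ->
    exists C0 : R, forall p u, U u -> `|F' p u * G' p u| <= C0.
  move=> hC hC'; exists (C * C') => p u Uu.
  by rewrite normrM ler_pM// ?hC ?hC'.
elim: m F G => [|m IH] F G [[C hC] hF] [[C' hC'] hG]; split => //; try exact: bM hC hC'.
have [F' [sF dF]] := hF; have [G' [sG dG]] := hG.
have sF0 : unif_smooth m F by apply: unif_smoothS; split; [exists C|exists F'].
have sG0 : unif_smooth m G by apply: unif_smoothS; split; [exists C'|exists G'].
exists (fun p u => F p u * G' p u + G p u * F' p u); split.
  by apply: unif_smoothD; apply: IH.
by move=> p u Uu; apply: line_deriveM; [exact: dF|exact: dG].
Qed.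

Lemma unif_smoothV m F (c : R) : 0 < c -> (forall p u, U u -> c <= `|F p u|) ->
  unif_smooth m F -> unif_smooth m (fun p u => (F p u)^-1).
Proof.
move=> c0 hc.
have bV : exists C : R, forall p u, U u -> `|(F p u)^-1| <= C.
  by exists c^-1 => p u Uu; rewrite normfV lef_pV2 ?posrE ?hc// (lt_le_trans c0) ?hc.
elim: m => [|m IH] [[C hC] hF]; split => //.
have [F' [sF dF]] := hF.
have sF0 : unif_smooth m F by apply: unif_smoothS; split; [exists C|exists F'].
exists (fun p u => ((-1) * (F p u)^-1) * (F p u)^-1 * F' p u); split.
  apply: unif_smoothM => //; apply: unif_smoothM; last exact: IH.
  apply: unif_smoothM; last exact: IH.
  by apply: (@unif_smooth_cst _ (fun=> -1) 1) => p; rewrite normrN1.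
move=> p u Uu; rewrite mulN1r; apply: line_deriveV; last exact: dF.
by rewrite -normr_gt0 (lt_le_trans c0) ?hc.
Qed.

Lemma unif_smooth_sum m (I : Type) (s : seq I) (F : I -> P -> 'rV[R]_n -> R) :
  (forall i, unif_smooth m (F i)) -> unif_smooth m (fun p u => \sum_(i <- s) F i p u).
Proof.
move=> hF; elim: s => [|i s IH].
  have := @unif_smooth_cst m (fun=> 0) 0; rewrite normr0 => /(_ (fun _ => lexx _)).
  by congr unif_smooth; apply/funext => p; apply/funext => u; rewrite big_nil.
have := unif_smoothD (hF i) IH.
by congr unif_smooth; apply/funext => p; apply/funext => u; rewrite big_cons.
Qed.

Lemma unif_smooth_prod m (I : Type) (s : seq I) (F : I -> P -> 'rV[R]_n -> R) :
  (forall i, unif_smooth m (F i)) -> unif_smooth m (fun p u => \prod_(i <- s) F i p u).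
Proof.
move=> hF; elim: s => [|i s IH].
  have := @unif_smooth_cst m (fun=> 1) 1; rewrite normr1 => /(_ (fun _ => lexx _)).
  by congr unif_smooth; apply/funext => p; apply/funext => u; rewrite big_nil.
have := unif_smoothM (hF i) IH.
by congr unif_smooth; apply/funext => p; apply/funext => u; rewrite big_cons.
Qed.

Lemma unif_smoothZ m (c : P -> R) (C : R) F : (forall p, `|c p| <= C) ->
  unif_smooth m F -> unif_smooth m (fun p u => c p * F p u).
Proof. by move=> hc; apply: unif_smoothM; exact: unif_smooth_cst hc. Qed.

Lemma unif_smooth_eq m F G : open U -> (forall p u, U u -> F p u = G p u) ->
  unif_smooth m F -> unif_smooth m G.
Proof.
move=> oU FG; case: m => [|m] [[C hC] hF].
  by split => //; exists C => p u Uu; rewrite -FG ?hC.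
split; first by exists C => p u Uu; rewrite -FG ?hC.
have [F' [sF dF]] := hF; exists F'; split => // p u Uu.
apply: line_derive_near (dF p u Uu).
have : nbhs u U by exact: open_nbhs_nbhs.
by apply: filterS => v; exact: FG.
Qed.

End UniformlySmooth.

Section SmoothFunctions.
Context {R : realType} {n : nat}.
Implicit Types (phi : 'rV[R]_n -> R) (u v h : 'rV[R]_n).

Lemma smooth_derive phi v : smooth phi -> smooth (fun x => 'D_v phi x).
Proof. by move=> sphi m; have [_] := sphi m.+1; apply. Qed.

Lemma smooth_differentiable phi u : smooth phi -> differentiable phi u.
Proof. by move=> sphi; have [] := sphi 1%N. Qed.

Lemma smooth_continuous phi : smooth phi -> continuous phi.
Proof. by move=> sphi; exact: sphi 0%N. Qed.

Lemma derive_sum_coord phi u h : differentiable phi u ->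
  'D_h phi u = \sum_j h 0 j * 'D_(coord_vec j) phi u.
Proof.
move=> dphi; rewrite deriveE// {1}[h]row_sum_delta linear_sum.
by apply: eq_bigr => j _; rewrite linearZ/= deriveE.
Qed.

Lemma continuous_bounded_ball phi (B : R) : continuous phi ->
  exists2 C : R, 0 < C & forall u, `|u| <= B -> `|phi u| <= C.
Proof.
move=> cphi.
have cA : compact [set u : 'rV[R]_n | `|u| <= B].
  apply: bounded_closed_compact.
    by exists B; split; [exact: num_real|move=> M BM u /= uB; exact: le_trans (ltW BM)].
  have -> : [set u : 'rV[R]_n | `|u| <= B] = (fun u => `|u|) @^-1` [set x : R | x <= B] by [].
  by apply: closed_comp; [move=> x _; exact: norm_continuous|exact: closed_le].
have : compact (phi @` [set u : 'rV[R]_n | `|u| <= B]).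
  by apply: continuous_compact => //; exact: continuous_subspaceT.
move=> /compact_bounded[M [Mr hM]].
exists (`|M| + 1); first by rewrite ltr_wpDl.
move=> u hu; apply: hM; last by exists u.
by rewrite (le_lt_trans (ler_norm _))// ltrDl.
Qed.

Lemma smooth_mvt phi u h : smooth phi -> exists2 s : R, 0 <= s <= 1 &
  phi (u + h) - phi u = 'D_h phi (u + s *: h).
Proof.
move=> sphi; have [||s s01] := @line_mvt R n phi (fun x => 'D_h phi x) u h 1 => //.
  by move=> s _; apply: line_derive_diff; exact: smooth_differentiable.
by rewrite scale1r mul1r => e; exists s.
Qed.

Lemma smooth_lipschitz phi (B : R) : smooth phi ->
  exists2 C : R, 0 < C & forall u h, `|u| <= B -> `|h| <= B ->
    `|phi (u + h) - phi u| <= C * `|h|.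
Proof.
move=> sphi.
have /choice[C hC] (j : 'I_n) : exists C : R, 0 < C /\
    forall u, `|u| <= B + B -> `|'D_(coord_vec j) phi u| <= C.
  have [C C0 hC] := @continuous_bounded_ball (fun x => 'D_(coord_vec j) phi x) (B + B)
    (smooth_continuous (smooth_derive _ sphi)).
  by exists C.
exists (\sum_j C j + 1).
  by rewrite ltr_wpDl// sumr_ge0// => j _; rewrite ltW//; case: (hC j).
move=> u h uB hB; have [s /andP[s0 s1] ->] := smooth_mvt u h sphi.
have us : `|u + s *: h| <= B + B.
  apply: le_trans (ler_normD _ _) _; rewrite lerD// normrZ ger0_norm//.
  by rewrite (le_trans _ hB)// ler_piMl.
rewrite derive_sum_coord; last exact: smooth_differentiable.
apply: le_trans (ler_norm_sum _ _ _) _.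
rewrite mulrDl mul1r ler_wpDr// mulr_suml; apply: ler_sum => j _.
rewrite normrM mulrC ler_pM ?coord_le_norm//.
by have [_] := hC j; apply.
Qed.

End SmoothFunctions.

Section SmoothFamilies.
Context {R : realType} {n : nat} {P : Type} (U : set 'rV[R]_n) (k : P -> 'I_n).
Variables (B : R) (UB : forall u, U u -> `|u| <= B).
Implicit Types (phi : 'rV[R]_n -> R) (u v : 'rV[R]_n).

(** In the families below, the direction [k p] varies with the parameter. Writing the derivative as
    a sum over all coordinates with coefficients [0] or [1] exhibits it as a bounded combination of
    finitely many fixed smooth functions, which makes the bounds uniform in [p]. *)
Lemma line_derive_pick phi u (i : 'I_n) : differentiable phi u ->
  line_derive phi u (coord_vec i) (\sum_j (j == i)%:R * 'D_(coord_vec j) phi u).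
Proof.
move=> dphi; apply: line_derive_eq (line_derive_diff _ dphi) _.
by rewrite (bigD1 i)//= eqxx mul1r big1 ?addr0// => j /negbTE->; rewrite mul0r.
Qed.

Lemma line_derive_shift phi u e h l : line_derive phi (u + h) e l ->
  line_derive (fun u => phi (u + h)) u e l.
Proof.
rewrite /line_derive; congr (is_derive _ _ _ _).
by apply/funext => s; rewrite addrAC.
Qed.

Lemma delta_norm_le1 (i j : 'I_n) : `|(j == i)%:R : R| <= 1.
Proof. by case: (j == i); rewrite ?normr1 ?normr0. Qed.

Lemma unif_smooth_shift m phi (h : P -> 'rV[R]_n) : smooth phi ->
  (forall p, `|h p| <= B) -> unif_smooth U k m (fun p u => phi (u + h p)).
Proof.
move=> + hB; elim: m phi => [|m IH] phi sphi.
  have [C C0 hC] := continuous_bounded_ball (B + B) (smooth_continuous sphi).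
  split => //; exists C => p u Uu; apply: hC.
  by apply: le_trans (ler_normD _ _) _; apply: lerD; [exact: UB|exact: hB].
split.
  have [C C0 hC] := continuous_bounded_ball (B + B) (smooth_continuous sphi).
  exists C => p u Uu; apply: hC.
  by apply: le_trans (ler_normD _ _) _; apply: lerD; [exact: UB|exact: hB].
exists (fun p u => \sum_j (j == k p)%:R * 'D_(coord_vec j) phi (u + h p)); split.
  apply: unif_smooth_sum => j; apply: (@unif_smoothZ _ _ _ _ _ _ _ 1).
    by move=> p; exact: delta_norm_le1.
  by apply: (IH (fun x => 'D_(coord_vec j) phi x)); exact: smooth_derive.
move=> p u Uu; apply: line_derive_shift; apply: line_derive_pick.
exact: smooth_differentiable.
Qed.

(** Differentiation commutes with the difference quotient, so every derivative is built from
    quotients of the same kind, bounded by Lipschitz constants. The bounds survive when [h p] tends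
    to [0]. *)
Lemma unif_smooth_quot m phi (h : P -> 'rV[R]_n) : smooth phi ->
  (forall p, 0 < `|h p| <= B) ->
  unif_smooth U k m (fun p u => (phi (u + h p) - phi u) / `|h p|).
Proof.
move=> + hB; elim: m phi => [|m IH] phi sphi.
  have [C C0 hC] := smooth_lipschitz B sphi.
  split => //; exists C => p u Uu; have /andP[h0 h1] := hB p.
  by rewrite normrM normfV normr_id ler_pdivrMr//; apply: hC => //; exact: UB.
split.
  have [C C0 hC] := smooth_lipschitz B sphi.
  exists C => p u Uu; have /andP[h0 h1] := hB p.
  by rewrite normrM normfV normr_id ler_pdivrMr//; apply: hC => //; exact: UB.
exists (fun p u => \sum_j (j == k p)%:R *
  (('D_(coord_vec j) phi (u + h p) - 'D_(coord_vec j) phi u) / `|h p|)); split.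
  apply: unif_smooth_sum => j; apply: (@unif_smoothZ _ _ _ _ _ _ _ 1).
    by move=> p; exact: delta_norm_le1.
  by apply: (IH (fun x => 'D_(coord_vec j) phi x)); exact: smooth_derive.
move=> p u Uu.
have d1 := line_derive_shift (line_derive_pick (k p) (smooth_differentiable (u + h p) sphi)).
have d2 := line_derive_pick (k p) (smooth_differentiable u sphi).
have d3 := line_deriveD d1 (line_deriveM (line_derive_cst (-1) u (coord_vec (k p))) d2).
have d4 := line_deriveM d3 (line_derive_cst (`|h p|^-1) u (coord_vec (k p))).
move: d4; rewrite /line_derive !mulr0 add0r addr0.
have -> : (fun s : R => (phi (u + s *: coord_vec (k p) + h p) +
    -1 * phi (u + s *: coord_vec (k p))) * `|h p|^-1) =
    (fun s : R => (phi (u + s *: coord_vec (k p) + h p) - phi (u + s *: coord_vec (k p))) / `|h p|).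
  by apply/funext => s; rewrite mulN1r.
move=> d4; apply: is_derive_eq d4 _.
rewrite mulN1r -sumrB mulr_sumr; apply: eq_bigr => j _; ring.
Qed.

End SmoothFamilies.

(** * Integration by parts *)

Section IntegrationByParts.
Context {R : realType} {n : nat}.
Variables (u0 : 'rV[R]_n) (rho : R).
Hypothesis rho0 : 0 < rho.
Implicit Types (F G : 'rV[R]_n -> R) (u : 'rV[R]_n).

Definition vanishes_off (r : R) F := forall u, r < `|u - u0| -> F u = 0.

Definition ball_ind (r : R) u : R := if `|u - u0| <= r then 1 else 0.

Lemma vanishes_offM r F G : vanishes_off r F -> vanishes_off r (fun u => G u * F u).
Proof. by move=> h u /h->; rewrite mulr0. Qed.

Lemma bdd_suppn_ball r C F : (forall u, `|u - u0| <= r -> `|F u| <= C) ->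
  vanishes_off r F -> bdd_suppn F.
Proof.
move=> hC hF; have [M hM] := nat_above `|C|; have [B hB] := nat_above (r + `|u0|).
exists M, B; split => [u|u i _ hi].
  have [h|/hF->] := leP `|u - u0| r; last by rewrite normr0.
  by rewrite (le_trans (hC u h))// (le_trans (ler_norm _))// ltW.
apply: hF; have := coord_le_norm (u - u0) i; rewrite !mxE => h1.
have := coord_le_norm u0 i => h2; have := ler_normB (u 0 i - u0 0 i) (- u0 0 i).
by rewrite opprK subrK normrN; lra.
Qed.

Lemma bdd_suppn_ball_ind r : bdd_suppn (ball_ind r).
Proof.
apply: (@bdd_suppn_ball r 1) => u.
  by rewrite /ball_ind => ->; rewrite normr1.
by rewrite /ball_ind ltNge => /negbTE->.
Qed.

Lemma rint_ball_ind_ge0 r : 0 <= rint (ball_ind r).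
Proof.
apply: rint_ge0; first exact: bdd_suppn_ball_ind.
by move=> u; rewrite /ball_ind; case: ifP.
Qed.

Lemma norm_rint_le r C F : (forall u, `|u - u0| <= r -> `|F u| <= C) ->
  vanishes_off r F -> `|rint F| <= C * rint (ball_ind r).
Proof.
move=> hC hF; have bF := bdd_suppn_ball hC hF; have bb := bdd_suppn_ball_ind r.
have hb u : `|F u| <= C * ball_ind r u.
  rewrite /ball_ind; case: ifP => [/hC|/negbT]; first by rewrite mulr1.
  by rewrite -ltNge => /hF->; rewrite normr0 mulr0.
rewrite -rintZ// ler_norml; apply/andP; split.
  rewrite -mulN1r -rintZ; last exact: bdd_suppnZ.
  apply: ler_rint => //; first by apply: bdd_suppnZ; exact: bdd_suppnZ.
  by move=> u; have := hb u; rewrite ler_norml mulN1r => /andP[].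
apply: ler_rint => //; first exact: bdd_suppnZ.
by move=> u; apply: le_trans (ler_norm _) (hb u).
Qed.

Lemma coord_vec_norm (i : 'I_n) : `|coord_vec i : 'rV[R]_n| <= 1.
Proof.
by apply: row_norm_le => // j; rewrite mxE/=; case: (j == i); rewrite ?normr1 ?normr0.
Qed.

(** The exact invariance is under rational translations. For the step [1 / q] the difference
    quotient of [G] integrates to [0], and two applications of the mean value theorem put it within
    [C / q] of [G']; a nonzero integral of [G'] is contradicted by a large [q]. The shifts are short
    enough to stay in the ball of radius [2 * rho], where the derivatives are given. *)
Lemma rint_derive0 (i : 'I_n) (C : R) G G' G'' :
  vanishes_off rho G -> vanishes_off rho G' ->
  (forall u, `|u - u0| < 2 * rho -> `|G u| <= C) ->
  (forall u, `|u - u0| < 2 * rho -> `|G' u| <= C) ->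
  (forall u, `|u - u0| < 2 * rho -> `|G'' u| <= C) ->
  (forall u, `|u - u0| < 2 * rho -> line_derive G u (coord_vec i) (G' u)) ->
  (forall u, `|u - u0| < 2 * rho -> line_derive G' u (coord_vec i) (G'' u)) ->
  rint G' = 0.
Proof.
move=> G0 G'0 GC G'C G''C dG dG'; have r0 := rho0.
have rho2 u : `|u - u0| <= rho -> `|u - u0| < 2 * rho by lra.
have bG : bdd_suppn G by apply: (@bdd_suppn_ball rho C) => // u /rho2/GC.
have bG' : bdd_suppn G' by apply: (@bdd_suppn_ball rho C) => // u /rho2/G'C.
have C0 : 0 <= C by apply: le_trans (GC u0 _); rewrite ?normr_ge0// subrr normr0; lra.
set e : 'rV[R]_n := coord_vec i.
set V := rint (ball_ind (2 * rho)); have V0 : 0 <= V := rint_ball_ind_ge0 _.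
apply/eqP; rewrite -normr_le0 leNgt; apply/negP => a0.
have [q hq] := nat_above (C * V / `|rint G'| + 4 / rho + 1).
have x0 : 0 <= C * V / `|rint G'| by rewrite divr_ge0 ?mulr_ge0.
have y0 : 0 <= 4 / rho by rewrite divr_ge0// ltW.
have qp : 0 < q%:R :> R by lra.
have qr : q%:R^-1 <= rho / 4.
  have : 4 / rho <= q%:R by lra.
  rewrite ler_pdivrMr// => h.
  by rewrite -[leLHS]mul1r ler_pdivrMr//; lra.
have q0 : (0 < q)%N by rewrite -(ltr_nat R).
set t : R := q%:R^-1 in qr; have t0 : 0 < t by rewrite invr_gt0.
have sh : rint (fun u => G (u + t *: e)) = rint G.
  by rewrite -[RHS](rint_shift1 i 1 q0 bG) mulr1z mul1r.
have bsh : bdd_suppn (fun u => G (u + t *: e)) by exact: bdd_suppn_shift.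
have bq : bdd_suppn (fun u => q%:R * (G (u + t *: e) - G u)).
  by apply: bdd_suppnZ; exact: bdd_suppnB.
have E : rint G' = rint (fun u => G' u - q%:R * (G (u + t *: e) - G u)).
  rewrite rintB// rintZ; last exact: bdd_suppnB.
  by rewrite rintB// sh subrr mulr0 subr0.
suff : `|rint G'| <= C * t * V.
  rewrite leNgt => /negP; apply.
  rewrite mulrAC /t ltr_pdivrMr// [ltRHS]mulrC -ltr_pdivrMr//; lra.
rewrite {1}E.
have te s : 0 <= s <= t -> `|s *: e| <= rho / 4.
  move=> /andP[s0 st]; rewrite normrZ ger0_norm//; apply: le_trans qr.
  by rewrite (le_trans _ st)// ler_piMr// coord_vec_norm.
have step u s : `|u - u0| <= 3 / 2 * rho -> 0 <= s <= t -> `|u + s *: e - u0| < 2 * rho.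
  move=> hu hs; rewrite addrAC; apply: le_lt_trans (ler_normD _ _) _.
  by have := te s hs; lra.
have t0' : 0 <= t <= t by rewrite lexx ltW.
have out u : 3 / 2 * rho < `|u - u0| -> rho < `|u - u0| /\ rho < `|u + t *: e - u0|.
  move=> hu; split; first by lra.
  have := te t t0'; have := ler_normB (u + t *: e - u0) (t *: e).
  by rewrite addrAC addrK; lra.
apply: norm_rint_le => [u _|u hu].
  have [hu|/out[h1 h2]] := leP `|u - u0| (3 / 2 * rho); last first.
    by rewrite G'0// (G0 u)// (G0 _ h2) subrr mulr0 subrr normr0 mulr_ge0// ltW.
  have [s hs ->] := line_mvt t0 (fun s hs => dG _ (step u s hu hs)).
  rewrite mulrA /t mulfV ?gt_eqF// mul1r.
  have /andP[] := hs; rewrite le_eqVlt => /orP[/eqP<- _|s0 st].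
    by rewrite scale0r addr0 subrr normr0 mulr_ge0// ltW.
  have hs' s' : 0 <= s' <= s -> 0 <= s' <= t.
    by move=> /andP[a b]; rewrite a (le_trans b).
  have [s2 hs2 e2] := line_mvt s0 (fun s' h => dG' _ (step u s' hu (hs' s' h))).
  rewrite distrC e2 normrM (gtr0_norm s0) mulrC; apply: ler_pM => //; first exact: ltW.
  by apply: G''C; exact: step (hs' _ hs2).
have [h1 h2] : rho < `|u - u0| /\ rho < `|u + t *: e - u0| by apply: out; lra.
by rewrite G'0// (G0 u)// (G0 _ h2) subrr mulr0 subrr.
Qed.

Section Iterate.
Context {P : Type} (k : P -> 'I_n).
Notation U := [set u : 'rV[R]_n | `|u - u0| < 2 * rho].
Variables (f f' : P -> 'rV[R]_n -> R) (c : R).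
Hypothesis c0 : 0 < c.
Hypothesis df : forall p u, U u -> line_derive (f p) u (coord_vec (k p)) (f' p u).
Hypothesis sf' : forall m, unif_smooth U k m f'.
Hypothesis f'c : forall p u, U u -> c <= `|f' p u|.
Implicit Types (A : P -> 'rV[R]_n -> R).

Lemma near_ball_open u : U u -> \forall v \near u, U v.
Proof.
move=> Uu; have e0 : 0 < 2 * rho - `|u - u0| by rewrite subr_gt0.
apply/nbhs_ballP; exists (2 * rho - `|u - u0|) => // v.
rewrite -ball_normE /= => h.
have := ler_distD u v u0; rewrite (distrC v u).
by lra.
Qed.

(** One step replaces [A] by the derivative of [A / f'] and gains a factor [1 / L]: the derivative
    of [sin (L * f + th) * (A / f')] is [L * cos (L * f + th) * A + sin (L * f + th) * (A / f')'].
    The free phase [th] lets the remaining sine be read as a cosine in the next step. One derivative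
    more than the number of steps is asked for, because [rint_derive0] wants a bounded second
    derivative. *)
Lemma rint_ibp m A : unif_smooth U k m.+1 A -> (forall p, vanishes_off rho (A p)) ->
  exists C : R, forall p (L th : R), 0 < L ->
    `|rint (fun u => cos (L * f p u + th) * A p u)| <= C / L ^+ m.
Proof.
have r0 := rho0; elim: m A => [|m IH] A sA A0.
  have [C hC] := unif_smooth_bounded sA.
  exists (C * rint (ball_ind rho)) => p L th L0; rewrite expr0 divr1.
  apply: norm_rint_le => [u hu|]; last exact: vanishes_offM.
  rewrite normrM -[C]mul1r ler_pM ?cos_max//; apply: hC => /=; lra.
pose B p u := A p u * (f' p u)^-1.
have [bB [B' [sB' dB]]] : unif_smooth U k m.+2 B.
  by apply: unif_smoothM => //; exact: (unif_smoothV c0 f'c (sf' m.+2)).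
have B0 p : vanishes_off rho (B p) by move=> u hu; rewrite /B A0// mul0r.
(* [B'] is specified on [U] only, so it is cut to the small ball; nothing changes on [U], because
   [B] vanishes outside that ball. *)
pose A1 p u := if `|u - u0| <= rho then B' p u else 0.
have A10 p : vanishes_off rho (A1 p) by move=> u hu; rewrite /A1 leNgt hu.
have A1E p u : U u -> B' p u = A1 p u.
  move=> Uu; rewrite /A1; case: leP => // hu.
  have d0 : line_derive (B p) u (coord_vec (k p)) 0.
    apply: line_derive_near (line_derive_cst 0 u _).
    have e0 : 0 < `|u - u0| - rho by rewrite subr_gt0.
    apply/nbhs_ballP; exists (`|u - u0| - rho) => // v.
    rewrite -ball_normE /= => h; apply/esym/B0.
    by have := ler_distD v u u0; lra.
  have [_ e1] := dB p u Uu; have [_ e2] := d0; by rewrite -e1 e2.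
have oU : open U.
  by rewrite openE => u Uu; exact: near_ball_open.
have sA1 : unif_smooth U k m.+1 A1 := @unif_smooth_eq _ _ _ U k m.+1 _ _ oU A1E sB'.
have [C hC] := IH A1 sA1 A10.
exists C => p L th L0.
have key : rint (fun u => L * (cos (L * f p u + th) * A p u) + sin (L * f p u + th) * A1 p u) = 0.
  pose G u := sin (L * f p u + th) * B p u.
  pose Ph := unit; pose k1 (_ : unit) := k p.
  have sm_f' : unif_smooth U k1 0 (fun _ => f' p).
    by have [C' hC'] := unif_smooth_bounded (sf' 0%N); split => //; exists C' => _ u; exact: hC'.
  have dLf u : U u -> line_derive (fun u => L * f p u + th) u (coord_vec (k p)) (L * f' p u).
    move=> Uu; apply: line_derive_eq (line_deriveD (line_deriveM (line_derive_cst L _ _)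
      (df p Uu)) (line_derive_cst th _ _)) _.
    by rewrite mulr0 !addr0.
  have dsin u : U u -> line_derive (fun u => sin (L * f p u + th)) u (coord_vec (k p))
      (cos (L * f p u + th) * (L * f' p u)).
    by move=> Uu; apply: line_derive_comp (dLf u Uu).
  have dcos u : U u -> line_derive (fun u => cos (L * f p u + th)) u (coord_vec (k p))
      (- sin (L * f p u + th) * (L * f' p u)).
    by move=> Uu; apply: line_derive_comp (dLf u Uu).
  have [C1 hC1] := unif_smooth_bounded (sf' 0%N).
  have bb (trig : R -> R) : (forall x, `|trig x| <= 1) -> unif_smooth U k1 0
      (fun _ u => trig (L * f p u + th) * (L * f' p u)).
    move=> ht; split => //; exists (`|L| * C1) => _ u Uu.
    by rewrite normrM -[leRHS]mul1r ler_pM// normrM ler_wpM2l// hC1.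
  have scos : unif_smooth U k1 1 (fun _ u => cos (L * f p u + th)).
    split; first by exists 1 => _ u _; exact: cos_max.
    exists (fun _ u => - sin (L * f p u + th) * (L * f' p u)); split; last by move=> q; exact: dcos.
    by apply: (bb (fun x => - sin x)) => x; rewrite normrN sin_max.
  have ssin : unif_smooth U k1 1 (fun _ u => sin (L * f p u + th)).
    split; first by exists 1 => _ u _; exact: sin_max.
    exists (fun _ u => cos (L * f p u + th) * (L * f' p u)); split; last by move=> q; exact: dsin.
    by apply: (bb cos) => x; rewrite cos_max.
  have restrict (F : P -> 'rV[R]_n -> R) m' : unif_smooth U k m' F -> unif_smooth U k1 m' (fun _ => F p).
    elim: m' F => [|m' IHm] F [[C' hC'] hF]; first by split => //; exists C' => _; exact: hC'.
    split; first by exists C' => _; exact: hC'.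
    have [F' [sF' dF']] := hF; exists (fun _ => F' p); split; first exact: IHm.
    by move=> q; exact: dF'.
  have sG' : unif_smooth U k1 1 (fun _ u => L * (cos (L * f p u + th) * A p u) +
      sin (L * f p u + th) * A1 p u).
    apply: unif_smoothD.
      apply: (@unif_smoothZ _ _ _ _ _ _ (fun=> L) `|L|) => //.
      apply: unif_smoothM => //; apply: (restrict A).
      by apply: unif_smooth_leq sA.
    apply: unif_smoothM => //; apply: (restrict A1).
    by apply: unif_smooth_leq sA1.
  have [[CG' hCG'] [G'' [[[CG'' hCG''] _] dG'']]] := sG'.
  have [CB hCB] := bB.
  pose C3 := Num.max CB (Num.max CG' CG'').
  apply: (@rint_derive0 (k p) C3 G _ (G'' tt)).
  - by move=> u hu; rewrite /G B0// mulr0.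
  - by move=> u hu; rewrite A0// A10// !mulr0 addr0.
  - move=> u Uu; rewrite /G normrM; apply: (@le_trans _ _ (1 * CB)).
      by rewrite ler_pM// ?sin_max ?hCB.
    by rewrite mul1r /C3 le_max lexx.
  - move=> u Uu; apply: le_trans (hCG' tt u Uu) _.
    by rewrite /C3 !le_max lexx orbT.
  - move=> u Uu; apply: le_trans (hCG'' tt u Uu) _.
    by rewrite /C3 !le_max lexx !orbT.
  - move=> u Uu; apply: line_derive_eq (line_deriveM (dsin u Uu) (dB p u Uu)) _.
    rewrite A1E// addrC; congr (_ + _); rewrite /B.
    have f'0 : f' p u != 0 by rewrite -normr_gt0 (lt_le_trans c0) ?f'c.
    by field.
  - by move=> u Uu; exact: (dG'' tt u Uu).
have rho2 u : `|u - u0| <= rho -> U u by rewrite /=; lra.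
have b1 : bdd_suppn (fun u => cos (L * f p u + th) * A p u).
  have [C' hC'] := unif_smooth_bounded sA.
  apply: (@bdd_suppn_ball rho (1 * C')); last exact: vanishes_offM.
  by move=> u /rho2 hu; rewrite normrM ler_pM ?cos_max ?hC'.
have b2 : bdd_suppn (fun u => sin (L * f p u + th) * A1 p u).
  have [C' hC'] := unif_smooth_bounded sA1.
  apply: (@bdd_suppn_ball rho (1 * C')); last exact: vanishes_offM.
  by move=> u /rho2 hu; rewrite normrM ler_pM ?sin_max ?hC'.
move: key; rewrite rint_lin// => key.
have := hC p L (th - pi / 2) L0.
have -> : (fun u => cos (L * f p u + (th - pi / 2)) * A1 p u) =
          (fun u => sin (L * f p u + th) * A1 p u).
  by apply/funext => u; rewrite addrA cosBpihalf.
have -> : rint (fun u => sin (L * f p u + th) * A1 p u) =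
   - (L * rint (fun u => cos (L * f p u + th) * A p u)) by lra.
rewrite normrN normrM gtr0_norm// => h.
by rewrite exprS invfM mulrCA mulrC ler_pdivlMr// mulrC.
Qed.

End Iterate.
End IntegrationByParts.

(** * Decay for hypersurfaces with nonvanishing curvature *)

Section Bump.
Context {R : realType}.

(** Finitely many derivatives are enough: [(1 - s ^ 2) ^ M] cut at [0] has bounded ones up to order
    [M - 1] on bounded sets, and its derivative is a multiple of [s] times the bump of exponent
    [M - 1]. *)
Definition bump (M : nat) (s : R) : R := Num.max 0 (1 - s ^+ 2) ^+ M.

Lemma is_derive_max_pow (M : nat) (x : R) :
  is_derive x 1 (fun y : R => Num.max 0 y ^+ M.+2) (M.+2%:R * Num.max 0 x ^+ M.+1).
Proof.
have [x0|x0|<-] := ltgtP 0 x.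
- have d : is_derive x (1 : R) (fun y : R => y ^+ M.+2) (M.+2%:R * x ^+ M.+1).
    have -> : (fun y : R => y ^+ M.+2) = (@id R) ^+ M.+2.
      by apply/funext => y; rewrite exprfctE.
    by apply: is_derive_eq (is_deriveX M.+2 (is_derive_id x (1 : R))) _; rewrite [LHS]mulr1.
  have e : \forall y \near x, y ^+ M.+2 = Num.max 0 y ^+ M.+2.
    near=> y; rewrite max_r// ltW//; near: y; exact: lt_nbhsr.
  have [d1 d2] := d; split; first exact: near_eq_derivable d1.
  by rewrite -(near_eq_derive _ e) d2.
- have e : \forall y \near x, 0 = Num.max 0 y ^+ M.+2 :> R.
    near=> y; rewrite max_l ?expr0n//= ltW//; near: y; exact: lt_nbhsl.
  have [d1 d2] := is_derive_cst (0 : R) x (1 : R).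
  split; first exact: near_eq_derivable d1.
  by rewrite -(near_eq_derive _ e) d2 expr0n/= mulr0.
have c : (fun h : R => h^-1 *: (((fun y : R => Num.max 0 y ^+ M.+2) \o shift 0) (h *: (1 : R)) -
    Num.max 0 0 ^+ M.+2)) @ 0^' --> (0 : R).
  apply/cvgr0Pnorm_le => e e0; have m0 : 0 < Num.min 1 e by rewrite lt_min ltr01.
  near=> h.
  rewrite /= addr0 /GRing.scale/= mulr1 maxxx expr0n/= subr0.
  have h0 : h != 0 by near: h; exact: nbhs_dnbhs_neq.
  have h1 : `|h| <= Num.min 1 e.
    by near: h; exact: dnbhs0_le.
  have [he h1'] : `|h| <= e /\ `|h| <= 1 by move: h1; rewrite le_min => /andP[].
  have mh : Num.max 0 h <= `|h| by rewrite ge_max normr_ge0 ler_norm.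
  have mh0 : 0 <= Num.max 0 h by rewrite le_max lexx.
  rewrite normrM normfV (ger0_norm (exprn_ge0 _ mh0)) ler_pdivrMl ?normr_gt0//.
  apply: (@le_trans _ _ (`|h| ^+ 2)).
    apply: (@le_trans _ _ (`|h| ^+ M.+2)); first by rewrite ler_pXn2r ?nnegrE.
    by rewrite ler_wiXn2l.
  by rewrite expr2 ler_wpM2l.
rewrite expr0n/= mulr0; split; first by apply/cvg_ex; exists 0.
exact/cvg_lim.
Unshelve. all: by end_near.
Qed.

Lemma is_derive_bump (M : nat) (s : R) :
  is_derive s 1 (bump M.+2) (- 2 * M.+2%:R * s * bump M.+1 s).
Proof.
have d1 : is_derive s (1 : R) (fun s : R => 1 - s ^+ 2) (- (2 * s)).
  have -> : (fun s : R => 1 - s ^+ 2) = cst 1 - (@id R) ^+ 2.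
    by apply/funext => y; rewrite !fctE.
  by apply: is_derive_eq; rewrite /GRing.scale/=; ring.
have := @is_derive1_comp _ (fun y : R => Num.max 0 y ^+ M.+2) (fun s : R => 1 - s ^+ 2) s _ _
  (is_derive_max_pow M (1 - s ^+ 2)) d1.
by move=> h; apply: is_derive_eq h _; rewrite /bump; ring.
Qed.

Lemma bump_ge0 M s : 0 <= bump M s.
Proof. by rewrite exprn_ge0// le_max lexx. Qed.

Lemma bump_le1 M s : bump M s <= 1.
Proof.
rewrite exprn_ile1//; first by rewrite le_max lexx.
by rewrite ge_max ler01 gerBl sqr_ge0.
Qed.

Lemma bump_out M s : 1 < `|s| -> bump M.+1 s = 0.
Proof.
move=> s1; rewrite /bump max_l ?expr0n// subr_le0 -[s ^+ 2]real_normK ?num_real//.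
by rewrite exprn_ege1// ltW.
Qed.

Lemma bump_lower M s : `|s| <= 2^-1 -> 2^-1 ^+ M <= bump M s.
Proof.
move=> s1; have h : 2^-1 <= 1 - s ^+ 2.
  by rewrite -[s ^+ 2]real_normK ?num_real//; have := normr_ge0 s; nra.
by rewrite /bump lerXn2r ?nnegrE ?invr_ge0// ?le_max ?h ?orbT ?lexx.
Qed.

End Bump.

Section Cutoff.
Context {R : realType} {n : nat}.
Variables (u0 : 'rV[R]_n) (rho : R).
Hypothesis rho0 : 0 < rho.
Implicit Types (u : 'rV[R]_n).

Definition cutoff (M : nat) u : R := \prod_j bump M ((u 0 j - u0 0 j) / rho).

Lemma cutoff_ge0 M u : 0 <= cutoff M u.
Proof. by apply: prodr_ge0 => j _; exact: bump_ge0. Qed.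

Lemma cutoff_le1 M u : cutoff M u <= 1.
Proof. by apply: prodr_ile1 => j _; rewrite bump_ge0 bump_le1. Qed.

Lemma cutoff_vanishes M : vanishes_off u0 rho (cutoff M.+1).
Proof.
move=> u hu; have u0' : u - u0 != 0 by rewrite -normr_gt0 (lt_trans rho0).
have [j hj] := row_norm_attained u0'.
rewrite /cutoff (bigD1 j)//= bump_out ?mul0r//.
rewrite normrM normfV (gtr0_norm rho0) ltr_pdivlMr// mul1r.
by move: hu; rewrite hj !mxE.
Qed.

Lemma cutoff_lower M u : `|u - u0| <= rho / 2 -> 2^-1 ^+ (M * n) <= cutoff M u.
Proof.
have r0 := rho0 => hu; rewrite exprM -[n in leLHS]card_ord -prodr_const /cutoff.
apply: ler_prod => j _; rewrite exprn_ge0 ?invr_ge0//=; apply: bump_lower.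
rewrite normrM normfV (gtr0_norm rho0) ler_pdivrMr//.
by have := coord_le_norm (u - u0) j; rewrite !mxE; lra.
Qed.

Context {P : Type} (U : set 'rV[R]_n) (k : P -> 'I_n).
Variables (B : R) (UB : forall u, U u -> `|u| <= B).

Lemma unif_smooth_coord m j (h : P -> 'rV[R]_n) : (forall p, `|h p| <= B) ->
  unif_smooth U k m (fun p u => ((u + h p) 0 j - u0 0 j) / rho).
Proof.
move=> hB.
have bd : exists C : R, forall p u, U u -> `|((u + h p) 0 j - u0 0 j) / rho| <= C.
  exists ((B + B + `|u0|) / rho) => p u Uu.
  rewrite normrM normfV (gtr0_norm rho0) ler_pM2r ?invr_gt0//.
  apply: le_trans (ler_normB _ _) _; apply: lerD; last exact: coord_le_norm.
  apply: le_trans (coord_le_norm _ _) _; apply: le_trans (ler_normD _ _) _.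
  by apply: lerD; [exact: UB|exact: hB].
case: m => [|m]; split => //.
exists (fun p _ => (j == k p)%:R / rho); split.
  apply: (@unif_smooth_cst _ _ _ _ _ _ _ rho^-1) => p.
  rewrite normrM normfV (gtr0_norm rho0) ler_piMl ?invr_ge0 ?(ltW rho0)//.
  exact: delta_norm_le1.
move=> p u Uu; rewrite /line_derive.
have -> : (fun s : R => ((u + s *: coord_vec (k p) + h p) 0 j - u0 0 j) / rho) =
    (fun s : R => ((u + h p) 0 j - u0 0 j) / rho + s * ((j == k p)%:R / rho)).
  by apply/funext => s; rewrite !mxE/=; ring.
by apply: is_derive_eq; rewrite /GRing.scale/=; ring.
Qed.

Lemma unif_smooth_bump m M j (h : P -> 'rV[R]_n) : (m < M)%N -> (forall p, `|h p| <= B) ->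
  unif_smooth U k m (fun p u => bump M (((u + h p) 0 j - u0 0 j) / rho)).
Proof.
move=> + hB; elim: m M => [|m IH] M mM.
  by split => //; exists 1 => p u _; rewrite ger0_norm ?bump_ge0// bump_le1.
split; first by exists 1 => p u _; rewrite ger0_norm ?bump_ge0// bump_le1.
case: M mM => [//|[//|M]] mM.
exists (fun p u => (-2 * M.+2%:R * (((u + h p) 0 j - u0 0 j) / rho) *
   bump M.+1 (((u + h p) 0 j - u0 0 j) / rho)) * ((j == k p)%:R / rho)); split.
  apply: unif_smoothM; last first.
    apply: (@unif_smooth_cst _ _ _ _ _ _ _ rho^-1) => p.
    rewrite normrM normfV (gtr0_norm rho0) ler_piMl ?invr_ge0 ?(ltW rho0)//.
    exact: delta_norm_le1.
  apply: unif_smoothM; last exact: IH.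
  apply: (@unif_smoothZ _ _ _ _ _ _ (fun=> -2 * M.+2%:R) `|-2 * M.+2%:R|) => //.
  exact: unif_smooth_coord.
move=> p u Uu.
have [_ [F' [_ dF']]] := unif_smooth_coord 1 j hB.
have d : line_derive (fun u => ((u + h p) 0 j - u0 0 j) / rho) u (coord_vec (k p))
    ((j == k p)%:R / rho).
  rewrite /line_derive.
  have -> : (fun s : R => ((u + s *: coord_vec (k p) + h p) 0 j - u0 0 j) / rho) =
      (fun s : R => ((u + h p) 0 j - u0 0 j) / rho + s * ((j == k p)%:R / rho)).
    by apply/funext => s; rewrite !mxE/=; ring.
  by apply: is_derive_eq; rewrite /GRing.scale/=; ring.
exact: (line_derive_comp (is_derive_bump M _) d).
Qed.

Lemma unif_smooth_cutoff m M (h : P -> 'rV[R]_n) : (m < M)%N -> (forall p, `|h p| <= B) ->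
  unif_smooth U k m (fun p u => cutoff M (u + h p)).
Proof. by move=> mM hB; apply: unif_smooth_prod => j; exact: unif_smooth_bump. Qed.

End Cutoff.

Section Nondegenerate.
Context {R : realType} {n : nat}.
Variables (g : 'rV[R]_n -> R) (u0 : 'rV[R]_n).
Hypothesis sg : smooth g.
Implicit Types (u h : 'rV[R]_n).

Definition hessian u : 'M[R]_n :=
  \matrix_(i, j) 'D_(coord_vec i) (fun w => 'D_(coord_vec j) g w) u.

(** By the mean value theorem the difference is the [k]-th entry of [h] times a matrix of second
    derivatives close to those at [u0]; invertibility bounds [h *m H] below, and [k] is a coordinate
    where its sup norm is attained. Thus [k] depends on [h] but not on [u], and one direction of
    integration by parts serves the whole ball. *)
Lemma hessian_expansion : hessian u0 \in unitmx ->
  exists2 c : R, 0 < c & exists2 r : R, 0 < r & forall h, h != 0 -> `|h| <= r ->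
    exists k, forall u, `|u - u0| <= r ->
      c * `|h| <= `|'D_(coord_vec k) g (u + h) - 'D_(coord_vec k) g u|.
Proof.
move=> Hu; set H := hessian u0 in Hu.
pose m : R := \sum_i \sum_j `|invmx H i j| + 1.
have m0 : 0 < m by rewrite ltr_wpDl// sumr_ge0// => i _; rewrite sumr_ge0.
have big h : h != 0 -> exists k, `|h| <= m * `|(h *m H) 0 k|.
  move=> h0; have hH0 : h *m H != 0.
    by apply: contra h0 => /eqP e; rewrite -(mulmxK Hu h) e mul0mx.
  have [k hk] := row_norm_attained hH0; exists k; rewrite -hk.
  apply: row_norm_le => [|l]; first by rewrite mulr_ge0// ltW.
  rewrite -(mulmxK Hu h) mxE mulmxK//; apply: le_trans (ler_norm_sum _ _ _) _.
  rewrite /m mulrDl mul1r ler_wpDr// mulr_suml; apply: ler_sum => j _.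
  rewrite normrM mulrC ler_pM ?coord_le_norm//.
  by rewrite (bigD1 l)//= lerDl sumr_ge0.
have n0 : 0 < n%:R + 1 :> R by rewrite ltr_wpDl.
pose e := (2 * m * (n%:R + 1))^-1.
have e0 : 0 < e by rewrite invr_gt0 !mulr_gt0.
have near_hess (jk : 'I_n * 'I_n) : exists2 r : R, 0 < r &
   forall u, `|u - u0| < r -> `|hessian u jk.1 jk.2 - H jk.1 jk.2| < e.
  have cont : continuous (fun u => hessian u jk.1 jk.2).
    have -> : (fun u => hessian u jk.1 jk.2) =
      (fun u => 'D_(coord_vec jk.1) (fun w => 'D_(coord_vec jk.2) g w) u).
      by apply/funext => u; rewrite mxE.
    by apply: smooth_continuous; apply: smooth_derive; exact: smooth_derive.
  have := cont u0; move=> /cvgrPdist_lt/(_ e e0)/nbhs_ballP[r /= r0 hr].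
  exists r => // u hu; rewrite distrC; apply: hr.
  by rewrite -ball_normE/= distrC.
have /choice[rr hrr] (jk : 'I_n * 'I_n) : exists r : R, 0 < r /\
   forall u, `|u - u0| < r -> `|hessian u jk.1 jk.2 - H jk.1 jk.2| < e.
  by have [r] := near_hess jk; exists r.
pose s := \big[Num.min/1]_(jk : 'I_n * 'I_n) rr jk.
have s0 : 0 < s by apply/bigmin_gtP; split => // jk _; case: (hrr jk).
have srr jk : s <= rr jk by apply: bigmin_le_cond.
exists ((2 * m)^-1); first by rewrite invr_gt0 mulr_gt0.
exists (s / 4); first by rewrite divr_gt0.
move=> h h0 hs; have [k hk] := big h h0; exists k => u hu.
have sD : smooth (fun x => 'D_(coord_vec k) g x) by exact: smooth_derive.
have [t /andP[t0 t1] ->] := smooth_mvt u h sD.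
rewrite (derive_sum_coord _ (smooth_differentiable _ sD)).
have hv : `|u + t *: h - u0| < s.
  rewrite addrAC; apply: le_lt_trans (ler_normD _ _) _.
  rewrite normrZ ger0_norm//.
  have : t * `|h| <= 1 * `|h| by rewrite ler_wpM2r.
  by lra.
set v := u + t *: h in hv *.
have E : \sum_j h 0 j * 'D_(coord_vec j) (fun x => 'D_(coord_vec k) g x) v =
   (h *m H) 0 k + \sum_j h 0 j * (hessian v j k - H j k).
  rewrite [in RHS]mxE -big_split; apply: eq_bigr => j _ /=.
  by rewrite -mulrDr addrC subrK mxE.
rewrite E.
have small : `|\sum_j h 0 j * (hessian v j k - H j k)| <= `|h| / (2 * m).
  apply: le_trans (ler_norm_sum _ _ _) _.
  apply: (@le_trans _ _ (\sum_(j < n) `|h| * e)).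
    apply: ler_sum => j _; rewrite normrM ler_pM ?coord_le_norm//.
    apply: ltW; have [_ H2] := hrr (j, k); apply: H2.
    by apply: lt_le_trans hv _; exact: (srr (j, k)).
  rewrite sumr_const card_ord -[leLHS]mulr_natl mulrCA ler_wpM2l//.
  rewrite /e invfM mulrCA ler_piMr ?invr_ge0 ?mulr_ge0 ?(ltW m0)//.
  by rewrite ler_pdivrMr// mul1r lerDl.
have hk' : `|h| / m <= `|(h *m H) 0 k| by rewrite ler_pdivrMr// mulrC.
have := ler_normB ((h *m H) 0 k + \sum_j h 0 j * (hessian v j k - H j k))
   (\sum_j h 0 j * (hessian v j k - H j k)).
rewrite addrK.
have -> : (2 * m)^-1 * `|h| = `|h| / m - `|h| / (2 * m) by field; rewrite gt_eqF.
lra.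
Qed.

End Nondegenerate.

Section GraphDecay.
Context {R : realType} {n : nat}.
Variables (g : 'rV[R]_n -> R) (u0 : 'rV[R]_n) (rho r : R) (M : nat).
Hypotheses (sg : smooth g) (rho0 : 0 < rho) (rho_r : 2 * rho <= r) (M2n : (2 * n + 1 < M)%N).
Implicit Types (u h a : 'rV[R]_n) (b : R).

Notation U := [set u : 'rV[R]_n | `|u - u0| < 2 * rho].
Notation chi := (cutoff u0 rho M).

Let B := `|u0| + r + r.

Lemma ball_bound u : U u -> `|u| <= B.
Proof.
have r1 := rho_r; have r0 := rho0; move=> /= hu.
have := ler_normD (u - u0) u0; rewrite subrK /B.
by move=> h; apply: le_trans h _; lra.
Qed.

Lemma chi_vanishes : vanishes_off u0 rho chi.
Proof. by case: M M2n => // m _; exact: cutoff_vanishes. Qed.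

Lemma norm_chi_le1 u : `|chi u| <= 1.
Proof. by rewrite ger0_norm ?cutoff_ge0// cutoff_le1. Qed.

Lemma bdd_suppn_chi F : (forall u, `|F u| <= 1) -> bdd_suppn (fun u => F u * chi u).
Proof.
move=> hF; apply: (@bdd_suppn_ball _ _ u0 rho 1); last first.
  by apply: vanishes_offM; exact: chi_vanishes.
by move=> u _; rewrite normrM -[leRHS]mulr1 ler_pM// norm_chi_le1.
Qed.

Lemma norm_rint_chi F : (forall u, `|F u| <= 1) ->
  `|rint (fun u => F u * chi u)| <= rint (ball_ind u0 rho).
Proof.
move=> hF; rewrite -[leRHS]mul1r; apply: norm_rint_le.
  by move=> u _; rewrite normrM -[leRHS]mulr1 ler_pM// norm_chi_le1.
by apply: vanishes_offM; exact: chi_vanishes.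
Qed.

Lemma line_derive_dot a u (i : 'I_n) : line_derive (dot a) u (coord_vec i) (a 0 i).
Proof.
rewrite /line_derive.
have -> : (fun s : R => dot a (u + s *: coord_vec i)) = (fun s : R => dot a u + s * a 0 i).
  apply/funext => s; rewrite dotDr dotZr; congr (_ + _ * _).
  rewrite /dot (bigD1 i)//= !mxE !eqxx mulr1 big1 ?addr0// => j ji.
  by rewrite !mxE (negbTE ji) andbF mulr0.
by apply: is_derive_eq; rewrite /GRing.scale/=; ring.
Qed.

(* When [|b|] is small against [|a|], the phase has no critical point. *)
Lemma nonstationary_decay : exists2 kap : R, 0 < kap <= 1 &
  exists C : R, forall a b, a != 0 -> `|b| <= kap * `|a| ->
    `|rint (fun u => cos (dot a u + b * g u) * chi u)| <= C / `|a| ^+ n.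
Proof.
have r0 := rho0.
have /choice[D hD] (j : 'I_n) : exists D : R, 0 < D /\
    forall u, `|u| <= B -> `|'D_(coord_vec j) g u| <= D.
  have [D D0 hD] := continuous_bounded_ball B (smooth_continuous (smooth_derive (coord_vec j) sg)).
  by exists D.
pose S := \sum_j D j + 1.
have S0 : 0 < S by rewrite ltr_wpDl// sumr_ge0// => j _; rewrite ltW//; case: (hD j).
have DS j : D j <= S.
  rewrite /S (bigD1 j)//= -addrA lerDl addr_ge0// sumr_ge0// => i _.
  by rewrite ltW//; case: (hD i).
(* With this choice [|b|] times any first derivative of [g] is at most [|a| / 2], while some
   coordinate of [a] has absolute value [|a|]: the phase keeps a derivative of size [|a| / 2] in
   that direction. *)
pose kap := Num.min 1 (2 * S)^-1.
have k0 : 0 < kap by rewrite lt_min ltr01/= invr_gt0 mulr_gt0.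
have k1 : kap <= 1 by rewrite ge_min lexx.
have kS : kap * S <= 2^-1.
  have : kap <= (2 * S)^-1 by rewrite ge_min lexx orbT.
  by rewrite invfM -ler_pdivlMr.
exists kap; first by rewrite k0.
have half_away (x y : R) : `|x| = 1 -> `|y| <= 2^-1 -> 2^-1 <= `|x + y|.
  by move=> x1 y1; have := ler_normB (x + y) y; rewrite addrK x1; lra.
have B0' : `|0 : 'rV[R]_n| <= B.
  by rewrite normr0 /B; have r1 := rho_r; have := normr_ge0 u0; lra.
(* After division by [|a|] the pairs form a bounded family, over which the constant of [rint_ibp] is
   uniform; [|a|] becomes the large parameter. *)
pose P := {p : 'rV[R]_n * R | `|p.1| = 1 /\ `|p.2| <= kap}.
have /choice[k hk] (p : P) : exists i, `|(sval p).1 0 i| = 1.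
  have [h1 h2] := svalP p; have p0 : (sval p).1 != 0 by rewrite -normr_gt0 h1.
  by have [i hi] := row_norm_attained p0; exists i; rewrite -hi.
pose f (p : P) u := dot (sval p).1 u + (sval p).2 * g u.
pose f' (p : P) u := (sval p).1 0 (k p) +
  (sval p).2 * \sum_j (j == k p)%:R * 'D_(coord_vec j) g (u + 0).
have UB := ball_bound.
have B0 (p : P) : `|0 : 'rV[R]_n| <= B by [].
have sf' m : unif_smooth U k m f'.
  apply: unif_smoothD.
    by apply: (@unif_smooth_cst _ _ _ _ _ _ (fun p : P => (sval p).1 0 (k p)) 1) => p; rewrite hk.
  apply: (@unif_smoothZ _ _ _ _ _ _ (fun p : P => (sval p).2) 1).
    by move=> p; have [_ h2] := svalP p; apply: le_trans h2 k1.
  apply: unif_smooth_sum => j; apply: (@unif_smoothZ _ _ _ _ _ _ _ 1).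
    by move=> p; exact: delta_norm_le1.
  exact: (@unif_smooth_shift _ _ _ U k B UB m _ (fun _ : P => 0) (smooth_derive (coord_vec j) sg) B0).
have df p u : U u -> line_derive (f p) u (coord_vec (k p)) (f' p u).
  move=> Uu; apply: line_derive_eq (line_deriveD (line_derive_dot _ _ _)
    (line_deriveM (line_derive_cst (sval p).2 _ _)
       (line_derive_pick (k p) (smooth_differentiable u sg)))) _.
  by rewrite mulr0 addr0 /f'; under [in RHS]eq_bigr do rewrite addr0.
have f'c p u : U u -> 2^-1 <= `|f' p u|.
  move=> Uu; rewrite /f' (bigD1 (k p))//= eqxx mul1r big1 ?addr0; last first.
    by move=> j /negbTE->; rewrite mul0r.
  have [_ h2] := svalP p; have [D0 hDk] := hD (k p).
  have : `|(sval p).2 * 'D_(coord_vec (k p)) g u| <= 2^-1.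
    rewrite normrM; apply: le_trans kS; apply: ler_pM => //.
    by apply: le_trans (DS (k p)); apply: hDk; exact: UB.
  exact: half_away (hk p).
have sA : unif_smooth U k n.+1 (fun (_ : P) u => chi (u + 0)).
  by apply: (@unif_smooth_cutoff _ _ u0 _ rho0 P _ k _ UB _ _ (fun _ : P => 0)) => //; apply: leq_ltn_trans M2n; rewrite mul2n -addnn addn1 ltnS leq_addr.
have A0 (p : P) : vanishes_off u0 rho (fun u => chi (u + 0)).
  by move=> u hu; rewrite addr0 chi_vanishes.
have [C hC] := rint_ibp rho0 (ltac:(by rewrite invr_gt0) : 0 < 2^-1 :> R) df sf' f'c sA A0.
exists C => a b a0 hb.
have na : 0 < `|a| by rewrite normr_gt0.
pose na1 := `|a|. have hp : `|na1^-1 *: a| = 1 /\ `|b / na1| <= kap.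
  by rewrite /na1 normrZ normfV normr_id mulVf ?gt_eqF// normrM normfV normr_id ler_pdivrMr.
have := hC (exist _ (na1^-1 *: a, b / na1) hp) na1 0 na.
congr (`|rint _| <= _); apply/funext => u; rewrite /f /= !addr0 dotZl.
by congr (cos _ * _); field; rewrite gt_eqF.
Qed.

Variable c : R.
Hypothesis c0 : 0 < c.
Hypothesis nondeg : forall h, h != 0 -> `|h| <= r ->
    exists k, forall u, `|u - u0| <= r ->
      c * `|h| <= `|'D_(coord_vec k) g (u + h) - 'D_(coord_vec k) g u|.

(** This is the real part of the autocorrelation at lag [h] of the oscillating function with phase
    [a . u + b * g u] and amplitude [chi]; the linear term contributes only the constant phase
    [a . h]. *)
Definition correlation a b h : R := rint (fun u =>
  cos (dot a (u + h) + b * g (u + h) - (dot a u + b * g u)) * (chi u * chi (u + h))).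

Lemma correlation_trivial a b h : `|correlation a b h| <= rint (ball_ind u0 rho).
Proof.
rewrite /correlation; under eq_fun do rewrite mulrA mulrAC.
apply: norm_rint_chi => u; rewrite normrM -[leRHS]mulr1 ler_pM ?cos_max//.
exact: norm_chi_le1.
Qed.

(** Up to sign and an additive constant the phase is [|b| * |h|] times the difference quotient of
    [g], whose derivative along the coordinate attached to [h] is at least [c] in absolute value.
    Integrating by parts [2 * n] times leaves an inverse square for each of the [n] coordinates of
    the lag, which is summable; this fixes the smoothness of the cutoff. *)
Lemma correlation_decay : exists C : R, forall a b h, b != 0 -> h != 0 -> `|h| <= r ->
  `|correlation a b h| <= C / (`|b| * `|h|) ^+ (2 * n).
Proof.
have r0 := rho0; have r1 := rho_r; have nn := normr_ge0 u0.
have B0' : `|0 : 'rV[R]_n| <= B by rewrite normr0 /B; lra.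
have rB : r <= B by rewrite /B; lra.
have U_r u : U u -> `|u - u0| <= r by move=> /= hu; lra.
pose P := {h : 'rV[R]_n | h != 0 /\ `|h| <= r}.
have /choice[k hk] (p : P) : exists k, forall u, `|u - u0| <= r ->
    c * `|sval p| <= `|'D_(coord_vec k) g (u + sval p) - 'D_(coord_vec k) g u|.
  by have [h1 h2] := svalP p; exact: nondeg.
have UB := ball_bound.
have pB (p : P) : `|sval p| <= B by have [_ h2] := svalP p; exact: le_trans rB.
have pB0 (p : P) : 0 < `|sval p| <= B by rewrite pB normr_gt0 (proj1 (svalP p)).
have B0 (p : P) : `|0 : 'rV[R]_n| <= B by [].
pose f (p : P) u := (g (u + sval p) - g u) / `|sval p|.
pose f' (p : P) u := \sum_j (j == k p)%:R *
  (('D_(coord_vec j) g (u + sval p) - 'D_(coord_vec j) g u) / `|sval p|).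
have sf' m : unif_smooth U k m f'.
  apply: unif_smooth_sum => j; apply: (@unif_smoothZ _ _ _ _ _ _ _ 1).
    by move=> p; exact: delta_norm_le1.
  exact: (@unif_smooth_quot _ _ _ U k B UB m _ (fun p : P => sval p) (smooth_derive (coord_vec j) sg) pB0).
have df p u : U u -> line_derive (f p) u (coord_vec (k p)) (f' p u).
  move=> Uu.
  have d1 := line_derive_shift (line_derive_pick (k p) (smooth_differentiable (u + sval p) sg)).
  have d2 := line_derive_pick (k p) (smooth_differentiable u sg).
  have d3 := line_deriveD d1 (line_deriveM (line_derive_cst (-1) u (coord_vec (k p))) d2).
  have d4 := line_deriveM d3 (line_derive_cst (`|sval p|^-1) u (coord_vec (k p))).
  move: d4; rewrite /line_derive !mulr0 add0r addr0.
  have -> : (fun s : R => (g (u + s *: coord_vec (k p) + sval p) +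
      -1 * g (u + s *: coord_vec (k p))) * `|sval p|^-1) =
      (fun s : R => f p (u + s *: coord_vec (k p))).
    by apply/funext => s; rewrite mulN1r.
  move=> d4; apply: is_derive_eq d4 _.
  rewrite mulN1r -sumrB mulr_sumr; apply: eq_bigr => j _; ring.
have f'c p u : U u -> c <= `|f' p u|.
  move=> Uu; rewrite /f' (bigD1 (k p))//= eqxx mul1r big1 ?addr0; last first.
    by move=> j /negbTE->; rewrite mul0r.
  have /andP[p0 _] := pB0 p.
  rewrite normrM normfV normr_id ler_pdivlMr//; apply: hk.
  exact: U_r.
have sA : unif_smooth U k (2 * n).+1 (fun (p : P) u => chi (u + 0) * chi (u + sval p)).
  have M2n' : ((2 * n).+1 < M)%N by rewrite -addn1.
  apply: unif_smoothM.
    exact: (@unif_smooth_cutoff _ _ u0 _ rho0 P _ k _ UB _ _ (fun _ : P => 0)).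
  exact: (@unif_smooth_cutoff _ _ u0 _ rho0 P _ k _ UB _ _ (fun p : P => sval p)).
have A0 (p : P) : vanishes_off u0 rho (fun u => chi (u + 0) * chi (u + sval p)).
  by move=> u hu; rewrite addr0 chi_vanishes// mul0r.
have [C hC] := rint_ibp rho0 c0 df sf' f'c sA A0.
exists C => a b h b0 h0 hr.
have L0 : 0 < `|b| * `|h| by rewrite mulr_gt0 ?normr_gt0.
have hp : h != 0 /\ `|h| <= r by [].
have nh : `|h| != 0 by rewrite normr_eq0.
case: (ltgtP 0 b) b0 => // hb _.
- have := hC (exist _ h hp) (`|b| * `|h|) (dot a h) L0.
  congr (`|_| <= _); rewrite /correlation; congr rint; apply/funext => u.
  rewrite /f /= addr0 dotDr (gtr0_norm hb); congr (cos _ * _).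
  by field.
- have := hC (exist _ h hp) (`|b| * `|h|) (- dot a h) L0.
  congr (`|_| <= _); rewrite /correlation; congr rint; apply/funext => u.
  rewrite /f /= addr0 dotDr (ltr0_norm hb) -cosN; congr (cos _ * _).
  by field.
Qed.

End GraphDecay.

Section Differencing.
Context {R : realType} {n : nat}.
Variables (g : 'rV[R]_n -> R) (u0 : 'rV[R]_n) (rho r : R) (M : nat).
Hypotheses (rho0 : 0 < rho) (rho_r : 2 * rho <= r) (M2n : (2 * n + 1 < M)%N).
Implicit Types (u h a : 'rV[R]_n) (b : R).

Notation chi := (cutoff u0 rho M).

Definition grid_shift (q : nat) (al : 'I_n -> nat) : 'rV[R]_n :=
  \row_i ((al i)%:Z%:~R / q%:R).

Variables (a : 'rV[R]_n) (b : R).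
Let psi u := dot a u + b * g u.

Let bdd_trig (trig : R -> R) : (forall x, `|trig x| <= 1) ->
  bdd_suppn (fun u => trig (psi u) * chi u).
Proof. by move=> ht; apply: (bdd_suppn_chi u0 rho0 M2n (F := fun u => trig (psi u))) => u; exact: ht. Qed.

(* Van der Corput differencing: averaging over the shifts before squaring turns
   the oscillatory sum into correlations, whose phases are free of [a]. *)
Lemma differencing (q m : nat) : (0 < q)%N -> (0 < m)%N -> q%:R^-1 <= r ->
  (m%:R ^+ n * rint (fun u => cos (psi u) * chi u)) ^+ 2 <=
  rint (ball_ind u0 (rho + r)) *
  \sum_(al : {ffun 'I_n -> 'I_m}) \sum_(be : {ffun 'I_n -> 'I_m})
    correlation g u0 rho M a b (grid_shift (q * m) (fun i => al i) -
                                grid_shift (q * m) (fun i => be i)).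
Proof.
move=> q0 m0 qr.
have qm0 : (0 < q * m)%N by rewrite muln_gt0 q0.
pose h (al : {ffun 'I_n -> 'I_m}) := grid_shift (q * m) (fun i => al i).
pose F u := cos (psi u) * chi u; pose G u := sin (psi u) * chi u.
have bF : bdd_suppn F by apply: bdd_trig => x; exact: cos_max.
have bG : bdd_suppn G by apply: bdd_trig => x; exact: sin_max.
pose SF u := \sum_al F (u + h al); pose SG u := \sum_al G (u + h al).
have bSF : bdd_suppn SF by apply: bdd_suppn_sum => al; exact: bdd_suppn_shift.
have hr al : `|h al| <= r.
  apply: row_norm_le => [|i]; first by apply: le_trans qr; rewrite invr_ge0.
  rewrite mxE ger0_norm ?divr_ge0 ?ler0n ?ler0z//.
  apply: le_trans qr; rewrite natrM invfM mulrCA ler_piMr ?invr_ge0//.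
  by rewrite ler_pdivrMr ?ltr0n// mul1r ler_nat ltnW.
have SF0 : vanishes_off u0 (rho + r) SF.
  move=> u hu; rewrite /SF big1// => al _; rewrite /F (chi_vanishes rho0 M2n) ?mulr0//.
  have := hr al; have := ler_normB (u + h al - u0) (h al).
  by rewrite addrAC addrK; lra.
have SG0 : vanishes_off u0 (rho + r) SG.
  move=> u hu; rewrite /SG big1// => al _; rewrite /G (chi_vanishes rho0 M2n) ?mulr0//.
  have := hr al; have := ler_normB (u + h al - u0) (h al).
  by rewrite addrAC addrK; lra.
have sq (S : 'rV[R]_n -> R) : bdd_suppn S -> vanishes_off u0 (rho + r) S ->
    bdd_suppn (fun u => S u ^+ 2).
  move=> [N [N' [hN _]]] hS; apply: (@bdd_suppn_ball _ _ u0 (rho + r) (N%:R ^+ 2)).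
    by move=> u _; rewrite normrX ler_pXn2r ?nnegrE.
  by move=> u hu; rewrite hS// expr0n.
have bSF2 := sq _ bSF SF0.
have bSG2 : bdd_suppn (fun u => SG u ^+ 2).
  by apply: sq => //; apply: bdd_suppn_sum => al; exact: bdd_suppn_shift.
have intSF : rint SF = m%:R ^+ n * rint F.
  rewrite /SF rint_sum; last by move=> al; exact: bdd_suppn_shift.
  under eq_bigr do rewrite (rint_shift _ qm0 bF).
  by rewrite sumr_const card_ffun !card_ord -[LHS]mulr_natl natrX.
rewrite -/F -intSF.
apply: (@le_trans _ _ (rint (ball_ind u0 (rho + r)) * rint (fun u => SF u ^+ 2))).
  apply: rint_cauchy_schwarz => //; first exact: bdd_suppn_ball_ind.
    move=> u; rewrite /ball_ind; case: leP => hu; first by rewrite mulr1.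
    by rewrite mulr0 SF0.
  by move=> u; rewrite /ball_ind; case: leP => hu; rewrite ?expr1n ?expr0n.
rewrite ler_wpM2l ?rint_ball_ind_ge0//.
(* Adding the squared sine sum gives a squared modulus, whose cross terms involve only differences
   of phases. *)
apply: (@le_trans _ _ (rint (fun u => SF u ^+ 2 + SG u ^+ 2))).
  by apply: ler_rint => // [|u]; [exact: bdd_suppnD|rewrite lerDl sqr_ge0].
pose D al be u := cos (psi (u + h al) - psi (u + h be)) * (chi (u + h al) * chi (u + h be)).
have DE al be : D al be = (fun u => (fun v => cos (dot a (v + (h al - h be)) + b * g (v + (h al - h be)) -
     (dot a v + b * g v)) * (chi v * chi (v + (h al - h be)))) (u + h be)).
  apply/funext => u; rewrite /D /=.
  have -> : u + h be + (h al - h be) = u + h al by rewrite addrACA subrr addr0.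
  by rewrite /psi [X in _ = _ * X]mulrC.
have bcorr hh : bdd_suppn (fun v => cos (dot a (v + hh) + b * g (v + hh) -
     (dot a v + b * g v)) * (chi v * chi (v + hh))).
  have -> : (fun v => cos (dot a (v + hh) + b * g (v + hh) -
     (dot a v + b * g v)) * (chi v * chi (v + hh))) =
    (fun v => (cos (dot a (v + hh) + b * g (v + hh) -
     (dot a v + b * g v)) * chi (v + hh)) * chi v).
    by apply/funext => v; rewrite mulrAC mulrA.
  apply: (bdd_suppn_chi u0 rho0 M2n) => v.
  by rewrite normrM -[leRHS]mulr1 ler_pM ?cos_max ?norm_chi_le1.
have bD al be : bdd_suppn (D al be).
  by rewrite DE; exact: (bdd_suppn_shift (h be) (bcorr (h al - h be))).
have -> : (fun u => SF u ^+ 2 + SG u ^+ 2) = (fun u => \sum_al \sum_be D al be u).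
  apply/funext => u; rewrite !expr2 /SF /SG !big_distrlr -big_split/=.
  apply: eq_bigr => al _; rewrite -big_split; apply: eq_bigr => be _ /=.
  by rewrite /D /F /G cosB; ring.
rewrite rint_sum; last by move=> al; exact: bdd_suppn_sum.
apply: ler_sum => al _; rewrite rint_sum//; apply: ler_sum => be _.
by rewrite DE (rint_shift _ qm0 (bcorr _)).
Qed.

End Differencing.

Section GraphDecay.
Context {R : realType} {n : nat}.
Variables (g : 'rV[R]_n -> R) (u0 : 'rV[R]_n) (rho r : R) (M : nat).
Hypotheses (sg : smooth g) (rho0 : 0 < rho) (rho_r : 2 * rho <= r) (M2n : (2 * n + 1 < M)%N).
Variable c : R.
Hypothesis c0 : 0 < c.
Hypothesis nondeg : forall h, h != 0 -> `|h| <= r ->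
    exists k, forall u, `|u - u0| <= r ->
      c * `|h| <= `|'D_(coord_vec k) g (u + h) - 'D_(coord_vec k) g u|.
Implicit Types (u h a : 'rV[R]_n) (b : R).

Notation chi := (cutoff u0 rho M).

Lemma grid_shift_diff (q m : nat) (al be : {ffun 'I_n -> 'I_m}) (i : 'I_n) :
  (grid_shift q (fun i => al i) - grid_shift q (fun i => be i) : 'rV[R]_n) 0 i =
  ((al i)%:R - (be i)%:R) / q%:R.
Proof. by rewrite !mxE mulrBl. Qed.

(** About [|b|] shifts per coordinate are used, within a total length [1 / q]. The correlation of
    [al] and [be] is bounded by a constant times the product of the [(1 + (al l - be l) ^ 2)^-1], so
    each row sums to [O(1)], as if only the diagonal counted; with [I] the integral,
    [m ^ (2 * n) * I ^ 2 <= C * m ^ n]. *)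
Lemma stationary_decay : exists2 C : R, 0 < C & forall a b, 1 <= `|b| ->
    rint (fun u => cos (dot a u + b * g u) * chi u) ^+ 2 <= C / `|b| ^+ n.
Proof.
have r0 : 0 < r by apply: lt_le_trans rho_r; rewrite mulr_gt0.
have [C1 hC1] := correlation_decay sg rho0 rho_r M2n c0 nondeg.
have [q hq] := nat_above r^-1.
have q0 : (0 < q)%N.
  by rewrite -(ltr_nat R); apply: lt_trans hq; rewrite invr_gt0.
have qR : 0 < q%:R :> R by rewrite ltr0n.
have qr : q%:R^-1 <= r by rewrite -[r]invrK lef_pV2 ?posrE ?invr_gt0// ltW.
set V := rint (ball_ind u0 rho); have V0 : 0 <= V by exact: rint_ball_ind_ge0.
set V2 := rint (ball_ind u0 (rho + r)); have V20 : 0 <= V2 by exact: rint_ball_ind_ge0.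
pose C2 := V + `|C1| * (2 * q%:R) ^+ (2 * n) * 2 ^+ n.
have C20 : 0 <= C2 by rewrite addr_ge0// !mulr_ge0 ?exprn_ge0 ?mulr_ge0.
exists (V2 * C2 * 6 ^+ n + 1).
  by rewrite ltr_wpDl// !mulr_ge0 ?exprn_ge0.
move=> a b b1.
have bR : 0 < `|b| by apply: lt_le_trans b1.
have b0 : b != 0 by rewrite -normr_gt0.
pose m := (Num.truncn `|b|).+1.
have m0 : (0 < m)%N by [].
have mR : 0 < m%:R :> R by rewrite ltr0n.
have /andP[m1 m2] := truncn_itv (normr_ge0 b).
have m3 : m%:R <= 2 * `|b| by rewrite /m -natr1; lra.
pose h (al : {ffun 'I_n -> 'I_m}) : 'rV[R]_n := grid_shift (q * m) (fun i => al i).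
have corr (al be : {ffun 'I_n -> 'I_m}) : correlation g u0 rho M a b (h al - h be) <=
    C2 * \prod_l (1 + ((al l)%:R - (be l)%:R) ^+ 2)^-1.
  have P0 : 0 <= \prod_l (1 + ((al l)%:R - (be l)%:R) ^+ 2)^-1 :> R.
    by apply: prodr_ge0 => l _; rewrite invr_ge0 addr_ge0// sqr_ge0.
  have [->|ab] := eqVneq al be.
    rewrite big1 ?mulr1; last by move=> l _; rewrite subrr expr0n addr0 invr1.
    apply: le_trans (ler_norm _) _; apply: le_trans (correlation_trivial g u0 rho0 M2n a b _) _.
    by rewrite lerDl !mulr_ge0 ?exprn_ge0 ?mulr_ge0.
  have dE l : (h al - h be) 0 l = ((al l)%:R - (be l)%:R) / (q * m)%:R.
    exact: grid_shift_diff.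
  have qmR : 0 < (q * m)%:R :> R by rewrite ltr0n muln_gt0 q0.
  have [l hl] : exists l, al l != be l.
    apply/existsP; rewrite -negb_forall; apply: contra ab => /forallP e.
    by apply/eqP/ffunP => l; apply/eqP.
  have int1 i : al i != be i -> 1 <= `|(al i)%:R - (be i)%:R| :> R.
    move=> ne; have {}ne : (al i != be i :> nat) by [].
    case: (ltngtP (al i) (be i)) ne => // lt _.
      by rewrite distrC -natrB ?(ltnW lt)// ger0_norm// (ler_nat R 1) subn_gt0.
    by rewrite -natrB ?(ltnW lt)// ger0_norm// (ler_nat R 1) subn_gt0.
  have h0 : h al - h be != 0.
    apply/eqP => e; have := dE l; rewrite e mxE => /esym/eqP.
    rewrite mulf_eq0 invr_eq0 (gt_eqF qmR) orbF => /eqP e'.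
    by have := int1 l hl; rewrite e' normr0 ler10.
  have hle : `|h al - h be| <= r.
    apply: row_norm_le => [|i]; first exact: ltW.
    rewrite dE normrM normfV (gtr0_norm qmR) ler_pdivrMr//.
    apply: (@le_trans _ _ m%:R).
      have h1 : (al i)%:R <= m%:R :> R by rewrite ler_nat ltnW.
      have h2 : (be i)%:R <= m%:R :> R by rewrite ler_nat ltnW.
      have h3 : 0 <= (al i)%:R :> R by []. have h4 : 0 <= (be i)%:R :> R by [].
      by rewrite ler_norml; apply/andP; split; lra.
    have : 1 <= r * q%:R by move: qr; rewrite -[q%:R^-1]mul1r ler_pdivrMr.
    by rewrite natrM mulrA => hh; rewrite -[leLHS]mul1r ler_wpM2r// ltW.
  (* [X] is the sup norm of the integer vector [al - be]. Since [m <= 2 * |b|], [|b|] times the norm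
     of the lag is at least [X / (2 * q)], and since [X >= 1], each [1 + (al l - be l) ^ 2] is at
     most [2 * X ^ 2]. *)
  pose X := `|h al - h be| * (q * m)%:R.
  have Xl i : `|(al i)%:R - (be i)%:R| <= X.
    have := coord_le_norm (h al - h be) i; rewrite dE normrM normfV (gtr0_norm qmR).
    by rewrite ler_pdivrMr.
  have X1 : 1 <= X by apply: le_trans (Xl l); exact: int1.
  apply: le_trans (ler_norm _) _; apply: le_trans (hC1 a b _ b0 h0 hle) _.
  have bX : X / (2 * q%:R) <= `|b| * `|h al - h be|.
    rewrite /X ler_pdivrMr ?mulr_gt0// natrM.
    have -> : `|b| * `|h al - h be| * (2 * q%:R) = `|h al - h be| * (q%:R * (2 * `|b|)) by ring.
    by rewrite ler_wpM2l// ler_wpM2l// ltW.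
  have q2 : 0 < 2 * q%:R :> R by rewrite mulr_gt0.
  have X0 : 0 < X by apply: lt_le_trans X1.
  clearbody X.
  apply: (@le_trans _ _ (`|C1| * (2 * q%:R) ^+ (2 * n) / X ^+ (2 * n))).
    apply: (@le_trans _ _ (`|C1| / (X / (2 * q%:R)) ^+ (2 * n))).
      apply: (@le_trans _ _ (`|C1| / (`|b| * `|h al - h be|) ^+ (2 * n))).
        by rewrite ler_wpM2r ?ler_norm// invr_ge0 exprn_ge0// mulr_ge0.
      rewrite ler_wpM2l// lef_pV2 ?posrE ?exprn_gt0 ?divr_gt0 ?mulr_gt0 ?normr_gt0//.
      by rewrite lerXn2r ?nnegrE ?divr_ge0 ?mulr_ge0 ?(ltW X0) ?(ltW q2).
    rewrite expr_div_n invf_div mulrA le_eqVlt; apply/orP; left.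
    by rewrite eqxx.
  have -> : `|C1| * (2 * q%:R) ^+ (2 * n) / X ^+ (2 * n) =
     (`|C1| * (2 * q%:R) ^+ (2 * n) * 2 ^+ n) * (2 ^- n / X ^+ (2 * n)).
    by field; rewrite !expf_neq0// ?gt_eqF// .
  have K0 : 0 <= `|C1| * (2 * q%:R) ^+ (2 * n) * 2 ^+ n.
    by rewrite !mulr_ge0 ?exprn_ge0 ?mulr_ge0.
  apply: (@le_trans _ _ (`|C1| * (2 * q%:R) ^+ (2 * n) * 2 ^+ n *
     \prod_l (1 + ((al l)%:R - (be l)%:R) ^+ 2)^-1)); last by rewrite ler_wpM2r// lerDr.
  rewrite ler_wpM2l// exprM -exprVn -exprVn -exprMn -[n in leLHS]card_ord -prodr_const.
  apply: ler_prod => i _; rewrite mulr_ge0 ?invr_ge0 ?sqr_ge0//=.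
  rewrite -invfM lef_pV2 ?posrE ?mulr_gt0 ?exprn_gt0//; last by rewrite ltr_pwDl// sqr_ge0.
  have := Xl i; rewrite -[((al i)%:R - _) ^+ 2]real_normK ?num_real// => hi.
  have : `|(al i)%:R - (be i)%:R| ^+ 2 <= X ^+ 2 by rewrite lerXn2r ?nnegrE ?(ltW X0).
  have : 1 <= X ^+ 2 by rewrite exprn_ege1.
  lra.
have D := differencing g u0 rho0 M2n a b q0 m0 qr.
set I := rint _ in D *.
have up : (m%:R ^+ n * I) ^+ 2 <= V2 * (m%:R ^+ n * (C2 * 6 ^+ n)).
  apply: le_trans D _; rewrite ler_wpM2l//.
  apply: (@le_trans _ _ (\sum_(al : {ffun 'I_n -> 'I_m}) C2 * 6 ^+ n)); last first.
    by rewrite sumr_const card_ffun !card_ord -[leLHS]mulr_natl natrX.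
  apply: ler_sum => al _.
  apply: (@le_trans _ _ (\sum_(be : {ffun 'I_n -> 'I_m})
     C2 * \prod_l (1 + ((al l)%:R - (be l)%:R) ^+ 2)^-1)).
    by apply: ler_sum => be _; exact: corr.
  rewrite -mulr_sumr ler_wpM2l//.
  have := bigA_distr_bigA (fun (l : 'I_n) (k : 'I_m) => (1 + ((al l)%:R - k%:R) ^+ 2)^-1 : R).
  move=> /= <-; rewrite -[n in leRHS]card_ord -prodr_const; apply: ler_prod => l _.
  rewrite sumr_ge0 => [|k _]; last by rewrite invr_ge0 addr_ge0// sqr_ge0.
  apply: le_trans (sum_inv_sqr_le m (al l)).
  by apply: ler_sum => k _; rewrite -sqrrN opprB.
have mn : 0 < m%:R ^+ n :> R by rewrite exprn_gt0.
have : I ^+ 2 <= V2 * C2 * 6 ^+ n / m%:R ^+ n.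
  rewrite ler_pdivlMr//.
  move: up; rewrite exprMn expr2 -mulrA [V2 * _]mulrCA ler_pM2l// => up.
  by rewrite mulrC -!mulrA.
move=> H; apply: le_trans H _.
apply: ler_pM; rewrite ?invr_ge0 ?(ltW mn)//.
- by rewrite !mulr_ge0 ?exprn_ge0.
- by rewrite lerDl.
- by rewrite lef_pV2 ?posrE ?exprn_gt0// lerXn2r ?nnegrE// ltW.
Qed.

End GraphDecay.

Section GraphFunctional.
Context {R : realType} {n : nat}.
Variables (g : 'rV[R]_n -> R) (u0 : 'rV[R]_n).
Hypothesis sg : smooth g.

Notation M := (2 * n + 2)%N.

(** Three regimes: bounded frequencies are trivial; for [|b| <= kap * |a|] the nonstationary bound
    gives even the exponent [n]; otherwise [|b|] is comparable to the maximum, and the square root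
    of the stationary bound gives [n / 2]. *)
Lemma graph_decay : hessian g u0 \in unitmx ->
  exists2 rho : R, 0 < rho & exists C : R, forall (a : 'rV[R]_n) (b : R),
    (Num.max `|a| `|b|) `^ (n%:R / 2) *
      `|rint (fun u => cos (dot a u + b * g u) * cutoff u0 rho M u)| <= C.
Proof.
move=> /(hessian_expansion sg)[c c0 [r r0 nondeg]].
pose rho := r / 2; have rho0 : 0 < rho by rewrite divr_gt0.
have rho_r : 2 * rho <= r by rewrite /rho; lra.
have M2n : (2 * n + 1 < M)%N by rewrite ltn_add2l.
exists rho => //.
have [kap /andP[k0 k1] [C1 hC1]] := nonstationary_decay u0 sg rho0 rho_r M2n.
have [C2 C20 hC2] := stationary_decay sg rho0 rho_r M2n c0 nondeg.
set V := rint (ball_ind u0 rho); have V0 : 0 <= V by exact: rint_ball_ind_ge0.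
have K0 : 0 < kap `^ (n%:R / 2) by rewrite powR_gt0.
have hn : 0 <= n%:R / 2 :> R by rewrite divr_ge0.
pose C := V + `|C1| + (kap `^ (n%:R / 2))^-1 * (Num.sqrt C2 + V).
exists C => a b; set I := `|rint _|.
have IV : I <= V by apply: (norm_rint_chi u0 rho0 M2n) => u; exact: cos_max.
have K1 : 0 <= (kap `^ (n%:R / 2))^-1 * (Num.sqrt C2 + V).
  by rewrite mulr_ge0 ?invr_ge0 ?addr_ge0 ?sqrtr_ge0// ltW.
have Z0 : 0 <= Num.max `|a| `|b| by rewrite le_max normr_ge0.
have [Z1|Z1] := leP (Num.max `|a| `|b|) 1.
  apply: (@le_trans _ _ (1 * V)).
    apply: ler_pM; rewrite ?powR_ge0 ?normr_ge0//.
    have E1 : 1 `^ (n%:R / 2) = 1 :> R by rewrite powR1.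
    by rewrite -[leRHS]E1 ge0_ler_powR// nnegrE.
  by rewrite mul1r /C -addrA lerDl addr_ge0.
have [hb|hb] := leP `|b| (kap * `|a|).
  have ba : `|b| <= `|a| by apply: le_trans hb _; rewrite ler_piMl.
  move: Z1; rewrite (max_l ba) => a1.
  have ap : 0 < `|a| by apply: lt_trans a1.
  have a0 : a != 0 by rewrite -normr_gt0.
  have h := hC1 a b a0 hb; rewrite -/I in h.
  apply: (@le_trans _ _ (`|a| ^+ n * (C1 / `|a| ^+ n))).
    apply: ler_pM; rewrite ?powR_ge0 ?normr_ge0//.
    rewrite -powR_mulrn// ler_powR// ?(ltW a1)//.
    by rewrite ler_pdivrMr// ler_peMr// ler1n.
  rewrite mulrCA mulfV ?mulr1 ?expf_neq0 ?gt_eqF//.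
  rewrite /C; have := ler_norm C1; lra.
have Zb : Num.max `|a| `|b| <= `|b| / kap.
  rewrite ge_max ler_pdivlMr// mulrC (ltW hb)/=.
  by rewrite ler_pdivlMr// ler_piMr.
apply: (@le_trans _ _ ((kap `^ (n%:R / 2))^-1 * (`|b| `^ (n%:R / 2) * I))).
  rewrite mulrA ler_wpM2r ?normr_ge0//.
  have -> : (kap `^ (n%:R / 2))^-1 * `|b| `^ (n%:R / 2) = (`|b| / kap) `^ (n%:R / 2).
    rewrite powRM ?invr_ge0 ?(ltW k0)// mulrC; congr (_ * _).
    by rewrite -(powR_inv1 (ltW k0)) -powRrM mulN1r powRN.
  by rewrite ge0_ler_powR// nnegrE// divr_ge0// ltW.
apply: (@le_trans _ _ ((kap `^ (n%:R / 2))^-1 * (Num.sqrt C2 + V))); last first.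
  by rewrite /C lerDr addr_ge0.
rewrite ler_wpM2l ?invr_ge0 ?(ltW K0)//.
have [b1|b1] := leP 1 `|b|; last first.
  apply: (@le_trans _ _ (1 * V)); last by rewrite mul1r lerDr sqrtr_ge0.
  apply: ler_pM; rewrite ?powR_ge0 ?normr_ge0//.
  have E1 : 1 `^ (n%:R / 2) = 1 :> R by rewrite powR1.
    by rewrite -[leRHS]E1 ge0_ler_powR ?nnegrE// ltW.
have bp : 0 < `|b| by apply: lt_le_trans b1.
apply: (@le_trans _ _ (Num.sqrt C2)); last by rewrite lerDl.
have := hC2 a b b1; rewrite -[X in X <= _]real_normK ?num_real// -/I => h.
have I0 : 0 <= I by exact: normr_ge0.
rewrite -(ler_pXn2r (n := 2)) ?nnegrE ?sqrtr_ge0 ?mulr_ge0 ?powR_ge0//.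
rewrite sqr_sqrtr ?(ltW C20)// exprMn -powR_mulrn ?powR_ge0// -powRrM divfK//.
by rewrite powR_mulrn// mulrC -ler_pdivlMr ?exprn_gt0.
Qed.

End GraphFunctional.

(** * Graph charts and their curvature *)

Section ChartCalculus.
Context {R : realType} {d : nat}.
Variables (i : 'I_d) (g : 'rV[R]_d.-1 -> R).
Implicit Types (u v : 'rV[R]_d.-1).

Lemma dot_graph_chart (zeta : 'rV[R]_d) u :
  dot zeta (graph_chart i g u) = dot (col' i zeta) u + zeta 0 i * g u.
Proof.
rewrite /dot (bigD1_ord i)//= !mxE unlift_none addrC; congr (_ + _).
by apply: eq_bigr => k _; rewrite !mxE liftK.
Qed.

Lemma norm_le_max_chart (zeta : 'rV[R]_d) :
  `|zeta| <= Num.max `|col' i zeta| `|zeta 0 i|.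
Proof.
apply: row_norm_le => [|j]; first by rewrite le_max normr_ge0.
case: (unliftP i j) => [k ->|->]; last by rewrite le_max lexx orbT.
rewrite le_max; apply/orP; left.
by have := coord_le_norm (col' i zeta) k; rewrite mxE.
Qed.

Lemma derive_affine (W : normedModType R) (L : 'rV[R]_d.-1 -> W) (l e : W)
    (phi : 'rV[R]_d.-1 -> R) u v : derivable phi u v ->
  (forall h : R, L (h *: v + u) - L u = h *: l) ->
  'D_v (fun w => L w + phi w *: e) u = l + 'D_v phi u *: e.
Proof.
move=> dphi hL; apply: cvg_lim => //.
have key : (fun h : R => l + (h^-1 *: ((phi \o shift u) (h *: v) - phi u)) *: e) @ 0^' -->
    l + 'D_v phi u *: e.
  by apply: cvgD; [exact: cvg_cst|apply: cvgZr_tmp].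
apply: cvg_trans key; apply: near_eq_cvg.
near=> h.
have h0 : h != 0 by near: h; exact: nbhs_dnbhs_neq.
rewrite /= opprD addrACA hL [RHS]scalerDr scalerA mulVf// scale1r; congr (_ + _).
by rewrite -scalerBl scalerA.
Unshelve. all: by end_near. Qed.

(** The chart is linear plus [g] times the [i]-th basis vector, so its second derivatives all point
    along that vector. *)
Lemma second_form_graph u : smooth g ->
  second_form (graph_chart i g) u =
  unit_normal (graph_chart i g) u 0 i *: hessian g u.
Proof.
move=> sg; apply/matrixP => a b; rewrite !mxE.
pose e : 'rV[R]_d := delta_mx 0 i.
pose L (w : 'rV[R]_d.-1) : 'rV[R]_d := graph_chart i (fun=> 0) w.
have Llin (h : R) v w : L (h *: v + w) - L w = h *: L v.
  apply/rowP => j; rewrite !mxE; case: (unlift i j) => [k|].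
    by rewrite !mxE addrK.
  by rewrite subrr mulr0.
have XE (phi : 'rV[R]_d.-1 -> R) w : graph_chart i phi w = L w + phi w *: e.
  apply/rowP => j; rewrite !mxE/=; case: (unliftP i j) => [k ->|->].
    by rewrite eq_sym (negbTE (neq_lift i k)) mulr0 addr0.
  by rewrite add0r eqxx mulr1.
have X1 w : 'D_(delta_mx 0 b) (graph_chart i g) w =
    L (delta_mx 0 b) + 'D_(delta_mx 0 b) g w *: e.
  have -> : graph_chart i g = fun w => L w + g w *: e by apply/funext => x; exact: XE.
  apply: derive_affine => //.
  by apply: diff_derivable; exact: smooth_differentiable.
have -> : (fun w => 'D_(delta_mx 0 b) (graph_chart i g) w) =
    (fun w => L (delta_mx 0 b) + 'D_(delta_mx 0 b) g w *: e).
  by apply/funext => w; exact: X1.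
rewrite (@derive_affine _ (fun=> L (delta_mx 0 b)) 0); last 2 first.
- by apply: diff_derivable; apply: smooth_differentiable; exact: smooth_derive.
- by move=> h; rewrite subrr scaler0.
rewrite add0r dotZl mulrC; congr (_ * _).
rewrite /dot (bigD1 i)//= !mxE !eqxx mul1r big1 ?addr0// => j ji.
by rewrite !mxE/= (negbTE ji) mul0r.
Qed.

(** A singular Hessian makes the second form singular, and the quotient defining the curvature then
    vanishes whatever its denominator. *)
Lemma curvature_hessian u : smooth g ->
  gauss_curvature (graph_chart i g) u != 0 -> hessian g u \in unitmx.
Proof.
move=> sg; rewrite /gauss_curvature second_form_graph// detZ unitmxE unitfE.
by apply: contra => /eqP->; rewrite mulr0 mul0r.
Qed.

End ChartCalculus.

Section SmoothLocalDecay.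
Context {R : realType} {d : nat}.

(** The functional integrates over the chart parameter with a cutoff, not over surface area: decay
    follows directly from [graph_decay], and the mass of small balls is read off in the parameter,
    where the chart is Lipschitz. *)
Lemma smooth_local_decay (S : set 'rV[R]_d) p : smooth_hypersurface S ->
  nonvanishing_curvature S -> S p ->
  exists2 e : R, 0 < e & exists sigma,
    decay_functional (d.-1%:R / 2) (S `&` ball p e) sigma.
Proof.
move=> hS hcurv Sp; have [i [g sgn]] := hS p Sp.
have [sg near_S] := sgn.
pose n := d.-1; pose u0 : 'rV[R]_n := col' i p.
have hu : hessian g u0 \in unitmx by apply: curvature_hessian => //; exact: hcurv sgn.
have [rho rho0 [C hC]] := graph_decay sg hu.
pose M := (2 * n + 2)%N.
have M2n : (2 * n + 1 < M)%N by rewrite ltn_add2l.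
pose X := graph_chart i g; pose chi := cutoff u0 rho M.
pose sigma (f : 'rV[R]_d -> R) := rint (fun u => f (X u) * chi u).
have bchi (f : 'rV[R]_d -> R) : bounded_fn f -> bdd_suppn (fun u => f (X u) * chi u).
  move=> [N hN]; apply: (@bdd_suppn_ball _ _ u0 rho N).
    move=> u _; rewrite normrM -[leRHS]mulr1 ler_pM//.
    by rewrite ger0_norm ?cutoff_ge0// cutoff_le1.
  by apply: vanishes_offM; exact: chi_vanishes.
have [e1 e10 he1] : exists2 e : R, 0 < e & forall x, `|x - p| < e ->
    (S x <-> x = X (col' i x)).
  move: near_S => /nbhs_ballP[e /= e0 he]; exists e => // x hx.
  by apply: he; rewrite ball_rowE /= distrC.
pose B := `|u0| + rho + 1.
have [L L0 hL] := smooth_lipschitz B sg.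
pose e := Num.min e1 (rho / 4).
have e0 : 0 < e by rewrite lt_min e10 divr_gt0.
exists e => //; exists sigma.
have colle (x y : 'rV[R]_d) : `|col' i x - col' i y| <= `|x - y|.
  by apply: row_norm_le => // k; have := coord_le_norm (x - y) (lift i k); rewrite !mxE.
split.
- move=> a f f' bf bf'; rewrite /sigma -rint_lin; [|exact: bchi|exact: bchi].
  by congr rint; apply/funext => u; rewrite mulrDl mulrA.
- move=> f bf f0; apply: rint_ge0; first exact: bchi.
  by move=> u; rewrite mulr_ge0// cutoff_ge0.
- exists C => zeta; apply: le_trans (hC (col' i zeta) (zeta 0 i)).
  have -> : sigma (fun p => cos (dot zeta p)) =
     rint (fun u => cos (dot (col' i zeta) u + zeta 0 i * g u) * chi u).
    by congr rint; apply/funext => u; rewrite dot_graph_chart.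
  rewrite ler_wpM2r// ge0_ler_powR ?norm_le_max_chart ?nnegrE ?divr_ge0//.
(* The parameter cube of half-side [c1 * r] about the projection of [q] has to be mapped into the
   ball of radius [r], hence [1] and [(1 + L)^-1], and to stay where [cutoff_lower] applies, hence
   [rho / 4]. *)
pose c1 := Num.min (Num.min 1 (rho / 4)) (1 + L)^-1.
have L1 : 0 < 1 + L by rewrite addr_gt0.
have c10 : 0 < c1 by rewrite !lt_min ltr01 divr_gt0// invr_gt0.
have [c1a c1b c1c] : [/\ c1 <= 1, c1 <= rho / 4 & c1 <= (1 + L)^-1].
  by rewrite /c1 !ge_min !lexx ?orbT.
exists (2^-1 ^+ (M * n) * c1 ^+ n); first by rewrite mulr_gt0 ?exprn_gt0 ?invr_gt0.
move=> q r f [Sq qp] /andP[r0 r1] bf f0 f1.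
move: qp; rewrite ball_rowE /= distrC lt_min => /andP[qe1 qrho].
have qX : q = X (col' i q) by apply/(he1 q).
set uq : 'rV[R]_n := col' i q in qX.
have uq0 : `|uq - u0| < rho / 4 by apply: le_lt_trans qrho; exact: colle.
pose s := c1 * r; have s0 : 0 < s by rewrite mulr_gt0.
have s1 : s <= c1 by rewrite /s ler_piMr// ltW.
have uB : `|uq| <= B.
  have := ler_normD (uq - u0) u0; rewrite subrK /B => h; apply: le_trans h _; lra.
have chart_close u : `|u - uq| <= s -> `|X u - q| <= r.
  move=> hus; rewrite qX; apply: row_norm_le => [|j]; first exact: ltW.
  have sr : s <= r by rewrite /s ler_piMl// ltW.
  rewrite !mxE; case: (unlift i j) => [k|].
    apply: le_trans sr; apply: le_trans hus.
    by have := coord_le_norm (u - uq) k; rewrite !mxE.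
  have := hL uq (u - uq) uB; rewrite [uq + _]addrC subrK => h.
  have hB : `|u - uq| <= B.
    apply: le_trans hus _; apply: le_trans s1 _; rewrite /B.
    by have := normr_ge0 u0; lra.
  apply: le_trans (h hB) _; apply: (@le_trans _ _ (L * s)); first by rewrite ler_pM2l.
  rewrite /s mulrA ler_piMl ?(ltW r0)//.
  have : L * c1 <= L * (1 + L)^-1 by rewrite ler_pM2l.
  move=> h2; apply: le_trans h2 _; rewrite ler_pdivrMr// mul1r; lra.
pose ind (l : 'I_n) (x : R) : R := if `|x - uq 0 l| <= s then 1 else 0.
have bind l : bdd_supp (ind l).
  have [N hN] := nat_above (`|uq 0 l| + s).
  exists 1%N, N; split => [x|x hx]; first by rewrite /ind; case: ifP; rewrite ?normr1 ?normr0.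
  rewrite /ind; case: leP => // h; exfalso.
  by have := ler_normD (x - uq 0 l) (uq 0 l); rewrite subrK; lra.
have indge l : s <= riemann (ind l).
  have -> : s = ((uq 0 l + s) - (uq 0 l - s)) / 2 by field.
  apply: riemann_lower => //; first by lra.
    by move=> x; rewrite /ind; case: ifP.
  move=> x /andP[h1 h2]; rewrite /ind ifT// ler_norml; apply/andP; split; lra.
have bprod : bdd_suppn (fun u : 'rV[R]_n => \prod_l ind l (u 0 l)).
  apply: (@bdd_suppn_ball _ _ uq s 1) => u hu'.
    rewrite ger0_norm; last by apply: prodr_ge0 => l _; rewrite /ind; case: ifP.
    by apply: prodr_ile1 => l _; rewrite /ind; case: ifP; rewrite ?lexx ?ler01.
  have [|l hl] := @row_norm_attained _ _ (u - uq); first by rewrite -normr_gt0 (lt_trans s0).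
  rewrite (bigD1 l)//= /ind leNgt.
  by move: hu'; rewrite hl !mxE => ->; rewrite mul0r.
apply: (@le_trans _ _ (rint (fun u => 2^-1 ^+ (M * n) * \prod_l ind l (u 0 l)))).
  rewrite rintZ// rint_prod// -mulrA ler_pM2l ?exprn_gt0 ?invr_gt0//.
  rewrite -exprMn -/s -[X in s ^+ X](card_ord n) -prodr_const.
  by apply: ler_prod => l _; rewrite (ltW s0) indge.
apply: ler_rint; [exact: bdd_suppnZ|exact: bchi|move=> u].
have [hus|hus] := leP `|u - uq| s.
  apply: (@le_trans _ _ (chi u)).
    rewrite big1 ?mulr1; last first.
      move=> l _; rewrite /ind ifT//; apply: le_trans hus.
      by have := coord_le_norm (u - uq) l; rewrite !mxE.
    apply: cutoff_lower => //.
    have := ler_normD (u - uq) (uq - u0); rewrite addrA subrK => h.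
    apply: le_trans h _; lra.
  by rewrite ler_peMl ?cutoff_ge0// f1// chart_close.
rewrite (_ : \prod_l _ = 0) ?mulr0 ?mulr_ge0 ?cutoff_ge0//.
have [|l hl] := @row_norm_attained _ _ (u - uq); first by rewrite -normr_gt0 (lt_trans s0).
rewrite (bigD1 l)//= /ind leNgt.
by move: hus; rewrite hl !mxE => ->; rewrite mul0r.
Qed.

End SmoothLocalDecay.

(** * Decay under the chord condition *)

Section VanDerCorput.
Context {R : realType}.
Implicit Types (psi c S : nat -> R).

Lemma sin_increment (x h : R) : `|h| <= 1 ->
  `|sin (x + h) - sin x - h * cos x| <= h ^+ 2.
Proof.
move=> h1.
have c1 (z : R) : `|cos z - 1| <= z ^+ 2 / 2.
  rewrite distrC ger0_norm ?subr_ge0 ?cos_le1//.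
  by have := cos_ge_sqr z; lra.
have s1 : `|sin h - h| <= h ^+ 2 / 2.
  clear x; wlog h0 : h h1 / 0 < h.
    move=> H; have [h0|h0|->] := ltgtP h 0.
    - have := H (- h); rewrite sinN -opprD !normrN sqrrN; apply => //; lra.
    - exact: H.
    - by rewrite sin0 subrr normr0 expr0n mul0r.
  have [z /andP[z0 zh] ->] := sin_mvt h0.
  rewrite -[X in _ - X]mul1r -mulrBl normrM (gtr0_norm h0).
  move: h1; rewrite (gtr0_norm h0) => h1.
  have zz : z ^+ 2 <= h ^+ 2 by rewrite ler_pXn2r ?nnegrE// ltW.
  apply: (@le_trans _ _ (h ^+ 2 / 2 * 1)); last by rewrite mulr1.
  apply: ler_pM => //; first exact: ltW.
  by apply: (le_trans (c1 z)); rewrite ler_pM2r ?invr_gt0.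
have -> : sin (x + h) - sin x - h * cos x =
    sin x * (cos h - 1) + cos x * (sin h - h) by rewrite sinD; ring.
apply: le_trans (ler_normD _ _) _; rewrite !normrM.
have h2 : 0 <= h ^+ 2 / 2 by rewrite divr_ge0// sqr_ge0.
have : `|sin x| * `|cos h - 1| <= 1 * (h ^+ 2 / 2) by rewrite ler_pM// sin_max.
have : `|cos x| * `|sin h - h| <= 1 * (h ^+ 2 / 2) by rewrite ler_pM// cos_max.
lra.
Qed.

Lemma abel_nondecreasing S c (C : R) n : (forall k, `|S k| <= 1) ->
  (forall k, (k < n)%N -> 0 <= c k <= C) ->
  (forall k, (k.+1 < n)%N -> c k <= c k.+1) -> 0 <= C ->
  `|\sum_(k < n) c k * (S k.+1 - S k)| <= 2 * C.
Proof.
move=> S1 c0 cn C0; case: n c0 cn => [|n] c0 cn.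
  by rewrite big_ord0 normr0; lra.
have key m : (m <= n)%N ->
    `|\sum_(k < m.+1) c k * (S k.+1 - S k) - c m * S m.+1| <= c m.
  elim: m => [|m IH] hm.
    rewrite big_ord1 mulrBr addrAC subrr add0r normrN normrM.
    by have /andP[c00 _] := c0 0%N isT; rewrite ger0_norm// ler_piMr.
  rewrite big_ord_recr/=.
  set T := \sum_(k < m.+1) _ in IH *.
  have -> : T + c m.+1 * (S m.+2 - S m.+1) - c m.+1 * S m.+2 =
    (T - c m * S m.+1) - (c m.+1 - c m) * S m.+1 by ring.
  apply: le_trans (ler_normB _ _) _.
  have cc := cn m hm; rewrite normrM (ger0_norm (x := c m.+1 - c m)) ?subr_ge0//.
  have : (c m.+1 - c m) * `|S m.+1| <= c m.+1 - c m by rewrite ler_piMr// subr_ge0.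
  by have := IH (ltnW hm); lra.
have /andP[cn0 cnC] := c0 n (leqnn _).
have := key n (leqnn _); set T := \sum_(k < n.+1) _ => h.
have : `|c n * S n.+1| <= c n by rewrite normrM ger0_norm// ler_piMr.
have := ler_normD (T - c n * S n.+1) (c n * S n.+1); rewrite subrK; lra.
Qed.

Lemma abel_monotone S c (C : R) n : (forall k, `|S k| <= 1) ->
  (forall k, (k < n)%N -> 0 <= c k <= C) ->
  (forall k, (k.+1 < n)%N -> c k <= c k.+1) \/
    (forall k, (k.+1 < n)%N -> c k.+1 <= c k) -> 0 <= C ->
  `|\sum_(k < n) c k * (S k.+1 - S k)| <= 4 * C.
Proof.
move=> S1 c0 [cn|cn] C0.
  by apply: le_trans (abel_nondecreasing S1 c0 cn C0) _; lra.
have h : `|\sum_(k < n) (C - c k) * (S k.+1 - S k)| <= 2 * C.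
  apply: (abel_nondecreasing (c := fun k => C - c k)) => //.
    by move=> k /c0/andP[? ?]; apply/andP; split; lra.
  by move=> k /cn ?; lra.
have E : \sum_(k < n) c k * (S k.+1 - S k) =
    C * (S n - S 0%N) - \sum_(k < n) (C - c k) * (S k.+1 - S k).
  have -> : S n - S 0%N = \sum_(k < n) (S k.+1 - S k).
    by rewrite -(big_mkord xpredT (fun k => S k.+1 - S k)) telescope_sumr.
  by rewrite mulr_sumr -sumrB; apply: eq_bigr => k _; ring.
rewrite E; apply: le_trans (ler_normB _ _) _.
have : `|C * (S n - S 0%N)| <= 2 * C.
  rewrite normrM (ger0_norm C0) mulrC ler_wpM2r//.
  by apply: le_trans (ler_normB _ _) _; have := S1 n; have := S1 0%N; lra.
lra.
Qed.

(* On a run where the increments stay above [nu], [cos (psi k)] is the increment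
   of [sin \o psi] divided by that of [psi], up to an error [D]; summation by
   parts applies because the weights are monotone. *)
Lemma sum_cos_run psi n (nu D : R) : 0 < nu -> D <= 1 ->
  (forall k, (k < n)%N -> nu <= psi k.+1 - psi k <= D) ->
  (forall k, (k.+1 < n)%N -> psi k.+2 - psi k.+1 <= psi k.+1 - psi k) \/
    (forall k, (k.+1 < n)%N -> psi k.+1 - psi k <= psi k.+2 - psi k.+1) ->
  `|\sum_(k < n) cos (psi k)| <= 4 / nu + n%:R * D.
Proof.
move=> nu0 D1 hd mono; pose c k := (psi k.+1 - psi k)^-1.
have d0 k : (k < n)%N -> 0 < psi k.+1 - psi k.
  by move=> /hd/andP[h _]; apply: lt_le_trans h.
have A : `|\sum_(k < n) c k * (sin (psi k.+1) - sin (psi k))| <= 4 * nu^-1.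
  apply: (abel_monotone (S := fun k => sin (psi k))) => //.
  - by move=> k; exact: sin_max.
  - move=> k kn; rewrite invr_ge0 (ltW (d0 _ kn))/= lef_pV2 ?posrE ?d0//.
    by have /andP[] := hd k kn.
  - case: mono => h; [left|right] => k kn; rewrite lef_pV2 ?posrE ?d0 ?h//; exact: ltnW.
  - by rewrite invr_ge0 ltW.
have B : `|\sum_(k < n) (cos (psi k) - c k * (sin (psi k.+1) - sin (psi k)))| <= n%:R * D.
  apply: le_trans (ler_norm_sum _ _ _) _.
  apply: (@le_trans _ _ (\sum_(k < n) D)); last by rewrite sumr_const card_ord mulr_natl.
  apply: ler_sum => k _; have kn := ltn_ord k; have dk := d0 k kn.
  have /andP[_ hD] := hd k kn.
  have := @sin_increment (psi k) (psi k.+1 - psi k).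
  rewrite (gtr0_norm dk) [psi k + _]addrC subrK => /(_ (le_trans hD D1)).
  set s := sin _ - _; move: dk hD; rewrite /c; set u := psi k.+1 - psi k => u0 uD h.
  have -> : cos (psi k) - u^-1 * s = - (u^-1 * (s - u * cos (psi k))).
    by field; rewrite gt_eqF.
  rewrite normrN normrM gtr0_norm ?invr_gt0// ler_pdivrMl//.
  by apply: le_trans h _; rewrite expr2 ler_pM2l.
have -> : \sum_(k < n) cos (psi k) =
  \sum_(k < n) c k * (sin (psi k.+1) - sin (psi k)) +
  \sum_(k < n) (cos (psi k) - c k * (sin (psi k.+1) - sin (psi k))).
  by rewrite -big_split; apply: eq_bigr => k _ /=; rewrite addrC subrK.
by apply: le_trans (ler_normD _ _) _; lra.
Qed.

Lemma antitone_threshold (P : pred nat) n :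
  (forall k l, (k <= l)%N -> (l < n)%N -> P l -> P k) ->
  exists2 i, (i <= n)%N & forall k, (k < n)%N -> P k = (k < i)%N.
Proof.
elim: n => [|n IH] h; first by exists 0%N.
have [|i iin hi] := IH; first by move=> k l kl /ltnW; exact: h.
case: (boolP (P n)) => Pn.
  exists n.+1 => // k kn; rewrite kn; exact: h Pn.
move: iin; rewrite leq_eqVlt => /orP[/eqP ei|iltn].
  exists n => // k; rewrite ltnS leq_eqVlt => /orP[/eqP->|kn].
    by rewrite ltnn (negbTE Pn).
  by rewrite hi// ei.
exists i; first exact/ltnW/ltnW.
move=> k; rewrite ltnS leq_eqVlt => /orP[/eqP->|/hi//].
by rewrite (negbTE Pn) ltnNge (ltnW iltn).
Qed.

(** The increments of a concave phase decrease, so they are first at least [nu], then between [- nu]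
    and [nu], then at most [- nu]. The outer runs cost [4 / nu] each by [sum_cos_run]; the middle
    one has at most [B + 1] terms, each bounded by [1]. *)
Lemma sum_cos_concave psi n (nu D B : R) : 0 < nu -> D <= 1 ->
  (forall k, (k < n)%N -> `|psi k.+1 - psi k| <= D) ->
  (forall k l, (k <= l)%N -> (l < n)%N ->
     psi l.+1 - psi l <= psi k.+1 - psi k) ->
  (forall k l, (k <= l)%N -> (l < n)%N ->
     psi k.+1 - psi k < nu -> - nu < psi l.+1 - psi l -> (l - k)%N%:R <= B) ->
  0 <= B ->
  `|\sum_(k < n) cos (psi k)| <= 8 / nu + n%:R * D + B + 1.
Proof.
move=> nu0 D1 hD mono mid B0.
have [|i iin hi] := @antitone_threshold (fun k => nu <= psi k.+1 - psi k) n.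
  by move=> k l kl ln /le_trans; apply; exact: mono.
have [|j jn hj] := @antitone_threshold (fun k => - nu < psi k.+1 - psi k) n.
  by move=> k l kl ln /lt_le_trans; apply; exact: mono.
have ij : (i <= j)%N.
  rewrite leqNgt; apply/negP => ji.
  have jn' : (j < n)%N := leq_trans ji iin.
  have := hi j jn'; have := hj j jn'; rewrite ji ltnn; lra.
have S1 : `|\sum_(0 <= k < i) cos (psi k)| <= 4 / nu + i%:R * D.
  rewrite big_mkord; apply: sum_cos_run => // [k ki|].
    have kn : (k < n)%N by apply: leq_trans iin.
    by rewrite hi// ki (le_trans _ (hD k kn))// ler_norm.
  by left => k ki; apply: mono => //; exact: leq_trans iin.
have S2 : `|\sum_(i <= k < j) cos (psi k)| <= B + 1.
  apply: le_trans (ler_norm_sum _ _ _) _.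
  apply: (@le_trans _ _ (\sum_(i <= k < j) 1)).
    by apply: ler_sum => k _; exact: cos_max.
  rewrite sumr_const_nat; case: (ltnP i j) => [ltij|]; last first.
    by rewrite -subn_eq0 => /eqP->; rewrite mulr0n addr_ge0.
  have h : (j.-1 - i)%N%:R <= B.
    have jn' : (j.-1 < n)%N by lia.
    apply: mid => //; first lia.
      by rewrite ltNge hi ?ltnn//; lia.
    by rewrite hj//; lia.
  have -> : (j - i = (j.-1 - i).+1)%N by lia.
  by rewrite -natr1 lerD2r.
have S3 : `|\sum_(j <= k < n) cos (psi k)| <= 4 / nu + (n - j)%N%:R * D.
  rewrite -{1}(add0n j) big_addn big_mkord.
  under eq_bigr do rewrite -cosN.
  apply: (sum_cos_run (psi := fun k => - psi (k + j)%N)) => // [k kn|].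
    have kj : (k + j < n)%N by lia.
    have := hj _ kj; have := hD _ kj; rewrite ltnNge leq_addl/= => h1 /negbT.
    rewrite -leNgt addSn => h2; apply/andP; split; first by lra.
    by apply: le_trans h1; rewrite -normrN opprB; apply: le_trans (ler_norm _); lra.
  right => k kn.
  have := mono (k + j)%N (k + j).+1 (leqnSn _) ltac:(lia); rewrite !addSn; lra.
rewrite -(big_mkord xpredT (fun k => cos (psi k))).
rewrite (big_cat_nat (n := j))//= (big_cat_nat (n := i))//=.
apply: le_trans (ler_normD _ _) _; apply: le_trans (lerD (ler_normD _ _) (lexx _)) _.
have h : i%:R * D + (n - j)%N%:R * D <= n%:R * D.
  have [n0|n0] := posnP n; first by move: iin jn; rewrite n0 !leqn0 => /eqP-> /eqP->; rewrite subnn !mul0r addr0.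
  have Dge : 0 <= D by apply: le_trans (hD 0%N n0); exact: normr_ge0.
  by rewrite -mulrDl ler_wpM2r// -natrD ler_nat; lia.
lra.
Qed.

End VanDerCorput.

#[local] Existing Instance grid_ultrafilter_ultra.

(** * Oscillatory integrals with a strongly concave phase *)

Section ConcaveDecay.
Context {R : realType}.
Variables (phi : R -> R) (rho1 L c3 : R).
Hypotheses (rho10 : 0 < rho1) (L1 : 1 <= L) (c30 : 0 < c3).
Hypothesis phi_lip : forall s t, `|s| <= rho1 -> `|t| <= rho1 ->
  `|phi s - phi t| <= L * `|s - t|.
Hypothesis phi_concave : forall s h, 0 < h ->
  `|s - h| <= rho1 -> `|s + h| <= rho1 ->
  c3 * h ^+ 2 <= 2 * phi s - phi (s - h) - phi (s + h).

Let L0 : 0 <= L := le_trans ler01 L1.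

Let slope (a b h s : R) := a * h + b * (phi (s + h) - phi s).

(** Strong concavity enters through second differences: each step of length [h] lowers the slope by
    [b * c3 * h ^ 2]. No derivative of [phi] is involved, as the boundary of [K] may have
    corners. *)
Lemma slope_decreasing a b h s (j : nat) : 0 <= b -> 0 < h -> `|s| <= rho1 ->
  `|s + j%:R * h + h| <= rho1 ->
  slope a b h (s + j%:R * h) <= slope a b h s - j%:R * (b * c3 * h ^+ 2).
Proof.
move=> b0 h0 s1; elim: j => [|j IH] hj; first by rewrite !mul0r addr0 subr0.
have j0 : 0 <= j%:R :> R by [].
have jh : 0 <= j%:R * h by rewrite mulr_ge0// ltW.
move: hj; rewrite -natr1 mulrDl mul1r addrA => hj.
have hj1 : `|s + j%:R * h + h| <= rho1.
  move: s1 hj; rewrite !ler_norml => /andP[? ?] /andP[? ?]; apply/andP; split; lra.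
have hj0 : `|s + j%:R * h| <= rho1.
  move: s1 hj; rewrite !ler_norml => /andP[? ?] /andP[? ?]; apply/andP; split; lra.
have := IH hj1; set t := s + j%:R * h in hj hj1 hj0 *.
have := phi_concave (s := t + h) h0; rewrite addrK => /(_ hj0 hj) hc.
have : b * (c3 * h ^+ 2) <= b * (2 * phi (t + h) - phi t - phi (t + h + h)).
  by rewrite ler_wpM2l.
rewrite /slope mulrDl mul1r; lra.
Qed.

Lemma norm_slope_le a b h s : 0 <= b -> 0 < h -> `|s| <= rho1 -> `|s + h| <= rho1 ->
  `|slope a b h s| <= (`|a| + b * L) * h.
Proof.
move=> b0 h0 s1 sh; apply: le_trans (ler_normD _ _) _; rewrite !normrM.
rewrite (gtr0_norm h0) (ger0_norm b0) mulrDl lerD2l -mulrA ler_wpM2l//.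
by have := phi_lip sh s1; rewrite [s + h]addrC addrK (gtr0_norm h0).
Qed.

Notation rho := (rho1 / 2).

Let osc a b (s : R) := if `|s| <= rho then cos (a * s + b * phi s) else 0.

Lemma bdd_supp_osc a b : bdd_supp (osc a b).
Proof.
have [B hB] := nat_above rho.
exists 1%N, B; split => s; rewrite /osc.
  by case: ifP; rewrite ?normr0 ?cos_max.
by move=> h1; rewrite ifF//; apply/negbTE; rewrite -ltNge; exact: lt_trans h1.
Qed.

Lemma grid_mean_osc a b m : exists i n : nat,
  [/\ grid_mean m (osc a b) = m`!%:R^-1 * \sum_(k < n)
        cos (a * grid_point m (i + k) + b * phi (grid_point m (i + k))),
      (forall k, (k < n)%N -> `|grid_point m (i + k) : R| <= rho) &
      n%:R * (m`!%:R^-1 : R) <= 2 * rho + 1].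
Proof.
have F0 := fact_gt0R (R := R) m.
have gm k l : (k <= l)%N -> (grid_point m k : R) <= grid_point m l.
  by move=> kl; rewrite ler_pM2r ?invr_gt0// lerD2r ler_nat.
set N := (2 * m * m`!)%N.
have [|i iN hi] := @antitone_threshold (fun k => (grid_point m k : R) < - rho) N.
  by move=> k l kl _; apply: le_lt_trans; exact: gm.
have [|j jN hj] := @antitone_threshold (fun k => (grid_point m k : R) <= rho) N.
  by move=> k l kl _; apply: le_trans; exact: gm.
have r0 := rho10.
have ij : (i <= j)%N.
  rewrite leqNgt; apply/negP => ji.
  have jN' : (j < N)%N := leq_trans ji iN.
  by have := hi j jN'; have := hj j jN'; rewrite ji ltnn; lra.
have win k : (k < N)%N -> (`|grid_point m k : R| <= rho) = (i <= k < j)%N.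
  by move=> kN; rewrite ler_norml leNgt hi// hj// -leqNgt.
exists i, (j - i)%N; split.
- congr (_ * _); rewrite (big_cat_nat (n := j))//= (big_cat_nat (n := i))//=.
  rewrite big_nat_cond big1 ?add0r; last first.
    move=> k /andP[/andP[_ ki] _]; have kN : (k < N)%N by apply: leq_trans iN.
    by rewrite /osc win// leqNgt ki.
  rewrite [X in _ + X]big_nat_cond [X in _ + X]big1 ?addr0; last first.
    move=> k /andP[/andP[jk kN] _]; rewrite /osc win//.
    by rewrite ltnNge jk andbF.
  rewrite -{1}(add0n i) big_addn big_mkord; apply: eq_bigr => k _.
  have kj : (k + i < j)%N by rewrite addnC -ltn_subRL.
  by rewrite /osc (win _ (leq_trans kj jN)) leq_addl kj/= addnC.
- move=> k kn; have kj : (i + k < j)%N by rewrite -ltn_subRL.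
  by rewrite (win _ (leq_trans kj jN)) leq_addr kj.
rewrite ler_pdivrMr//.
have F1 : 1 <= m`!%:R :> R by rewrite ler1n fact_gt0.
have [j0|ltij] := leqP j i; first by rewrite (eqP (j0 : (j - i == 0)%N)); nra.
have jn' : (j.-1 < N)%N by lia.
have h1 : - rho <= grid_point m i by rewrite leNgt hi ?ltnn// (leq_trans ltij).
have h2 : grid_point m j.-1 <= rho by rewrite hj//; lia.
have : grid_point m j.-1 - grid_point m i <= rho + rho by lra.
rewrite /grid_point -mulrBl ler_pdivrMr//.
have -> : (j - i)%N%:R = j.-1%:R - i%:R + 1 :> R.
  by rewrite -natrB; [rewrite natr1; congr (_%:R)|]; lia.
nra.
Qed.

(** [sum_cos_concave] is applied on the grid of mesh [h = 1 / m!] with [nu = mu * h]; [B] bounds the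
    length on which the slope is below [mu] in absolute value. The two outer runs give [8 / mu], and
    the errors of order [h] are collected in [G * h], at most [1 / mu] for large [m]. *)
Lemma riemann_osc_le a b mu B : 0 <= b -> 0 < mu -> 0 <= B ->
  (forall h s (j : nat), 0 < h -> `|s| <= rho -> `|s + j%:R * h| <= rho ->
     h <= rho -> slope a b h s < mu * h -> - (mu * h) < slope a b h (s + j%:R * h) ->
     j%:R * h <= B) ->
  `|riemann (osc a b)| <= 9 / mu + B.
Proof.
move=> b0 mu0 B0 mid; have r0 := rho10.
apply: cvgr_to_le (cvg_norm (riemann_cvg (bdd_supp_osc a b))) _.
pose D := `|a| + b * L; have D0 : 0 <= D by rewrite addr_ge0// mulr_ge0.
pose G := (rho1 + 1) * D + 1.
have G0 : 0 < G by rewrite ltr_wpDl// mulr_ge0// ltW// addr_gt0.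
have [m1 hm1] := nat_above (G * mu).
have [m2 hm2] := nat_above (rho^-1).
have [m3 hm3] := nat_above D.
apply: (near_grid_mean (m0 := (m1 + m2 + m3)%N)) => m hm.
have F0 := fact_gt0R (R := R) m.
have Fm : m%:R <= m`!%:R :> R.
  by rewrite ler_nat; case: (m) => // n; exact: fact_geq.
have h1 : G * mu < m%:R by apply: lt_le_trans hm1 _; rewrite ler_nat; clear -hm; lia.
have h2 : rho^-1 < m%:R by apply: lt_le_trans hm2 _; rewrite ler_nat; clear -hm; lia.
have h3 : D < m%:R by apply: lt_le_trans hm3 _; rewrite ler_nat; clear -hm; lia.
have [i [n [-> win nh]]] := grid_mean_osc a b m.
set h := m`!%:R^-1 in nh *.
have hp : 0 < h by rewrite invr_gt0.
have hrho : h <= rho.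
  by rewrite /h -[rho]invrK lef_pV2 ?posrE ?invr_gt0 ?divr_gt0//; lra.
have hD : D * h <= 1 by rewrite /h ler_pdivrMr// mul1r; lra.
have hG : G * h <= mu^-1.
  by rewrite /h ler_pdivrMr// mulrC -ler_pdivrMr ?invr_gt0// invrK; lra.
clear m1 m2 m3 hm1 hm2 hm3 hm h1 h2 h3 Fm.
have step k : grid_point m k.+1 = grid_point m k + h.
  by rewrite /grid_point -natr1 addrAC mulrDl mul1r.
have steps k j : grid_point m (k + j) = grid_point m k + j%:R * h.
  by elim: j => [|j IH]; rewrite ?addn0 ?mul0r ?addr0// addnS step IH -natr1 mulrDl mul1r addrA.
pose psi k := a * grid_point m (i + k) + b * phi (grid_point m (i + k)).
have psiE k : psi k.+1 - psi k = slope a b h (grid_point m (i + k)).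
  rewrite /psi /slope addnS step; ring.
have inner s : `|s| <= rho -> `|s| <= rho1 by move=> hs; apply: le_trans hs _; lra.
have outer s : `|s| <= rho -> `|s + h| <= rho1.
  by move=> hs; apply: le_trans (ler_normD _ _) _; rewrite (gtr0_norm hp); lra.
have S : `|\sum_(k < n) cos (psi k)| <= 8 / (mu * h) + n%:R * (D * h) + B / h + 1.
  apply: sum_cos_concave => //.
  - exact: mulr_gt0.
  - move=> k kn; rewrite psiE norm_slope_le//; [exact/inner/win|exact/outer/win].
  - move=> k l kl ln; rewrite !psiE -(subnKC kl) addnA steps.
    have e : 0 <= (l - k)%N%:R * (b * c3 * h ^+ 2).
      by rewrite !mulr_ge0// ?sqr_ge0// ltW.
    have k1 : `|grid_point m (i + k) : R| <= rho1 by apply/inner/win; exact: leq_ltn_trans ln.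
    have l1 : `|grid_point m (i + k) + (l - k)%N%:R * h + h| <= rho1.
      by rewrite -steps -addnA subnKC//; exact/outer/win.
    by apply: le_trans (slope_decreasing a b0 hp k1 l1) _; rewrite gerBl.
  - move=> k l kl ln; rewrite !psiE -{1}(subnKC kl) addnA (steps (i + k)%N) => s1 s2.
    rewrite ler_pdivlMr//; apply: mid s1 s2 => //.
      by apply: win; exact: leq_ltn_trans ln.
    by rewrite -steps -addnA subnKC//; exact: win.
  - by rewrite divr_ge0// ltW.
rewrite normrM (gtr0_norm hp).
have : h * `|\sum_(k < n) cos (psi k)| <=
    h * (8 / (mu * h) + n%:R * (D * h) + B / h + 1) by rewrite ler_pM2l.
have -> : h * (8 / (mu * h) + n%:R * (D * h) + B / h + 1) =
    8 / mu + n%:R * h * (D * h) + B + h by field; rewrite !gt_eqF.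
move=> {}S; apply: le_trans S _.
have : n%:R * h * (D * h) <= (2 * rho + 1) * (D * h).
  by rewrite ler_wpM2r// mulr_ge0// ltW.
move: hG; rewrite /G.
lra.
Qed.

(** If [b * L <= |a| / 2] the slope stays at least [|a| / 2] in absolute value and the middle run is
    empty. Otherwise [b] is comparable to the maximum, and the threshold [mu = sqrt b] balances the
    outer runs, [9 / mu], against the middle one, of length at most [2 * mu / (b * c3)]. *)
Lemma riemann_osc_decay : exists C : R, forall a b,
  Num.max `|a| `|b| `^ (1 / 2) * `|riemann (osc a b)| <= C.
Proof.
have r0 := rho10; have c0 := c30; have l1 := L1.
have [N hN] := nat_above rho.
pose V : R := 1%:R * (2 * N%:R + 1).
have V0 : 0 <= V by rewrite !mulr_ge0// addr_ge0// mulr_ge0.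
have IV a b : `|riemann (osc a b)| <= V.
  apply: riemann_bound => s; rewrite /osc.
    by case: ifP; rewrite ?normr0 ?cos_max.
  by move=> h1; rewrite ifF//; apply/negbTE; rewrite -ltNge; exact: lt_trans h1.
pose W := Num.sqrt (2 * L) * (9 + 2 / c3).
have W0 : 0 <= W by rewrite mulr_ge0 ?sqrtr_ge0// addr_ge0// divr_ge0// ltW.
exists (V + 18 + W) => a b; wlog b0 : a b / 0 <= b.
  move=> h; have [/h//|b0] := leP 0 b.
  have := h (- a) (- b); rewrite !normrN => h'.
  have -> : osc a b = osc (- a) (- b).
    apply/funext => s; rewrite /osc; case: ifP => // _.
    by rewrite !mulNr -opprD cosN.
  by apply: h'; lra.
set I := `|riemann _|; have I0 : 0 <= I by exact: normr_ge0.
set T := Num.max _ _; have T0 : 0 <= T by rewrite le_max normr_ge0.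
rewrite div1r powR12_sqrt//.
have [T1|T1] := leP T 1.
  apply: (@le_trans _ _ (1 * V)); last by rewrite mul1r; lra.
  by rewrite ler_pM ?sqrtr_ge0 ?IV// -[leRHS]sqrtr1 ler_wsqrtr.
have [hb|hb] := leP (b * L) (`|a| / 2).
  have ba : b <= `|a| / 2 by apply: le_trans hb; rewrite ler_peMr.
  have TE : T = `|a|.
    by rewrite /T max_l// (ger0_norm b0); have := normr_ge0 a; lra.
  have a0 : 0 < `|a| by rewrite -TE; lra.
  have h : I <= 9 / (`|a| / 2) + 0.
    apply: riemann_osc_le => //; first by rewrite divr_gt0.
    move=> h s j h0 s1 s2 hr; rewrite /slope => e1 e2; exfalso.
    have h1 (t : R) : `|t| <= rho -> `|b * (phi (t + h) - phi t)| <= `|a| / 2 * h.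
      move=> t1; have t2 : `|t| <= rho1 by lra.
      have t3 : `|t + h| <= rho1.
        by apply: le_trans (ler_normD _ _) _; rewrite (gtr0_norm h0); lra.
      have := phi_lip t3 t2; rewrite [t + h]addrC addrK (gtr0_norm h0) => hl.
      rewrite normrM (ger0_norm b0).
      apply: (@le_trans _ _ (b * (L * h))); first by rewrite [h + t]addrC in hl *; rewrite ler_wpM2l.
      by rewrite mulrA ler_pM2r.
    move: (h1 _ s1) (h1 _ s2); rewrite !ler_norml => /andP[f1 f2] /andP[g1 g2].
    have [ap|ap] := leP 0 a.
      by rewrite (ger0_norm ap) in e1 f1; lra.
    by rewrite (ltr0_norm ap) in e2 g2; lra.
  have hs : Num.sqrt T <= T.
    by rewrite -{2}(sqr_sqrtr T0) expr2 ler_peMl ?sqrtr_ge0// -[leLHS]sqrtr1 ler_wsqrtr// ltW.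
  apply: (@le_trans _ _ (T * (18 / `|a|))).
    by rewrite ler_pM ?sqrtr_ge0//; apply: le_trans h _; rewrite addr0 invf_div; lra.
  by rewrite TE mulrCA mulfV ?gt_eqF//; lra.
have bp : 0 < b.
  rewrite lt_neqAle b0 andbT; apply/eqP => be.
  by move: hb; rewrite -be mul0r; have := normr_ge0 a; lra.
have sb : 0 < Num.sqrt b by rewrite sqrtr_gt0.
have TL : T <= 2 * L * b.
  rewrite /T ge_max (ger0_norm b0); apply/andP; split; first by lra.
  by rewrite ler_peMl//; lra.
have h : I <= 9 / Num.sqrt b + 2 / (c3 * Num.sqrt b).
  apply: riemann_osc_le => //.
    by rewrite divr_ge0// mulr_ge0// ltW.
  move=> h s j h0 s1 s2 hr e1 e2.
  have s3 : `|s| <= rho1 by lra.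
  have s4 : `|s + j%:R * h + h| <= rho1.
    by apply: le_trans (ler_normD _ _) _; rewrite (gtr0_norm h0); lra.
  have h5 := slope_decreasing a b0 h0 s3 s4.
  have : j%:R * (b * c3 * h ^+ 2) < 2 * Num.sqrt b * h by lra.
  rewrite -[X in X * c3](sqr_sqrtr b0); move: sb; set u := Num.sqrt b => u0 h6.
  rewrite ler_pdivlMr ?mulr_gt0// ltW// -(ltr_pM2r (mulr_gt0 u0 h0)).
  by rewrite (mulrA 2); apply: le_lt_trans h6; rewrite le_eqVlt; apply/orP; left; apply/eqP; ring.
apply: (@le_trans _ _ (Num.sqrt (2 * L * b) * (9 / Num.sqrt b + 2 / (c3 * Num.sqrt b)))).
  by rewrite ler_pM ?sqrtr_ge0// ler_wsqrtr.
rewrite sqrtrM ?mulr_ge0//.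
have -> : Num.sqrt (2 * L) * Num.sqrt b * (9 / Num.sqrt b + 2 / (c3 * Num.sqrt b)) = W.
  by rewrite /W; move: sb; set u := Num.sqrt b => u0; field; rewrite !gt_eqF.
lra.
Qed.

End ConcaveDecay.

Section PlaneGeometry.
Context {R : realType}.
Implicit Types x y u v w p : 'rV[R]_2.

Lemma row2P u v : u 0 ord0 = v 0 ord0 -> u 0 ord_max = v 0 ord_max -> u = v.
Proof.
move=> h0 h1; apply/rowP => j.
by case: (unliftP ord0 j) => [k ->|->//]; rewrite (_ : lift ord0 k = ord_max)//; apply/val_inj; case: k => [[]].
Qed.

Lemma dot2 u v : dot u v = u 0 ord0 * v 0 ord0 + u 0 ord_max * v 0 ord_max.
Proof.
rewrite /dot !big_ord_recl big_ord0 addr0; congr (_ + _ * _); congr (_ _ _); exact/val_inj.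
Qed.

Definition perp p : 'rV[R]_2 := \row_j (if j == ord0 then - p 0 ord_max else p 0 ord0).

Lemma dot_perp p : dot (perp p) p = 0.
Proof. by rewrite dot2 !mxE/=; ring. Qed.

Lemma dot_perp_perp p : dot (perp p) (perp p) = dot p p.
Proof. by rewrite !dot2 !mxE/=; ring. Qed.

Lemma dot_ge0 p : 0 <= dot p p.
Proof. by apply: sumr_ge0 => j _; rewrite -expr2 sqr_ge0. Qed.

Lemma dot_gt0 p : p != 0 -> 0 < dot p p.
Proof.
move=> p0; rewrite lt_neqAle dot_ge0 andbT; apply: contra p0 => /eqP h.
move: h; rewrite dot2 => h.
have h0 : 0 <= p 0 ord0 ^+ 2 by exact: sqr_ge0.
have h1 : 0 <= p 0 ord_max ^+ 2 by exact: sqr_ge0.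
apply/eqP/row2P; rewrite !mxE; apply/eqP; rewrite -sqrf_eq0; apply/eqP; lra.
Qed.

Lemma perp_basis p x : p != 0 ->
  x = (dot (perp p) x / dot p p) *: perp p + (dot p x / dot p p) *: p.
Proof.
move=> /dot_gt0/lt0r_neq0; rewrite !dot2 => h.
by apply: row2P; rewrite !mxE/=; field.
Qed.

Lemma direction_unit u : dot u u = 1 ->
  exists2 theta : R, 0 <= theta < 2 * pi & direction theta = u.
Proof.
rewrite dot2; set a := u 0 ord0; set b := u 0 ord_max => h.
have b2 : b ^+ 2 = 1 - a ^+ 2 by lra.
have a1 : -1 <= a <= 1.
  by have := sqr_ge0 b; rewrite b2 subr_ge0 -ler_norml -[a ^+ 2]real_normK ?num_real// expr_le1.
have ca : cos (acos a) = a by apply: acosK; rewrite in_itv.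
have sa : sin (acos a) = `|b| by rewrite sin_acos// -b2 sqrtr_sqr.
have pi0 := pi_gt0 R.
have [b0|b0] := leP 0 b.
  exists (acos a); first by rewrite acos_ge0//=; have := acos_lepi a1; lra.
  by apply: row2P; rewrite !mxE/= ?ca ?sa// ger0_norm.
have a1' : -1 <= a < 1.
  have /andP[-> h1] := a1; rewrite lt_neqAle h1 andbT; apply/eqP => a1E.
  by have : 0 < b ^+ 2 by [rewrite exprn_even_gt0//= lt_eqF|]; rewrite b2 a1E; lra.
exists (2 * pi - acos a).
  have := acos_gt0 a1'; have := acos_lepi a1; lra.
have c2 : cos (2 * pi) = 1 :> R by rewrite mulr_natl cos2pi.
have s2 : sin (2 * pi) = 0 :> R by rewrite mulr_natl sin2pi.
apply: row2P; rewrite !mxE/= ?cosB ?sinB c2 s2 ca sa ltr0_norm//; rewrite -/a -/b; ring.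
Qed.

End PlaneGeometry.

(** * The boundary of a convex body as a concave graph *)

Section BoundaryGraph.
Context {R : realType} {d : nat}.
Variables (K : set 'rV[R]_d) (w p : 'rV[R]_d).
Hypothesis bodyK : symmetric_convex_body K.
Let N := body_norm K.
Hypothesis p1 : N p = 1.

Lemma body_norm0 : N 0 = 0.
Proof.
apply/eqP; rewrite eq_le (body_norm_ge0 bodyK) andbT.
by have [r _ /(_ 0)] := body_norm_le_norm bodyK; rewrite normr0 mul0r.
Qed.

Lemma body_norm_scale x (c : R) : N (c *: x) = `|c| * N x.
Proof.
have [c0|c0|->] := ltgtP c 0.
- have := body_normZ bodyK x (c := - c); rewrite oppr_gt0 => /(_ c0).
  by rewrite scaleNr /N (body_normN bodyK) ltr0_norm.
- by rewrite gtr0_norm//; exact: (body_normZ bodyK).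
- by rewrite scale0r normr0 mul0r body_norm0.
Qed.

Lemma boundaryE q : boundary K q -> N q = 1.
Proof.
move=> [clq niq]; apply/eqP; rewrite eq_le; apply/andP; split.
  apply/ler_addgt0Pr => e e0.
  have e1 : 0 < 1 + e by lra.
  apply: (body_norm_le bodyK) => //; apply: (closure_body_scale bodyK) => //.
  by rewrite invr_ge0 (ltW e1)/= invf_lt1//; lra.
rewrite leNgt; apply/negP => q1; apply: niq.
have [r r0 hr] := body_norm_lipschitz bodyK.
have e0 : 0 < r * (1 - N q) by rewrite mulr_gt0// subr_gt0.
apply/nbhs_ballP; exists (r * (1 - N q)) => //= x; rewrite ball_rowE /= => hx.
have h : body_norm K x < 1.
  have := hr q x; rewrite ler_norml => /andP[h1 _].
  have : `|q - x| / r < 1 - N q by rewrite ltr_pdivrMr// mulrC.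
  by move: h1; rewrite -/N; lra.
by have [_] := body_norm_lt bodyK h; rewrite invr1 scale1r.
Qed.

(** For [|s|] up to this value, [s *: w] has norm at most [1 / 2], so the line through it in the
    direction [p] passes well inside the body. *)
Definition graph_range : R := (2 * (N w + 1))^-1.

Definition graph_height (s : R) : R := sup [set y : R | N (s *: w + y *: p) <= 1].

Notation rho1 := graph_range.
Notation phi := graph_height.

Let Nw0 : 0 <= N w. Proof. exact: (body_norm_ge0 bodyK). Qed.

Lemma graph_range_gt0 : 0 < rho1.
Proof. by rewrite invr_gt0 mulr_gt0// ltr_wpDl. Qed.

Lemma graph_rangeP (s : R) : `|s| <= rho1 -> `|s| * N w <= 2^-1.
Proof.
have h := Nw0; rewrite /graph_range -div1r ler_pdivlMr ?mulr_gt0 ?ltr_wpDl// => hs.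
have := normr_ge0 s; nra.
Qed.

Lemma graph_le s y : N (s *: w + y *: p) <= 1 -> `|y| <= 1 + `|s| * N w.
Proof.
move=> h; have := body_norm_triangle bodyK (s *: w + y *: p) (- (s *: w)).
rewrite (body_normN bodyK) addrAC subrr add0r -!/(N _) !body_norm_scale p1 mulr1.
lra.
Qed.

Lemma graph_has_sup s : `|s| <= rho1 -> has_sup [set y : R | N (s *: w + y *: p) <= 1].
Proof.
move=> /graph_rangeP hs; split.
  by exists 0; rewrite /= scale0r addr0 body_norm_scale; lra.
by exists (1 + `|s| * N w) => y /graph_le; apply: le_trans; exact: ler_norm.
Qed.

Lemma le_graph_height s y : `|s| <= rho1 -> N (s *: w + y *: p) <= 1 -> y <= phi s.
Proof. by move=> /graph_has_sup hs h; apply: ub_le_sup => //; case: hs. Qed.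

Lemma graph_height_attained s : `|s| <= rho1 -> N (s *: w + phi s *: p) <= 1.
Proof.
move=> hs; apply/ler_addgt0Pr => e e0.
have [y /= hy ye] := sup_adherent e0 (graph_has_sup hs).
have := body_norm_triangle bodyK (s *: w + y *: p) ((phi s - y) *: p).
rewrite -addrA -scalerDl [y + _]addrC subrK -!/(N _) [N (_ *: p)]body_norm_scale p1 mulr1 => h.
apply: le_trans h _; rewrite lerD// ger0_norm ?subr_ge0 ?le_graph_height//.
by move: ye; rewrite -/(phi s); lra.
Qed.

Lemma graph_height_bounds s : `|s| <= rho1 -> 2^-1 <= phi s <= 3 / 2.
Proof.
move=> hs; have h := graph_rangeP hs; apply/andP; split.
  apply: le_graph_height => //; apply: le_trans (body_norm_triangle bodyK _ _) _.
  rewrite -!/(N _) !body_norm_scale p1 (ger0_norm (x := 2^-1))//; lra.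
by have := graph_le (graph_height_attained hs); have := ler_norm (phi s); lra.
Qed.

Lemma graph_height_combine (mu s t y z : R) : 0 <= mu <= 1 ->
  N (s *: w + y *: p) <= 1 -> N (t *: w + z *: p) <= 1 ->
  `|mu * s + (1 - mu) * t| <= rho1 ->
  mu * y + (1 - mu) * z <= phi (mu * s + (1 - mu) * t).
Proof.
move=> /andP[m0 m1] h1 h2 hr; apply: le_graph_height => //.
have -> : (mu * s + (1 - mu) * t) *: w + (mu * y + (1 - mu) * z) *: p =
    mu *: (s *: w + y *: p) + (1 - mu) *: (t *: w + z *: p).
  by rewrite !scalerDr !scalerA !scalerDl addrACA.
apply: le_trans (body_norm_triangle bodyK _ _) _.
rewrite -!/(N _) !body_norm_scale !ger0_norm ?subr_ge0//.
have : mu * N (s *: w + y *: p) <= mu * 1 by rewrite ler_wpM2l.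
have : (1 - mu) * N (t *: w + z *: p) <= (1 - mu) * 1 by rewrite ler_wpM2l// subr_ge0.
lra.
Qed.

(** Shrinking the graph point over [s] by the factor [1 - de] leaves room for the horizontal move to
    [t]; [de = 2 * |s - t| * N w] makes the norm come out at most [1]. As heights are at most
    [3 / 2], the loss is at most [3 * N w * |s - t|]. *)
Lemma graph_height_lipschitz s t : `|s| <= rho1 -> `|t| <= rho1 ->
  `|phi s - phi t| <= (3 * N w + 1) * `|s - t|.
Proof.
suff key : forall s t, `|s| <= rho1 -> `|t| <= rho1 ->
    phi s - phi t <= (3 * N w + 1) * `|s - t|.
  move=> hs ht; rewrite ler_norml key// andbT.
  by have := key t s ht hs; rewrite distrC; lra.
move=> {}s {}t hs ht; have nw := Nw0.
have /andP[s0 s1] := graph_height_bounds hs; have /andP[t0 t1] := graph_height_bounds ht.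
have hsw := graph_rangeP hs.
pose de := 2 * `|s - t| * N w.
have st0 : 0 <= `|s - t| by [].
have stw : 0 <= `|s - t| * N w by rewrite mulr_ge0.
have de0 : 0 <= de by rewrite /de -mulrA mulr_ge0.
have E : `|s - t| * N w = de / 2 by rewrite /de; field.
clearbody de; have [d1|d1] := leP 1 de; first by lra.
have : (1 - de) * phi s <= phi t.
  apply: le_graph_height => //.
  have -> : t *: w + ((1 - de) * phi s) *: p =
      (1 - de) *: (s *: w + phi s *: p) + (t - s + de * s) *: w.
    rewrite scalerDr !scalerA addrAC -scalerDl; congr (_ *: _ + _); ring.
  apply: le_trans (body_norm_triangle bodyK _ _) _.
  rewrite -!/(N _) !body_norm_scale ger0_norm ?subr_ge0 ?(ltW d1)//.
  have h1 : (1 - de) * N (s *: w + phi s *: p) <= (1 - de) * 1.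
    by rewrite ler_wpM2l ?subr_ge0 ?(ltW d1)// graph_height_attained.
  have h2 : `|t - s + de * s| <= `|s - t| + de * `|s|.
    by apply: le_trans (ler_normD _ _) _; rewrite normrM (ger0_norm de0) distrC.
  have h3 : `|t - s + de * s| * N w <= (`|s - t| + de * `|s|) * N w by rewrite ler_wpM2r.
  have h4 : de * (`|s| * N w) <= de * 2^-1 by rewrite ler_wpM2l.
  by lra.
have : de * phi s <= de * (3 / 2) by rewrite ler_wpM2l.
by lra.
Qed.

(** A point below the graph with [y >= 0] combines the graph point with [s *: w], whose norm is at
    most [1 / 2], so its norm is less than [1]. The sign condition excludes the opposite branch of
    the boundary. *)
Lemma graph_height_unique s y : `|s| <= rho1 -> 0 <= y ->
  N (s *: w + y *: p) = 1 -> y = phi s.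
Proof.
move=> hs y0 h; apply/eqP; rewrite eq_le le_graph_height ?h//= leNgt.
apply/negP => yphi; have /andP[f0 _] := graph_height_bounds hs.
have fp : 0 < phi s by lra.
have hsw := graph_rangeP hs.
have : N (s *: w + y *: p) < 1; last by rewrite h ltxx.
pose l := y / phi s; have l1 : l < 1 by rewrite ltr_pdivrMr// mul1r.
have l0 : 0 <= l by rewrite divr_ge0// ltW.
have lE : l * phi s = y by rewrite divfK ?gt_eqF.
clearbody l.
have -> : s *: w + y *: p = l *: (s *: w + phi s *: p) + ((1 - l) * s) *: w.
  rewrite scalerDr !scalerA lE addrAC -scalerDl.
  by congr (_ *: _ + _); ring.
apply: le_lt_trans (body_norm_triangle bodyK _ _) _.
rewrite -!/(N _) !body_norm_scale normrM (ger0_norm l0) (ger0_norm (x := 1 - l)) ?subr_ge0 ?(ltW l1)//.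
have : l * N (s *: w + phi s *: p) <= l * 1 by rewrite ler_wpM2l// graph_height_attained.
have : (1 - l) * (`|s| * N w) <= (1 - l) * 2^-1 by rewrite ler_wpM2l// subr_ge0 ltW.
lra.
Qed.

(* The left-hand side is the height of a point of [K] above a chord of the graph;
   [h] may be negative, so as to treat both sides of [s] at once. *)
Lemma chord_height (h s t y : R) : h != 0 -> `|s - h| <= rho1 -> `|s| <= rho1 ->
  `|s + h| <= rho1 -> N (t *: w + y *: p) <= 1 -> 0 <= (t - s) / h ->
  y - (phi (s - h) + (t - s + h) / (2 * h) * (phi (s + h) - phi (s - h))) <=
  2 * phi s - phi (s - h) - phi (s + h).
Proof.
move=> h0 hm hs hp hN r0.
set r := (t - s) / h in r0; have tE : t = s + r * h by rewrite /r divfK// addrC subrK.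
have a1 := graph_height_attained hm; have a2 := graph_height_attained hp.
move: r0 tE; clearbody r => r0 tE; have -> : (t - s + h) / (2 * h) = (r + 1) / 2 by rewrite tE; field.
have r1 : 0 < r + 1 by rewrite ltr_wpDl.
have combA mu u z : 0 <= mu <= 1 -> N (u *: w + z *: p) <= 1 ->
    mu * u + (1 - mu) * (s - h) = s -> mu * z + (1 - mu) * phi (s - h) <= phi s.
  move=> hmu hz e; have := graph_height_combine hmu hz a1; rewrite e; exact.
have combB mu u z : 0 <= mu <= 1 -> N (u *: w + z *: p) <= 1 ->
    mu * u + (1 - mu) * (s - h) = s + h -> mu * z + (1 - mu) * phi (s - h) <= phi (s + h).
  move=> hmu hz e; have := graph_height_combine hmu hz a1; rewrite e; exact.
move: a1 a2 combA combB; move: (phi (s - h)) (phi (s + h)) (phi s) => A B F a1 a2 combA combB.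
move: N a1 a2 combA combB hN => M a1 a2 combA combB hN.
have mid : (A + B) / 2 <= F.
  have := combA 2^-1 (s + h) B; have -> : 2^-1 * (s + h) + (1 - 2^-1) * (s - h) = s by field.
  by move=> /(_ ltac:(lra) a2 erefl) h1; lra.
(* For [r <= 1] the abscissa [s] lies between [s - h] and [t]; for [r > 1] it is [s + h] that does.
   Concavity is applied at that middle point, and in the second case the point of [K] lies on or
   below the chord line. *)
clear hm hs hp; have [rle|rgt] := leP r 1.
  have := combA (r + 1)^-1 t y.
  have -> : (r + 1)^-1 * t + (1 - (r + 1)^-1) * (s - h) = s.
    by rewrite tE; field; rewrite gt_eqF.
  move=> /(_ _ hN erefl); rewrite invr_ge0 (ltW r1) invf_le1//= => /(_ ltac:(lra)).
  have -> : (r + 1)^-1 * y + (1 - (r + 1)^-1) * A = A + (y - A) / (r + 1).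
    by field; rewrite gt_eqF.
  rewrite -lerBrDl ler_pdivrMr// => h1.
  have : 0 <= (1 - r) * (F - (A + B) / 2) by rewrite mulr_ge0 ?subr_ge0.
  lra.
have := combB (2 / (r + 1)) t y.
have -> : 2 / (r + 1) * t + (1 - 2 / (r + 1)) * (s - h) = s + h.
  by rewrite tE; field; rewrite gt_eqF.
move=> /(_ _ hN erefl); rewrite divr_ge0 ?(ltW r1)//= ler_pdivrMr// mul1r => /(_ ltac:(lra)).
have -> : 2 / (r + 1) * y + (1 - 2 / (r + 1)) * A = A + (y - A) * 2 / (r + 1).
  by field; rewrite gt_eqF.
rewrite -lerBrDl ler_pdivrMr// => h1.
lra.
Qed.

End BoundaryGraph.

Lemma chord_point_split (R : realFieldType) (n : nat) (w p : 'rV[R]_n)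
    (s t h a g y : R) : h != 0 ->
  t *: w + y *: p = (s - h) *: w + a *: p +
    ((t - s + h) / (2 * h)) *: ((2 * h) *: w + g *: p) +
    (y - (a + (t - s + h) / (2 * h) * g)) *: p.
Proof. by move=> h0; apply/rowP => j; rewrite !mxE; field. Qed.

Lemma chord_arith (R : realFieldType) (c e h2 g2 S Q b G : R) :
  0 < c -> 0 < e -> 0 < h2 -> 0 <= g2 -> 0 < b -> b <= e ->
  (4 * h2 + g2) * e ^+ 2 <= c ^+ 2 * (S - Q) -> S <= Q + b * G ->
  4 * e / c ^+ 2 * h2 <= G.
Proof.
move=> c0 e0 h0 g0 b0 be hV hS.
have cc : 0 < c ^+ 2 by rewrite exprn_gt0.
have ee : 0 < e ^+ 2 by rewrite exprn_gt0.
have h3 : (4 * h2 + g2) * e ^+ 2 <= c ^+ 2 * (b * G).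
  by apply: le_trans hV _; rewrite ler_pM2l// lerBlDl.
have h5 : 4 * h2 * e ^+ 2 <= c ^+ 2 * (b * G).
  by apply: le_trans h3; rewrite [leRHS]mulrDl lerDl mulr_ge0// ltW.
have G0 : 0 < G.
  have : 0 < c ^+ 2 * (b * G) by apply: lt_le_trans h5; rewrite !mulr_gt0.
  by rewrite pmulr_rgt0// pmulr_rgt0.
rewrite mulrAC ler_pdivrMr// -(ler_pM2r e0).
have -> : 4 * e * h2 * e = 4 * h2 * e ^+ 2 by ring.
apply: le_trans h5 _.
have -> : G * c ^+ 2 * e = c ^+ 2 * (e * G) by ring.
by rewrite ler_pM2l// ler_pM2r.
Qed.

(** * From short chords to strong concavity *)

Section ChordCondition.
Context {R : realType}.
Variables (K : set 'rV[R]_2) (c : R).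
Hypotheses (bodyK : symmetric_convex_body K) (c0 : 0 < c).
Hypothesis chordK : forall theta eps : R, 0 <= theta < 2 * pi -> 0 < eps ->
  (chord_length K theta eps <= (c * Num.sqrt eps)%:E)%E.
Let N := body_norm K.
Implicit Types (x u v : 'rV[R]_2).

Lemma support_has_sup u : has_sup [set dot y u | y in K].
Proof.
split; first by exists (dot 0 u); exists 0 => //; exact: body0.
have [B B0 hB] := body_outer bodyK.
exists (2%:R * B * `|u|) => _ [y Ky <-].
apply: le_trans (ler_norm _) _; apply: le_trans (norm_dot_le _ _) _.
by rewrite ler_wpM2r// ler_wpM2l// hB.
Qed.

Lemma dot_le_support u y : K y -> dot y u <= support_fun K u.
Proof. by move=> Ky; apply: ub_le_sup; [have [] := support_has_sup u|exists y]. Qed.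

Lemma support_gt0 u : u != 0 -> 0 < support_fun K u.
Proof.
move=> u0; have [r r0 hr] := body_inner bodyK.
have P0 : 0 < `|u| + 1 by rewrite ltr_wpDl.
have e0 : 0 < r / (`|u| + 1) by rewrite divr_gt0.
apply: (@lt_le_trans _ _ (dot ((r / (`|u| + 1)) *: u) u)).
  by rewrite dotZl mulr_gt0 ?dot_gt0.
apply: dot_le_support; apply: hr; rewrite normrZ gtr0_norm//.
by rewrite mulrAC ltr_pdivrMr// ltr_pM2l// ltrDl.
Qed.

(** The points have norm at most [1] but need not belong to [K]; the chord condition is applied to
    [t *: x] and [t *: y] with [t < 1], and [t] tends to [1]. *)
Lemma chord_support u x y : dot u u = 1 -> N x <= 1 -> N y <= 1 ->
  dot x u = dot y u ->
  dot (x - y) (x - y) <= c ^+ 2 * (support_fun K u - dot x u).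
Proof.
move=> u1 Nx Ny xyu; have [theta th tu] := direction_unit u1.
have u0 : u != 0.
  by apply: contraTneq isT => u0; move: u1; rewrite u0 dot2 !mxE; lra.
set S := support_fun K u; have S0 : 0 < S by exact: support_gt0.
set Q := dot x u in xyu *; set V := dot (x - y) (x - y).
have V0 : 0 <= V by exact: dot_ge0.
have tK z t : N z <= 1 -> 0 <= t < 1 -> K (t *: z).
  move=> Nz /andP[t0 t1]; have : body_norm K (t *: z) < 1.
    rewrite body_norm_scale// ger0_norm//; apply: le_lt_trans t1.
    by rewrite ler_piMr.
  by move=> /(body_norm_lt bodyK)[_]; rewrite invr1 scale1r.
have key t : 0 <= t < 1 -> t ^+ 2 * V <= c ^+ 2 * (S - t * Q).
  move=> ht; have /andP[t0 t1] := ht.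
  have eps0 : 0 < S - t * Q.
    rewrite subr_gt0; have [Q0|Q0] := leP Q 0.
      by apply: le_lt_trans S0; rewrite mulr_ge0_le0.
    have ht' : 0 <= (1 + t) / 2 < 1 by apply/andP; split; lra.
    have : dot (((1 + t) / 2) *: x) u <= S by apply: dot_le_support; exact: tK.
    by rewrite dotZl -/Q; apply: lt_le_trans; rewrite ltr_pM2r//; lra.
  have hch := chordK th eps0.
  have : ((eucl_dist (t *: x) (t *: y))%:E <= chord_length K theta (S - t * Q))%E.
    apply: ereal_sup_ubound; right; exists (t *: x).
      split; first exact: tK.
      by rewrite tu dotZl -/S -/Q; lra.
    exists (t *: y) => //; split; first exact: tK.
    by rewrite tu dotZl -/S -xyu; lra.
  move=> /le_trans/(_ hch); rewrite lee_fin /eucl_dist /eucl_norm -scalerBr.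
  rewrite dotZl dotZr -/V => h.
  have : Num.sqrt (t * (t * V)) ^+ 2 <= (c * Num.sqrt (S - t * Q)) ^+ 2.
    by rewrite ler_pXn2r ?nnegrE ?sqrtr_ge0 ?mulr_ge0 ?sqrtr_ge0// ltW.
  rewrite exprMn !sqr_sqrtr ?(ltW eps0)//; last by rewrite !mulr_ge0.
  by rewrite mulrA -expr2.
rewrite leNgt; apply/negP => hlt.
pose e := V - c ^+ 2 * (S - Q); have e0 : 0 < e by rewrite subr_gt0.
have G0 : 0 < 2 * V + c ^+ 2 * `|Q| + 1.
  by rewrite ltr_wpDl// addr_ge0// mulr_ge0// sqr_ge0.
pose eta := Num.min 2^-1 (e / (2 * (2 * V + c ^+ 2 * `|Q| + 1))).
have eta0 : 0 < eta by rewrite lt_min invr_gt0 ltr0n/= divr_gt0// mulr_gt0.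
have eta1 : eta <= 2^-1 by rewrite ge_min lexx.
have eta2 : eta * (2 * V + c ^+ 2 * `|Q| + 1) <= e / 2.
  rewrite -ler_pdivlMr//; apply: (@le_trans _ _ (e / (2 * (2 * V + c ^+ 2 * `|Q| + 1)))).
    by rewrite ge_min lexx orbT.
  by rewrite invfM mulrA.
have := key (1 - eta) ltac:(apply/andP; split; lra).
have : c ^+ 2 * (eta * Q) <= c ^+ 2 * (eta * `|Q|).
  by rewrite ler_wpM2l ?sqr_ge0// ler_wpM2l ?(ltW eta0)// ler_norm.
have : 0 <= eta ^+ 2 * V by rewrite mulr_ge0 ?sqr_ge0.
move: eta2 e0; rewrite /e; clearbody eta V Q S; lra.
Qed.

Variable p : 'rV[R]_2.
Hypothesis p1 : N p = 1.
Let w := perp p.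
Notation phi := (graph_height K w p).
Notation rho1 := (graph_range K w).

Let p_neq0 : p != 0.
Proof.
apply/eqP => p0; move: p1; rewrite p0 /N (body_norm0 bodyK) => /esym/eqP.
by rewrite oner_eq0.
Qed.

Let D := dot p p.
Let D0 : 0 < D. Proof. exact: dot_gt0. Qed.

Lemma body_below_chord s h x : 0 < h -> `|s - h| <= rho1 -> `|s| <= rho1 ->
  `|s + h| <= rho1 -> K x -> exists k y : R,
  x = (s - h) *: w + phi (s - h) *: p +
    k *: ((2 * h) *: w + (phi (s + h) - phi (s - h)) *: p) + y *: p /\
  y <= 2 * phi s - phi (s - h) - phi (s + h).
Proof.
move=> h0 hm hs hp Kx.
have Nx : body_norm K x <= 1.
  by apply: (body_norm_le bodyK ltr01); rewrite invr1 scale1r.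
have [t [y xE]] : exists t y, x = t *: w + y *: p.
  by do 2!eexists; exact: perp_basis.
have hn := lt0r_neq0 h0.
exists ((t - s + h) / (2 * h)).
exists (y - (phi (s - h) + (t - s + h) / (2 * h) * (phi (s + h) - phi (s - h)))).
split; first by rewrite {1}xE; exact: chord_point_split.
rewrite xE in Nx.
have [ts|ts] := leP 0 (t - s).
  have r0 : 0 <= (t - s) / h by rewrite divr_ge0// ltW.
  exact: (chord_height bodyK p1 hn hm hs hp Nx r0).
have hN : `|s + - h| <= rho1 by [].
have hNN : `|s - - h| <= rho1 by rewrite opprK.
have hn' : - h != 0 by rewrite oppr_eq0.
have r0 : 0 <= (t - s) / - h.
  by rewrite invrN mulrN -mulNr divr_ge0 ?oppr_ge0 ?(ltW ts) ?(ltW h0).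
have := chord_height bodyK p1 hn' hNN hs hN Nx r0.
rewrite opprK [X in _ <= X]addrAC => hh; apply: le_trans hh.
rewrite le_eqVlt; apply/orP; left; apply/eqP.
move: (phi _) (phi _) => A B; field.
exact: hn.
Qed.

(** The segment joining the graph points over [s - h] and [s + h] is a chord for its unit normal
    [u]. No point of [K] rises above its line, measured along [p], by more than the second
    difference of [phi]; so its depth below the support line is at most that difference times
    [p . u], which is at most [sqrt D]. Its squared length is at least [4 * h ^ 2 * D], and the
    chord condition compares the two. *)
Lemma graph_height_strongly_concave : exists2 c3 : R, 0 < c3 & forall s h, 0 < h ->
  `|s - h| <= rho1 -> `|s + h| <= rho1 ->
  c3 * h ^+ 2 <= 2 * phi s - phi (s - h) - phi (s + h).
Proof.
have sD : 0 < Num.sqrt D by rewrite sqrtr_gt0.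
exists (4 * Num.sqrt D / c ^+ 2) => [|s h h0 hm hp].
  by rewrite divr_gt0 ?mulr_gt0 ?exprn_gt0.
have hs : `|s| <= rho1.
  move: hm hp; rewrite !ler_norml => /andP[? ?] /andP[? ?]; apply/andP; split; lra.
have am := graph_height_attained bodyK p1 hm; have ap := graph_height_attained bodyK p1 hp.
pose P := (s + h) *: w + phi (s + h) *: p; pose M := (s - h) *: w + phi (s - h) *: p.
pose g := phi (s + h) - phi (s - h).
have PM : P - M = (2 * h) *: w + g *: p.
  rewrite /P /M /g opprD addrACA -!scalerBl; congr (_ *: _ + _); ring.
pose u0 : 'rV[R]_2 := (2 * h) *: p - g *: w.
have wp : dot w p = 0 by exact: dot_perp.
have pw : dot p w = 0 by rewrite dotC.
have ww : dot w w = D by exact: dot_perp_perp.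
have u0u0 : dot u0 u0 = (4 * h ^+ 2 + g ^+ 2) * D.
  by rewrite /u0 !(dotBl, dotBr, dotZl, dotZr) wp pw ww -/D; ring.
have PMPM : dot (P - M) (P - M) = (4 * h ^+ 2 + g ^+ 2) * D.
  by rewrite PM !(dotDl, dotDr, dotZl, dotZr) wp pw ww -/D; ring.
have h2 : 0 < h ^+ 2 by rewrite exprn_gt0.
have q0 : 0 < 4 * h ^+ 2 + g ^+ 2 by rewrite ltr_pwDl ?mulr_gt0// sqr_ge0.
pose n := Num.sqrt ((4 * h ^+ 2 + g ^+ 2) * D).
have n0 : 0 < n by rewrite sqrtr_gt0 mulr_gt0.
pose u := n^-1 *: u0.
have uu : dot u u = 1.
  rewrite /u dotZl dotZr u0u0 -[X in _ * (_ * X)]sqr_sqrtr ?mulr_ge0 ?ltW// -/n.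
  by field; rewrite gt_eqF.
have pu : dot p u = 2 * h * D / n.
  by rewrite /u /u0 !(dotBr, dotZr) pw -/D; ring.
have pu0 : 0 < dot p u by rewrite pu divr_gt0// !mulr_gt0.
have puD : dot p u <= Num.sqrt D.
  rewrite pu ler_pdivrMr// /n -sqrtrM ?(ltW D0)//.
  have h2D : 0 <= 2 * h * D by rewrite !mulr_ge0// ltW.
  rewrite -[leLHS](ger0_norm h2D) -sqrtr_sqr ler_wsqrtr//.
  have -> : D * ((4 * h ^+ 2 + g ^+ 2) * D) = (2 * h * D) ^+ 2 + g ^+ 2 * D ^+ 2 by ring.
  by rewrite lerDl mulr_ge0// sqr_ge0.
have vu : dot (P - M) u = 0.
  by rewrite PM /u /u0 !(dotDl, dotBr, dotZl, dotZr) wp pw ww -/D; ring.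
have PMu : dot P u = dot M u by apply/eqP; rewrite -subr_eq0 -dotBl vu.
have Sle : support_fun K u <= dot M u + dot p u * (2 * phi s - phi (s - h) - phi (s + h)).
  clear am ap; apply: ge_sup; first by have [] := support_has_sup u.
  move=> _ [x Kx <-].
  have [k [y' [xE hy]]] := body_below_chord h0 hm hs hp Kx.
  rewrite xE -PM !dotDl !dotZl vu mulr0 addr0 -/M.
  by rewrite lerD2l mulrC (ler_pM2l pu0).
have := chord_support uu ap am PMu.
rewrite -/P -/M PMPM PMu => hV.
have DE : D = Num.sqrt D ^+ 2 by rewrite (sqr_sqrtr (ltW D0)).
rewrite DE in hV.
exact: (chord_arith c0 sD h2 (sqr_ge0 g) pu0 puD hV Sle).
Qed.

End ChordCondition.

Section ChordLocalDecay.
Context {R : realType}.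

(** In the orthogonal basis [perp p], [p] the boundary near [p] is the graph of [phi], and
    [dot zeta] becomes [a * s + b * phi s] on it. Decay in [a] and [b] passes to [zeta], whose norm
    is bounded by a multiple of their maximum. *)
Lemma chord_local_decay (K : set 'rV[R]_2) (c : R) (p : 'rV[R]_2) :
  symmetric_convex_body K -> 0 < c ->
  (forall theta eps : R, 0 <= theta < 2 * pi -> 0 < eps ->
    (chord_length K theta eps <= (c * Num.sqrt eps)%:E)%E) ->
  boundary K p ->
  exists2 e : R, 0 < e & exists sigma,
    decay_functional (1 / 2) (boundary K `&` ball p e) sigma.
Proof.
move=> bodyK c0 chordK bp; have p1 := boundaryE bodyK bp.
have p0 : p != 0.
  apply/eqP => p0; move: p1; rewrite p0 (body_norm0 bodyK) => /esym/eqP.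
  by rewrite oner_eq0.
have D0 := dot_gt0 p0; set D := dot p p in D0.

have [c3 c30 hc3] := graph_height_strongly_concave bodyK c0 chordK p1.
have rho10 := graph_range_gt0 (perp p) bodyK.
have hlip := graph_height_lipschitz bodyK p1 (w := perp p).
have hatt := graph_height_unique bodyK p1 (w := perp p).
set w := perp p in rho10 hlip hatt hc3.
set rho1 := graph_range K w in rho10 hlip hatt hc3.
set phi := graph_height K w p in hc3 hlip hatt.
set L := 3 * body_norm K w + 1 in hlip.
have L1 : 1 <= L by rewrite lerDr mulr_ge0// (body_norm_ge0 bodyK).
have [C hC] := riemann_osc_decay rho10 L1 c30 hlip hc3.
have wD : dot w w = D by exact: dot_perp_perp.
have wp : dot w p = 0 by exact: dot_perp.
have pD : dot p p = D by [].
have basis x : x = (dot w x / D) *: w + (dot p x / D) *: p by exact: perp_basis.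
clear hc3; clearbody L phi rho1 w D.
pose rho := rho1 / 2; have rho0 : 0 < rho by rewrite divr_gt0.
pose X s := s *: w + phi s *: p.
pose sigma (f : 'rV[R]_2 -> R) := riemann (fun s => if `|s| <= rho then f (X s) else 0).
have bchi (f : 'rV[R]_2 -> R) : bounded_fn f ->
    bdd_supp (fun s => if `|s| <= rho then f (X s) else 0).
  move=> [M hM]; have [n hn] := nat_above M; have [B hB] := nat_above rho.
  exists n, B; split => s.
    by case: ifP => _; rewrite ?normr0//; apply: le_trans (hM _) (ltW hn).
  by move=> h; rewrite ifF//; apply/negbTE; rewrite -ltNge; exact: lt_trans h.
have W0 : 0 < `|w| + L * `|p| + 1.
  by rewrite ltr_wpDl// addr_ge0// mulr_ge0// (le_trans ler01).
pose e := Num.min 2^-1 (Num.min (rho / 2) 1 * D / (2 * (2 * (`|w| + `|p| + 1)))).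
have Q0 : 0 < 2 * (`|w| + `|p| + 1) :> R by rewrite mulr_gt0// ltr_wpDl// addr_ge0.
have e0 : 0 < e.
  have m0 : 0 < Num.min (rho / 2) 1 by rewrite lt_min ltr01 divr_gt0.
  by rewrite lt_min invr_gt0 ltr0n divr_gt0// mulr_gt0.
have eb (v x : 'rV[R]_2) : `|v| <= `|w| + `|p| -> `|x| < e ->
    `|dot v x / D| <= Num.min (rho / 2) 1.
  move=> hv hx; rewrite normrM (gtr0_norm (x := D^-1)) ?invr_gt0// ler_pdivrMr//.
  apply: le_trans (norm_dot_le _ _) _.
  apply: (@le_trans _ _ (2 * (`|w| + `|p| + 1) * e)).
    apply: ler_pM; rewrite ?mulr_ge0//.
      by rewrite ler_wpM2l//; apply: le_trans hv _; rewrite lerDl.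
    exact: ltW.
  apply: (@le_trans _ _ (2 * (`|w| + `|p| + 1) *
      (Num.min (rho / 2) 1 * D / (2 * (2 * (`|w| + `|p| + 1)))))).
    by rewrite ler_pM2l// ge_min lexx orbT.
  have m0 : 0 < Num.min (rho / 2) 1 * D by rewrite mulr_gt0// lt_min ltr01 divr_gt0.
  move: m0 Q0; move: (_ * D) (2 * (_ + _)) => u v' u0 v0.
  have -> : v' * (u / (2 * v')) = u / 2 by field; rewrite gt_eqF.
  by rewrite ler_pdivrMr//; lra.
exists e => //; exists sigma; split.
- move=> a f g bf bg; rewrite /sigma -riemann_lin; [|exact: bchi|exact: bchi].
  by congr riemann; apply/funext => s; case: ifP; rewrite ?mulr0 ?addr0.
- move=> f bf f0; apply: riemann_ge0; first exact: bchi.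
  by move=> s; case: ifP.
- exists (((`|w| + `|p|) / D) `^ (1 / 2) * `|C|) => zeta.
  set a := dot zeta w; set b := dot zeta p.
  have -> : sigma (fun x => cos (dot zeta x)) =
      riemann (fun s => if `|s| <= rho1 / 2 then cos (a * s + b * phi s) else 0).
    congr riemann; apply/funext => s; case: ifP => // _.
    by rewrite /X dotDr !dotZr mulrC [phi s * _]mulrC.
  have hz : `|zeta| <= (`|w| + `|p|) / D * Num.max `|a| `|b|.
    rewrite {1}(basis zeta) ![dot _ zeta]dotC -/a -/b.
    apply: le_trans (ler_normD _ _) _; rewrite !normrZ.
    rewrite (gtr0_norm (x := D^-1)) ?invr_gt0//.
    have -> : (`|w| + `|p|) / D * Num.max `|a| `|b| =
      Num.max `|a| `|b| / D * `|w| + Num.max `|a| `|b| / D * `|p| by ring.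
    by rewrite lerD// ler_wpM2r// ler_wpM2r ?invr_ge0 ?(ltW D0)// le_max lexx ?orbT.
  have T0 : 0 <= Num.max `|a| `|b| by rewrite le_max normr_ge0.
  have A0 : 0 <= (`|w| + `|p|) / D by rewrite divr_ge0 ?addr_ge0// ltW.
  apply: (@le_trans _ _ (((`|w| + `|p|) / D) `^ (1 / 2) *
      (Num.max `|a| `|b| `^ (1 / 2) * `|riemann (fun s =>
        if `|s| <= rho1 / 2 then cos (a * s + b * phi s) else 0)|))).
    rewrite mulrA -powRM// ler_wpM2r// ge0_ler_powR ?nnegrE ?mulr_ge0 ?divr_ge0 ?invr_ge0 ?(ltW D0)//.
  rewrite ler_wpM2l ?powR_ge0//; apply: le_trans (hC a b) _; exact: ler_norm.
pose c1 := Num.min (rho / 2) (`|w| + L * `|p| + 1)^-1.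
have c10 : 0 < c1 by rewrite lt_min divr_gt0//= invr_gt0.
have c1a : c1 <= rho / 2 by rewrite ge_min lexx.
have c1b : c1 <= (`|w| + L * `|p| + 1)^-1 by rewrite ge_min lexx orbT.
exists c1 => // q r f [bq qp] /andP[r0 r1] bf f0 f1.
move: qp; rewrite ball_rowE /= distrC => qe.
pose s0 := dot w q / D; pose y0 := dot p q / D.
have qE : q = s0 *: w + y0 *: p by exact: basis.
have hs0 : `|s0| <= rho / 2.
  have := eb w (q - p); rewrite lerDl normr_ge0 => /(_ isT qe).
  by rewrite dotBr wp subr0 le_min => /andP[].
(* Nonnegative height places [q] on the branch described by [phi]. *)
have hy0 : 0 <= y0.
  have := eb p (q - p); rewrite lerDr normr_ge0 => /(_ isT qe).
  rewrite dotBr pD mulrBl divff ?gt_eqF// le_min => /andP[_]; rewrite ler_norml => /andP[h _].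
  by rewrite /y0; lra.
have hs1 : `|s0| <= rho1 by move: hs0; rewrite /rho; lra.
have yE : y0 = phi s0.
  by apply: hatt => //; rewrite -qE; exact: boundaryE.
have cr0 : 0 < c1 * r by rewrite mulr_gt0.
have cr1 : c1 * r <= rho / 2 by apply: le_trans c1a; rewrite ler_piMr// ltW.
rewrite expr1.
have -> : c1 * r = ((s0 + c1 * r) - (s0 - c1 * r)) / 2 by field.
apply: riemann_lower; [lra|exact: bchi|by move=> s; case: ifP|].
move=> s /andP[s1 s2].
have ss0 : `|s - s0| <= c1 * r by rewrite ler_norml; apply/andP; split; lra.
have hs : `|s| <= rho.
  by have := ler_normD (s - s0) s0; rewrite subrK; lra.
rewrite hs; apply: f1.
have hs' : `|s| <= rho1 by move: hs; rewrite /rho; lra.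
have -> : X s - q = (s - s0) *: w + (phi s - phi s0) *: p.
  by rewrite qE yE /X opprD addrACA -!scalerBl.
apply: le_trans (ler_normD _ _) _; rewrite !normrZ.
have h1 := hlip s s0 hs' hs1.
have h2 : `|phi s - phi s0| * `|p| <= L * `|s - s0| * `|p| by rewrite ler_wpM2r.
have h3 : `|s - s0| * (`|w| + L * `|p| + 1) <= c1 * r * (`|w| + L * `|p| + 1).
  by rewrite ler_wpM2r// ltW.
have h4 : c1 * (`|w| + L * `|p| + 1) <= 1.
  by rewrite -ler_pdivlMr// mul1r.
have h5 : c1 * (`|w| + L * `|p| + 1) * r <= 1 * r by rewrite ler_wpM2r// ltW.
have := normr_ge0 (s - s0).
clear h1 hC hlip hatt basis eb bchi f0; lra.
Qed.

End ChordLocalDecay.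

(** * From local to global decay *)

Section Globalize.
Context {R : realType} {d : nat}.
Implicit Types (S : set 'rV[R]_d) (gamma : R).

Lemma decay_functional_sub gamma S1 S2 sigma : S1 `<=` S2 ->
  decay_functional gamma S2 sigma -> decay_functional gamma S1 sigma.
Proof.
move=> S12 [h1 h2 h3 [c c0 h4]]; split => //.
by exists c => // q r f /S12; exact: h4.
Qed.

Lemma decay_functional_set0 gamma :
  decay_functional gamma (set0 : set 'rV[R]_d) (fun=> 0).
Proof.
split => //.
- by move=> a f g _ _; rewrite mulr0 addr0.
- by exists 0 => zeta; rewrite normr0 mulr0.
- by exists 1.
Qed.

Lemma decay_functionalU gamma S1 S2 s1 s2 : decay_functional gamma S1 s1 ->
  decay_functional gamma S2 s2 ->
  decay_functional gamma (S1 `|` S2) (fun f => s1 f + s2 f).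
Proof.
move=> [a1 a2 [C a3] [c c0 a4]] [b1 b2 [C' b3] [c' c'0 b4]]; split.
- by move=> a f g bf bg; rewrite a1// b1//; ring.
- by move=> f bf f0; rewrite addr_ge0 ?a2 ?b2.
- exists (C + C') => zeta; apply: le_trans (lerD (a3 zeta) (b3 zeta)).
  by rewrite -mulrDr ler_wpM2l ?powR_ge0// ler_normD.
exists (Num.min c c') => [|q r f Sq r01 bf f0 f1]; first by rewrite lt_min c0.
have r0 : 0 <= r ^+ d.-1 by case/andP: r01 => /ltW *; rewrite exprn_ge0.
case: Sq => Sq.
  apply: (@le_trans _ _ (c * r ^+ d.-1)); first by rewrite ler_wpM2r// ge_min lexx.
  by apply: le_trans (a4 q r f Sq r01 bf f0 f1) _; rewrite lerDl b2.
apply: (@le_trans _ _ (c' * r ^+ d.-1)); first by rewrite ler_wpM2r// ge_min lexx orbT.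
by apply: le_trans (b4 q r f Sq r01 bf f0 f1) _; rewrite lerDr a2.
Qed.

(** The local functionals are added without a partition of unity: decay is an upper bound, stable
    under finite sums, and the lower mass bound only improves when a nonnegative functional is
    added. *)
Lemma decay_globalize gamma S : compact S ->
  (forall p, S p -> exists2 e : R, 0 < e & exists sigma,
     decay_functional gamma (S `&` ball p e) sigma) ->
  exists sigma, decay_functional gamma S sigma.
Proof.
move=> cS loc.
have [e he] : exists e : 'rV[R]_d -> R, forall p, S p -> 0 < e p /\
    exists sigma, decay_functional gamma (S `&` ball p (e p)) sigma.
  have /choice[e he] : forall p, exists e : R, S p -> 0 < e /\
      exists sigma, decay_functional gamma (S `&` ball p e) sigma.
    move=> p; have [Sp|nSp] := pselect (S p); last by exists 1.
    by have [e e0 hs] := loc p Sp; exists e.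
  by exists e.
move: cS; rewrite compact_cover => /(_ _ S (fun p => ball p (e p))) [].
- by move=> p /he[e0 _]; exact: ball_open.
- by move=> p Sp; exists p => //; apply: ballxx; have [] := he p Sp.
move=> s sS cov.
have : exists sigma, decay_functional gamma
    (\bigcup_(p in [set` finmap.enum_fset s]) (S `&` ball p (e p))) sigma.
  have : forall p, p \in (finmap.enum_fset s) -> S p by move=> p ps; have := sS p ps; rewrite in_setE.

  elim: (finmap.enum_fset s) => [|p l IH] hl.
    exists (fun=> 0); apply: decay_functional_sub (decay_functional_set0 _).
    by move=> x [].
  have [|s1 h1] := IH; first by move=> q ql; apply: hl; rewrite inE ql orbT.
  have [_ [s2 h2]] := he p (hl p (mem_head _ _)).
  exists (fun f => s1 f + s2 f); apply: decay_functional_sub (decay_functionalU h1 h2).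
  move=> x [q /=]; rewrite inE => /orP[/eqP->|ql] hx; first by right.
  by left; exists q.
move=> [sigma h]; exists sigma; apply: decay_functional_sub h.
by move=> x Sx; have [q qs hx] := cov x Sx; exists q.
Qed.

End Globalize.

(** * Null sets *)

Section Covers.
Context {R : realType}.
Implicit Types (D : set R) (F : nat -> set R) (p e r : nat -> R).

Lemma sum_half_powers n : \sum_(k < n) 2^-1 ^+ k.+1 <= 1 :> R.
Proof.
suff -> : \sum_(k < n) 2^-1 ^+ k.+1 = 1 - 2^-1 ^+ n :> R.
  by rewrite gerBl exprn_ge0.
elim: n => [|n IH]; first by rewrite big_ord0 expr0 subrr.
by rewrite big_ord_recr/= IH exprS; field.
Qed.

(** Each nonempty set is replaced by an open interval about one of its points, as compactness
    requires. The radius exceeds [r k] so little, even for [r k = 0], that the extra costs form a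
    geometric series of sum at most [c]. *)
Lemma cover_thicken (beta c : R) D F r : 0 < beta -> 0 < c ->
  D `<=` \bigcup_k F k -> (forall k, 0 <= r k) ->
  (forall k x y, F k x -> F k y -> `|x - y| <= r k) ->
  (forall n, \sum_(k < n) r k `^ beta <= c) ->
  exists p e, [/\ forall k, 0 < e k, forall z, D z -> exists k, `|z - p k| < e k &
    forall n, \sum_(k < n) e k `^ beta <= 2 * c].
Proof.
move=> b0 c0 cov r0 hF hs.
pose eta k := c * 2^-1 ^+ k.+1.
have eta0 k : 0 < eta k by rewrite mulr_gt0// exprn_gt0// invr_gt0.
pose g k := r k `^ beta + eta k.
have g0 k : 0 < g k by rewrite ltr_wpDl// powR_ge0.
exists (fun k => xget 0 (F k)), (fun k => g k `^ beta^-1); split.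
- by move=> k; rewrite powR_gt0.
- move=> z /cov[k _ Fz]; exists k.
  apply: le_lt_trans (hF k z _ Fz _) _; first by apply: xgetPex; exists z.
  have -> : r k = (r k `^ beta) `^ beta^-1.
    by rewrite -powRrM mulfV ?gt_eqF// powRr1.
  by rewrite gt0_ltr_powR ?invr_gt0 ?nnegrE ?powR_ge0 ?(ltW (g0 k))// ltrDl.
move=> n; under eq_bigr do rewrite -powRrM mulVf ?gt_eqF// powRr1 ?(ltW (g0 _))//.
rewrite big_split/= -mulr_sumr.
have := hs n; have : c * \sum_(i < n) 2^-1 ^+ i.+1 <= c * 1.
  by rewrite ler_wpM2l ?(ltW c0)// sum_half_powers.
lra.
Qed.

Lemma compact_finite_cover D p e : compact D -> (forall k, 0 < e k) ->
  (forall z, D z -> exists k, `|z - p k| < e k) ->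
  exists n, forall z, D z -> exists2 k, (k < n)%N & `|z - p k| < e k.
Proof.
move=> cD e0 cov.
move: cD; rewrite compact_cover => /(_ _ [set: nat] (fun k => ball (p k) (e k))) [].
- by move=> k _; exact: ball_open.
- by move=> z /cov[k hk]; exists k => //; rewrite /ball/= distrC.
move=> s _ hs; exists (\max_(k <- finmap.enum_fset s) k).+1 => z /hs[k ks].
rewrite /ball/= distrC => hk; exists k => //.
by rewrite ltnS (leq_bigmax_seq (F := id)).
Qed.

End Covers.

Section DistanceSets.
Context {R : realType} {d : nat}.
Implicit Types (K E : set 'rV[R]_d).

Lemma distance_set_compact K E : symmetric_convex_body K -> compact E ->
  compact (distance_set K E).
Proof.
move=> bodyK cE.
have -> : distance_set K E =
    (fun z : 'rV[R]_d * 'rV[R]_d => body_norm K (z.1 - z.2)) @` (E `*` E).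
  apply/seteqP; split => [z [x Ex [y Ey <-]]|z [[x y] [/= Ex Ey] <-]].
    by exists (x, y).
  by exists x => //; exists y.
apply: continuous_compact; last exact: compact_setX.
apply: continuous_subspaceT => z.
have [r r0 hr] := body_norm_lipschitz bodyK.
have cN : continuous (body_norm K).
  move=> x A /nbhs_ballP[eps /= eps0 hA].
  apply/nbhs_ballP; exists (eps * r) => /=; first by rewrite mulr_gt0.
  move=> y; rewrite ball_rowE /= => xy; apply: hA; rewrite /ball/=.
  by apply: le_lt_trans (hr x y) _; rewrite ltr_pdivrMr.
apply: (@continuous_comp _ _ _ (fun z : 'rV[R]_d * 'rV[R]_d => z.1 - z.2) (body_norm K)); last exact: cN.
by apply: cvgB; [exact: cvg_fst|exact: cvg_snd].
Qed.

Lemma distance_set_content K E gamma sigma (s beta : R) :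
  symmetric_convex_body K -> decay_functional gamma (boundary K) sigma ->
  (0 < d)%N -> 0 <= gamma -> 0 < beta <= 1 -> 0 < s -> beta + d%:R - 1 - gamma < s ->
  E `<=` unit_cube -> compact E -> hausdorff_measure eucl_dist s E != 0%E ->
  exists2 c, 0 < c & forall (F : nat -> set R) (r : nat -> R),
    distance_set K E `<=` \bigcup_k F k -> (forall k, 0 <= r k) ->
    (forall k x y, F k x -> F k y -> `|x - y| <= r k) ->
    ~ (forall n, \sum_(k < n) r k `^ beta <= c).
Proof.
move=> bodyK sP d0 g0 /andP[b0 b1] s0 hs EU cE mE.
have [|c c0 hc] := distance_cover_bound bodyK sP d0 g0 _ s0 hs EU mE.
  by rewrite (ltW b0).
(* Thickening doubles the bound, and [2 * c / 3] is still below [c]. *)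
exists (c / 3) => [|F r cov r0 hF hn]; first by rewrite divr_gt0.
have c30 : 0 < c / 3 by rewrite divr_gt0.
have [p [e [e0 he hsum]]] := cover_thicken b0 c30 cov r0 hF hn.
have [n hfin] := compact_finite_cover (distance_set_compact bodyK cE) e0 he.
have := hc [seq (p k, e k) | k <- iota 0 n].
have h1 q : q \in [seq (p k, e k) | k <- iota 0 n] -> 0 < q.2 by move=> /mapP[k _ ->] /=.
move=> /(_ h1); have h2 z : distance_set K E z ->
    exists2 q : R * R, q \in [seq (p k, e k) | k <- iota 0 n] & `|z - q.1| < q.2.
  move=> /hfin[k kn hk]; exists (p k, e k) => //.
  by apply/mapP; exists k => //; rewrite mem_iota.
move=> /(_ h2); rewrite big_map.
rewrite -[X in iota 0 X]subn0 big_mkord => h3.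
by have := hsum n; lra.
Qed.

End DistanceSets.

Section NullSets.
Context {R : realType}.

Lemma hausdorff_measure_lt_dim (T : Type) (dist : T -> T -> R) (E : set T) (alpha s : R) :
  hausdorff_dim dist E = alpha%:E -> 0 <= s < alpha -> hausdorff_measure dist s E != 0%E.
Proof.
move=> dE /andP[s0 sa]; apply/eqP => m0.
have : (hausdorff_dim dist E <= s%:E)%E by apply: ereal_inf_lbound; exists s.
by rewrite dE lee_fin leNgt sa.
Qed.

(* The exponent is raised from [s] to [beta] so that single points, which cost
   [1] when [s = 0], become free. *)
Lemma hausdorff_null_cover (D : set R) (s beta c : R) : 0 <= s -> s < beta -> 0 < c ->
  hausdorff_measure (fun x y : R => `|x - y|) s D = 0%E ->
  exists (F : nat -> set R) (r : nat -> R),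
    [/\ D `<=` \bigcup_k F k, forall k, 0 <= r k,
        forall k x y, F k x -> F k y -> `|x - y| <= r k &
        forall n, \sum_(k < n) r k `^ beta <= c].
Proof.
move=> s0 sb c0 m0; set dist := fun x y : R => `|x - y|.
have : (hausdorff_premeasure dist s 1 D < c%:E)%E.
  apply: (@le_lt_trans _ _ 0%E); last by rewrite lte_fin.
  by rewrite -m0; apply: ereal_sup_ubound; exists 1 => /=.
move=> /ereal_inf_lt[_ [F [cov F1] <-] hsum].
have fF k : ediam dist (F k) \is a fin_num.
  by rewrite ge0_fin_numE ?ediam_ge0//; apply: le_lt_trans (F1 k) _; exact: ltry.
exists F, (fun k => fine (ediam dist (F k))); split => //.
- by move=> k; rewrite fine_ge0// ediam_ge0.
- move=> k x y Fx Fy; rewrite -lee_fin fineK//.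
  by apply: ereal_sup_ubound; right; exists x => //; exists y.
move=> n; rewrite -lee_fin; apply: le_trans (ltW hsum).
have cost0 k : (0 <= hausdorff_cost dist s (F k))%E by exact: hausdorff_cost_ge0.
apply: le_trans (nneseries_lim_ge n _) => //.
rewrite big_mkord -sumEFin; apply: lee_sum => k _.
have b0 : beta != 0 by rewrite gt_eqF// (le_lt_trans s0).
rewrite /hausdorff_cost; case: ifP => [/eqP->|_]; first by rewrite ediam0/= powR0.
have := ediam_ge0 dist (F k); have := F1 k; have := fF k.
case: (ediam dist (F k)) => [t||]//= _; rewrite !lee_fin => t1 t0.
have [->|tn] := eqVneq t 0; first by rewrite powR0// powR_ge0.
by apply: ger_powR (ltW sb); rewrite t1 lt_neqAle eq_sym tn t0.
Qed.

Lemma lebesgue_null_cover (D : set R) (c : R) : 0 < c -> lebesgue_measure D = 0%E ->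
  exists (F : nat -> set R) (r : nat -> R),
    [/\ D `<=` \bigcup_k F k, forall k, 0 <= r k,
        forall k x y, F k x -> F k y -> `|x - y| <= r k &
        forall n, \sum_(k < n) r k `^ 1 <= c].
Proof.
move=> c0 m0; have : (lebesgue_measure D < c%:E)%E by rewrite m0 lte_fin.
rewrite /lebesgue_measure/= /lebesgue_stieltjes_measure/= /measure_extension/=.
move=> /ereal_inf_lt[_ [F [mF cov] <-] hsum].
have /choice[ab hab] : forall k, exists ab : R * R, F k = [set` `]ab.1, ab.2]].
  by move=> k; have [ab _ h] := mF k; exists ab.
have wl k : wlength idfun (F k) = (Num.max 0 ((ab k).2 - (ab k).1))%:E :> \bar R.
  rewrite hab wlength_itv/= lte_fin; case: ltP => h.
    by rewrite max_r// subr_ge0 ltW.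
  by rewrite max_l// subr_le0.
exists F, (fun k => Num.max 0 ((ab k).2 - (ab k).1)); split => //.
- by move=> k; rewrite le_max lexx.
- move=> k x y; rewrite hab/= !in_itv/= => /andP[x1 x2] /andP[y1 y2].
  by rewrite le_max; apply/orP; right; rewrite ler_norml; apply/andP; split; lra.
move=> n; rewrite -lee_fin; apply: le_trans (ltW hsum).
apply: le_trans (nneseries_lim_ge n _); last first.
  by move=> k _ _; rewrite wl lee_fin le_max lexx.
rewrite big_mkord -sumEFin; apply: lee_sum => k _.
by rewrite wl powRr1// le_max lexx.
Qed.

End NullSets.

Section DistanceSetSize.
Context {R : realType} {d : nat}.
Variables (K E : set 'rV[R]_d) (gamma alpha : R).
Variable sigma : ('rV[R]_d -> R) -> R.
Hypotheses (bodyK : symmetric_convex_body K)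
  (sigmaP : decay_functional gamma (boundary K) sigma).
Hypotheses (d0 : (0 < d)%N) (gamma0 : 0 <= gamma) (gammad : gamma <= d%:R - 1).
Hypotheses (EU : E `<=` unit_cube) (cE : compact E).
Hypotheses (dimE : hausdorff_dim eucl_dist E = alpha%:E).

Lemma distance_set_dim :
  ((Num.min 1 (alpha - (d%:R - 1 - gamma)))%:E <=
    hausdorff_dim (fun s t : R => `|s - t|%R) (distance_set K E))%E.
Proof.
apply: le_ereal_inf_tmp => _ [s [s0 ms] <-]; rewrite lee_fin leNgt; apply/negP.
set m := Num.min _ _ => sm; have gd := gammad.
have [m1 m2] : m <= 1 /\ m <= alpha - (d%:R - 1 - gamma).
  by rewrite !ge_min !lexx orbT.
(* [beta] lies strictly between [s] and [m], and [s'] strictly between [beta + d - 1 - gamma] and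
   [alpha]; at the exponent [s'] the measure of [E] is nonzero. *)
pose beta := (s + m) / 2.
pose s' := (beta + (d%:R - 1 - gamma) + alpha) / 2.
have sb : s < beta by rewrite /beta; lra.
have bm : beta < m by rewrite /beta; lra.
have b0 : 0 < beta by apply: le_lt_trans sb.
have b1 : 0 < beta <= 1 by rewrite b0; lra.
have s'0 : 0 < s' by rewrite /s'; clearbody beta m; lra.
have s'a : 0 <= s' < alpha by rewrite (ltW s'0)/= /s'; clearbody beta m; lra.
have s'b : beta + d%:R - 1 - gamma < s' by rewrite /s'; clearbody beta m; lra.
have mE := hausdorff_measure_lt_dim dimE s'a.
have [c c0 hc] := distance_set_content bodyK sigmaP d0 gamma0 b1 s'0 s'b EU cE mE.
by have [F [r [h1 h2 h3 h4]]] := hausdorff_null_cover s0 sb c0 ms; exact: hc h1 h2 h3 h4.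
Qed.

(** With [beta = 1] the powers of lengths are lengths, and the condition on the exponent becomes
    [d - gamma < s']. *)
Lemma distance_set_lebesgue : d%:R - gamma < alpha ->
  (0 < lebesgue_measure (distance_set K E))%E.
Proof.
move=> ha; have gd := gammad; rewrite lt_neqAle measure_ge0 andbT eq_sym; apply/negP => /eqP m0.
pose s' := (d%:R - gamma + alpha) / 2.
have s'0 : 0 < s' by rewrite /s'; lra.
have s'a : 0 <= s' < alpha by rewrite (ltW s'0)/= /s'; lra.
have s'b : 1 + d%:R - 1 - gamma < s' by rewrite /s'; lra.
have mE := hausdorff_measure_lt_dim dimE s'a.
have b1 : 0 < (1 : R) <= 1 by rewrite ltr01 lexx.
have [c c0 hc] := distance_set_content bodyK sigmaP d0 gamma0 b1 s'0 s'b EU cE mE.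
by have [F [r [h1 h2 h3 h4]]] := lebesgue_null_cover c0 m0; exact: hc h1 h2 h3 h4.
Qed.

End DistanceSetSize.

Theorem corollary0p2 (R : realType) :
  (forall K : set 'rV[R]_2,
     symmetric_convex_body K ->
     (exists2 c : R, 0 < c &
        forall theta eps : R, 0 <= theta < 2 * pi -> 0 < eps ->
          (chord_length K theta eps <= (c * Num.sqrt eps)%:E)%E) ->
     forall (E : set 'rV[R]_2) (alpha : R),
       E `<=` unit_cube -> compact E ->
       hausdorff_dim eucl_dist E = alpha%:E -> 1 / 2 < alpha ->
       ((Num.min 1 (alpha - 1 / 2))%:E <=
          hausdorff_dim (fun s t : R => `|s - t|%R) (distance_set K E))%E /\
       (3 / 2 < alpha -> (0 < lebesgue_measure (distance_set K E))%E)) /\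
  (forall (d : nat) (K : set 'rV[R]_d),
     (2 <= d)%N ->
     symmetric_convex_body K ->
     smooth_hypersurface (boundary K) ->
     nonvanishing_curvature (boundary K) ->
     forall (E : set 'rV[R]_d) (alpha : R),
       E `<=` unit_cube -> compact E ->
       hausdorff_dim eucl_dist E = alpha%:E -> (d%:R + 1) / 2 < alpha ->
       (0 < lebesgue_measure (distance_set K E))%E).
Proof.
split.
- move=> K bodyK [c c0 chordK] E alpha EU cE dimE _.
  have [sigma sigmaP] : exists sigma, decay_functional (1 / 2) (boundary K) sigma.
    apply: decay_globalize (boundary_compact bodyK) _ => p Sp.
    exact: (chord_local_decay bodyK c0 chordK Sp).
  (* In the plane with [gamma = 1 / 2], the loss [d - 1 - gamma] is [1 / 2] and the threshold
     [d - gamma] is [3 / 2]. *)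
  have g0 : 0 <= 1 / 2 :> R by lra.
  have gd : 1 / 2 <= 2%:R - 1 :> R by lra.
  split => [|a32].
    have := distance_set_dim bodyK sigmaP isT g0 gd EU cE dimE.
    by have -> : (2%:R - 1 - 1 / 2 : R) = 1 / 2 by field.
  by apply: (distance_set_lebesgue bodyK sigmaP) dimE _ => //; lra.
move=> d K d2 bodyK hS hcurv E alpha EU cE dimE ha.
have [sigma sigmaP] : exists sigma, decay_functional (d.-1%:R / 2) (boundary K) sigma.
  by apply: decay_globalize (boundary_compact bodyK) _ => p Sp; exact: smooth_local_decay.
have d1 : d.-1%:R = d%:R - 1 :> R by rewrite -[in RHS](prednK (ltnW d2)) -natr1 addrK.
have d2R : 2 <= d%:R :> R by rewrite ler_nat.
(* Here [gamma = (d - 1) / 2], so that [d - gamma = (d + 1) / 2]. *)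
rewrite d1 in sigmaP.
have g0 : 0 <= (d%:R - 1) / 2 :> R by lra.
have gd : (d%:R - 1) / 2 <= d%:R - 1 :> R by lra.
by apply: (distance_set_lebesgue bodyK sigmaP (ltnW d2) g0 gd EU cE dimE); lra.
Qed.
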